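(* Let $f$ and $\mathcal{P}=\{\mathsf{P}^*\}$ satisfy conditions (A1)–(A4) listed in the context, let the interest rate $r$ and the depreciation rate $\beta>0$ be constants, and let $C$ be an optimal consumption plan for $\sup_{C'\in\mathcal{A}(w)}U_0^{C'}$, $w>0$, with Lagrange multiplier $M>0$ (as described in the context). Let $\tau_0<\tau_1$ be two stopping times such that $[\tau_0,\tau_1]$ is a free interval, i.e. consumption under $C$ occurs at a strictly positive rate throughout the interval. Then for all $t\in(\tau_0,\tau_1)$, $$F_t(C)=M\,\frac{r+\beta}{\beta}\,\psi_t .$$
   Context: Fix $T>0$. Let $(\Omega,\mathcal{F},\mathsf{P}_0)$ be a probability space carrying a standard Brownian motion $B=\{B_t\}_{t\in[0,T]}$ and a Poisson random measure $v(dt,dx)$ on $\mathbb{R}_*=\mathbb{R}\setminus\{0\}$ (with time in $[0,T]$) with intensity $\vartheta$, a $\sigma$-finite measure on $\mathbb{R}_*$ with $\int_{\mathbb{R}_*}(1\wedge x^2)\,\vartheta(dx)<\infty$. $(\mathcal{F}_t)_{t\in[0,T]}$ is the filtration generated by $B$, $v$ and the $\mathsf{P}_0$-negligible sets. $\mathsf{E}$ is expectation under $\mathsf{P}_0$, $\mathsf{E}^*$ expectation under $\mathsf{P}^*$, and $\mathsf{E}_t[\cdot]=\mathsf{E}[\cdot\mid\mathcal{F}_t]$. The interest rate $r$ is a constant, $\gamma_t=e^{-rt}$. The financial market is complete: $\mathcal{P}=\{\mathsf{P}^*\}$ is a singleton, where $\mathsf{P}^*$ is a probability measure on $(\Omega,\mathcal{F}_T)$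 equivalent to $\mathsf{P}_0$. The state-price density is $\psi_t=e^{-rt}\,\frac{d\mathsf{P}^*}{d\mathsf{P}_0}\big|_{\mathcal{F}_t}$. $\mathcal{X}$ is the set of consumption plans: distribution functions $C=\{C_t\}_{t\in[0,T]}$ of nonnegative optional random measures on $[0,T]$, i.e. nondecreasing, right-continuous, adapted, nonnegative processes, with $C_{0-}=0$; integrals $\int_0^t\cdots dC_s$ include the possible atoms at $0$ and $t$. For $w>0$, $\mathcal{A}(w)=\{C\in\mathcal{X}:\ \mathsf{E}^*[\int_0^T\gamma_t\,dC_t]\le w\}$. The level of satisfaction is $Y^C_t=\eta e^{-\beta t}+\int_0^t\beta e^{-\beta(t-s)}\,dC_s$ with constants $\beta>0$, $\eta\ge0$. The recursive utility $U^C$ is the unique adapted càdlàg process with $\mathsf{E}[\sup_{t}|U^C_t|^2]<\infty$ satisfying $U^C_t=\mathsf{E}_t[\int_t^T f(s,Y^C_s,U^C_s)\,ds]$, $t\in[0,T]$. Set $$F_s(C)=\exp\Big(\int_0^s\partial_u f(z,Y^C_z,U^C_z)\,dz\Big)\,\partial_y f(s,Y^C_s,U^C_s),\qquad \nabla V(C)(t)=\mathsf{E}_t\Big[\int_t^T F_s(C)\,\beta e^{-\beta(s-t)}\,ds\Big],$$ the latter understood as an optional projection. An optimal plan $C$ is characterized by the existence of a finite Lagrange multiplier $M>0$ with: (i) $\mathsf{E}[\int_0^T\psi_t\,dC_t]=w$; (ii) $\nabla V(C)(t)\le M\psi_t$ for any $t\in[0,T]$, $\mathsf{P}_0$-a.s.;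 (iii) $\mathsf{E}[\int_0^T(\nabla V(C)(t)-M\psi_t)\,dC_t]=0$. $M$ in the claim is this multiplier. ''Consumption at a strictly positive rate'' on $[\tau_0,\tau_1]$ means $dC_t=c_t\,dt$ there with $c_t>0$. Conditions on the Borel measurable aggregator $f:[0,T]\times\mathbb{R}_+\times\mathbb{R}\to\mathbb{R}$, $(s,y,u)\mapsto f(s,y,u)$, and on $\mathsf{P}^*$: (A1) for every $s\in[0,T]$, $f(s,\cdot,\cdot)$ is strictly concave and continuously differentiable, and for every $s\in[0,T]$, $u\in\mathbb{R}$, $f(s,\cdot,u)$ is strictly increasing; (A2) there is a constant $K$ with $|f(s,y,u)-f(s,y,u')|\le K|u-u'|$ for all $(s,y)\in[0,T]\times\mathbb{R}_+$, $u,u'\in\mathbb{R}$; (A3) there are constants $\alpha\in(0,\frac12)$ and $K$ with $|f(s,y,0)|\le K(1+|y|^\alpha)$ for all $s\in[0,T]$, $y\in\mathbb{R}_+$; (A4) there exists $p>1$ with $2\alpha p<1$ such that $\frac{d\mathsf{P}_0}{d\mathsf{P}^*}\in L^q(\mathsf{P}^* )$ for $q=\frac{1}{1-2\alpha p}$.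
   Formalization: Since f is only Borel in time, the identity is claimed for almost every t in (τ0,τ1) and every t where F(C) is right-continuous; ''free interval'' also requires C to increase immediately after τ1 (if τ1<T), as the claim fails if consumption stops at a jump time τ1. *)

(* Defs.v *)
From HB Require Import structures.
From mathcomp Require Import all_boot all_order all_algebra.
From mathcomp Require Import all_classical all_reals all_analysis measurable_realfun.

Set Implicit Arguments.
Unset Strict Implicit.
Unset Printing Implicit Defensive.
Import Order.TTheory GRing.Theory Num.Theory.
Import numFieldNormedType.Exports.

Local Open Scope classical_set_scope.
Local Open Scope ring_scope.

(* Processes are functions of (t, omega) with t : R, of which only the values
   at times t in [0, T] matter.  A filtration is a family F of sigma-algebras,
   [F t A] meaning that the event A belongs to F_t. *)

Section driving_noise.
Context {d : measure_display} {Omega : measurableType d} {R : realType}.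
Variables (T : R) (P : probability Omega R).

(* In the product rule the [A i] may be [setT], so it covers subfamilies. *)
Definition independent_rv (S : Type) (mS : set (set S)) (n : nat)
    (X : 'I_n -> Omega -> S) : Prop :=
  forall A : 'I_n -> set S, (forall i, mS (A i)) ->
    P (\bigcap_i (X i @^-1` A i)) = (\prod_(i < n) P (X i @^-1` A i))%E.

(* [normal_prob m s] has standard deviation s. *)
Definition brownian_motion (B : R -> Omega -> R) : Prop :=
  [/\ forall t, 0 <= t <= T -> measurable_fun [set: Omega] (B t),
      {ae P, forall w, B 0 w = 0 /\ {within `[0, T], continuous (B ^~ w)}},
      forall s t, 0 <= s -> s < t -> t <= T ->
        forall A : set R, measurable A ->
          P ((fun w => B t w - B s w) @^-1` A)
          = normal_prob 0 (Num.sqrt (t - s)) A &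
      forall (n : nat) (t : nat -> R), 0 <= t 0%N -> t n <= T ->
        {homo t : i j / (i <= j)%N >-> i <= j} ->
        independent_rv (@measurable _ R)
          (fun (i : 'I_n) w => B (t i.+1) w - B (t i) w)].

Definition levy_measure (theta : {sigma_finite_measure set R -> \bar R}) : Prop :=
  theta [set 0] = 0%E /\
  (\int[theta]_(x in [set x | x != 0%R]) (Num.min 1 (x ^+ 2))%:E < +oo)%E.

Definition strip (t : R) : set (R * R) := `[0, t] `*` [set x | x != 0].

(* [v w E] is the number of points of the configuration w in E; the mean
   measure is dt (x) theta.  The second argument of the library's
   [poisson_prob] is a dummy. *)
Definition poisson_random_measure
    (theta : {sigma_finite_measure set R -> \bar R})
    (v : Omega -> {measure set (R * R) -> \bar R}) : Prop :=
  let mu := (lebesgue_measure \x theta)%E in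
  [/\ forall E, measurable E -> E `<=` strip T ->
        measurable_fun [set: Omega] (fun w => v w E),
      forall E, measurable E -> E `<=` strip T -> (mu E < +oo)%E ->
        forall k : nat, P [set w | v w E = k%:R%:E]
          = poisson_prob (fine (mu E)) k [set k],
      forall E, measurable E -> E `<=` strip T -> mu E = +oo%E ->
        {ae P, forall w, v w E = +oo%E} &
      forall (n : nat) (E : 'I_n -> set (R * R)),
        (forall i, measurable (E i) /\ E i `<=` strip T) ->
        trivIset setT E ->
        independent_rv (@measurable _ (\bar R)) (fun i w => v w (E i))].

(* The negligible sets are represented by the null events of the sigma-algebra
   of Omega; when P is complete these are all the P-negligible sets. *)
Definition noise_filtration (B : R -> Omega -> R)
    (v : Omega -> {measure set (R * R) -> \bar R}) (t : R) : set (set Omega) :=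
  <<s [set A | [\/ exists s X, [/\ 0 <= s <= t, measurable X
                                 & A = B s @^-1` X],
                   exists E X, [/\ measurable E, E `<=` strip t, measurable X
                                 & A = (fun w => v w E) @^-1` X]
                 | measurable A /\ P A = 0%E]] >>.

End driving_noise.

Section stochastic_processes.
Context {d : measure_display} {Omega : measurableType d} {R : realType}.
Variables (T : R) (P : probability Omega R) (F : R -> set (set Omega)).

Definition measurable_wrt {d' : measure_display} {V : measurableType d'}
    (G : set (set Omega)) (X : Omega -> V) : Prop :=
  measurable_fun [set: g_sigma_algebraType G] X.

Definition adapted (X : R -> Omega -> R) : Prop :=
  forall t, 0 <= t <= T -> measurable_wrt (F t) (X t).

Definition cadlag (X : R -> Omega -> R) : Prop :=
  forall w,
    (forall t, 0 <= t -> t < T -> X s w @[s --> t^'+] --> X t w) /\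
    (forall t, 0 < t -> t <= T -> cvg (X s w @[s --> t^'-])).

Definition is_cond_exp (G : set (set Omega)) (X : Omega -> \bar R)
    (Z : Omega -> R) : Prop :=
  [/\ P.-integrable setT X, measurable_wrt G Z &
      forall A, G A -> (\int[P]_(w in A) (Z w)%:E = \int[P]_(w in A) X w)%E].

Definition stopping_time (tau : Omega -> R) : Prop :=
  (forall w, 0 <= tau w <= T) /\
  forall t, 0 <= t <= T -> F t [set w | tau w <= t].

Definition stopped_sigma_algebra (tau : Omega -> R) : set (set Omega) :=
  [set A | F T A /\
           forall t, 0 <= t <= T -> F t (A `&` [set w | tau w <= t])].

(* The optional sigma-algebra on [0, T] x Omega. *)
Definition optional_gen : set (set (R * Omega)) :=
  [set A | exists X : R -> Omega -> R, exists2 S : set R, measurable S &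
     [/\ adapted X, cadlag X &
         A = [set p | 0 <= p.1 <= T /\ S (X p.1 p.2)]]].

Definition optional (G : R -> Omega -> \bar R) : Prop :=
  measurable_fun ([set p | 0 <= p.1 <= T] : set (g_sigma_algebraType optional_gen))
    (fun p : R * Omega => G p.1 p.2).

(* Optional projection of a nonnegative, possibly infinite, process X:
   G is optional and G_tau = E[X_tau | F_tau] for every stopping time tau. *)
Definition optional_projection (X G : R -> Omega -> \bar R) : Prop :=
  optional G /\
  forall tau, stopping_time tau -> forall A, stopped_sigma_algebra tau A ->
    (\int[P]_(w in A) G (tau w) w = \int[P]_(w in A) X (tau w) w)%E.

End stochastic_processes.

Section aggregator.
Context {R : realType}.
Implicit Types f : R -> R -> R -> R.

Definition aggregator_domain (T : R) : set (R * R * R) :=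
  [set x | 0 <= x.1.1 <= T /\ 0 <= x.1.2].

(* The filter is that of the increments h <> 0, h -> 0 keeping y + h in R_+, so
   the derivative at y = 0 is one-sided. *)
Definition diff_quotient_y f (s y u h : R) : R := h^-1 * (f s (y + h) u - f s y u).

Definition increments (y : R) : set_system R :=
  within [set h | 0 <= y + h] (0 : R)^'.

Definition partial_y f (s y u : R) : R :=
  lim (diff_quotient_y f s y u h @[h --> increments y]).

Definition partial_u f (s y u : R) : R := (f s y)^`()%classic u.

Definition continuously_differentiable f (s : R) : Prop :=
  [/\ forall y u, 0 <= y -> cvg (diff_quotient_y f s y u h @[h --> increments y]),
      forall y u, 0 <= y -> derivable (f s y) u 1,
      {within [set p : R * R | 0 <= p.1],
         continuous (fun p : R * R => partial_y f s p.1 p.2)} &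
      {within [set p : R * R | 0 <= p.1],
         continuous (fun p : R * R => partial_u f s p.1 p.2)}].

Definition strictly_concave f (s : R) : Prop :=
  forall y u y' u' l : R, 0 <= y -> 0 <= y' -> (y, u) <> (y', u') ->
    0 < l < 1 ->
    l * f s y u + (1 - l) * f s y' u'
    < f s (l * y + (1 - l) * y') (l * u + (1 - l) * u').

Definition condA1 (T : R) f : Prop :=
  forall s, 0 <= s <= T ->
    [/\ strictly_concave f s, continuously_differentiable f s &
        forall u y y', 0 <= y -> y < y' -> f s y u < f s y' u].

Definition condA2 (T : R) f : Prop :=
  exists K : R, forall s y u u', 0 <= s <= T -> 0 <= y ->
    `|f s y u - f s y u'| <= K * `|u - u'|.

Definition condA3 (T : R) f (alpha : R) : Prop :=
  exists K : R, forall s y, 0 <= s <= T -> 0 <= y ->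
    `|f s y 0| <= K * (1 + `|y| `^ alpha).

End aggregator.

Section market.
Context {d : measure_display} {Omega : measurableType d} {R : realType}.
Variables (T : R) (P : probability Omega R) (F : R -> set (set Omega)).
Variable Pstar : probability (g_sigma_algebraType (F T)) R.

Definition equivalent_on : Prop :=
  forall A, F T A -> (P A = 0%E <-> Pstar A = 0%E).

(* g is a version of dP/dP* on F_T. *)
Definition condA4 (alpha : R) : Prop :=
  exists p : R, [/\ 1 < p, 2 * alpha * p < 1 &
    exists g : g_sigma_algebraType (F T) -> R,
      [/\ forall w, 0 <= g w,
          forall A, F T A -> (P A = \int[Pstar]_(w in A) (g w)%:E)%E &
          g \in Lfun Pstar ((1 - 2 * alpha * p)^-1)%:E]].

(* The cadlag version of e^{-rt} dP*/dP on F_t. *)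
Definition state_price_density (r : R) (psi : R -> Omega -> R) : Prop :=
  [/\ adapted T F psi, cadlag T psi &
      forall t, 0 <= t <= T -> forall A, F t A ->
        (Pstar A = \int[P]_(w in A) (expR (r * t) * psi t w)%:E)%E].

(* The paths of a plan are extended by 0 before time 0 and by C_T after T.  Its
   Lebesgue-Stieltjes measure is then carried by [0, T], with mass C_0 at 0. *)
Definition consumption_plan (C : Omega -> cumulative R R) : Prop :=
  [/\ forall w t, t < 0 -> C w t = 0,
      forall w t, T <= t -> C w t = C w T &
      adapted T F (fun t w => C w t)].

Definition dC (C : Omega -> cumulative R R) (w : Omega) :=
  lebesgue_stieltjes_measure (C w).

Definition affordable (r wealth : R) (C : Omega -> cumulative R R) : Prop :=
  consumption_plan C /\
  (\int[Pstar]_w \int[dC C w]_(t in `[0%R, T]) (expR (- (r * t)))%:E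
     <= wealth%:E)%E.

Variables (f : R -> R -> R -> R) (eta beta : R).

Definition satisfaction (C : Omega -> cumulative R R) (t : R) (w : Omega) : R :=
  eta * expR (- (beta * t)) +
  \int[dC C w]_(s in `[0, t]) (beta * expR (- (beta * (t - s)))).

Definition recursive_utility (C : Omega -> cumulative R R)
    (U : R -> Omega -> R) : Prop :=
  [/\ adapted T F U, cadlag T U,
      (\int[P]_w ereal_sup [set (`|U t w| ^+ 2)%:E | t in `[0%R, T]] < +oo)%E &
      forall t, 0 <= t <= T ->
        is_cond_exp P (F t)
          (fun w => \int[lebesgue_measure]_(s in `[t, T])
                      (f s (satisfaction C s w) (U s w))%:E)%E
          (U t)].

Definition optimal_plan (r wealth : R) (C : Omega -> cumulative R R)
    (U : R -> Omega -> R) : Prop :=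
  [/\ affordable r wealth C, recursive_utility C U &
      forall C' U', affordable r wealth C' -> recursive_utility C' U' ->
        {ae P, forall w, U' 0 w <= U 0 w}].

(* F_s(C), where U = U^C. *)
Definition marginal_felicity (C : Omega -> cumulative R R)
    (U : R -> Omega -> R) (s : R) (w : Omega) : R :=
  expR (\int[lebesgue_measure]_(z in `[0, s])
          partial_u f z (satisfaction C z w) (U z w))
  * partial_y f s (satisfaction C s w) (U s w).

Definition is_utility_gradient (C : Omega -> cumulative R R)
    (U : R -> Omega -> R) (G : R -> Omega -> \bar R) : Prop :=
  optional_projection T P F
    (fun t w => \int[lebesgue_measure]_(s in `[t, T])
       (marginal_felicity C U s w * (beta * expR (- (beta * (s - t)))))%:E)%E
    G.

Definition lagrange_multiplier (wealth : R) (psi : R -> Omega -> R)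
    (C : Omega -> cumulative R R) (G : R -> Omega -> \bar R) (M : R) : Prop :=
  [/\ (\int[P]_w \int[dC C w]_(t in `[0%R, T]) (psi t w)%:E = wealth%:E)%E,
      {ae P, forall w, forall t, 0 <= t <= T -> (G t w <= (M * psi t w)%:E)%E} &
      (\int[P]_w \int[dC C w]_(t in `[0%R, T]) (G t w - (M * psi t w)%:E)
         = 0)%E].

(* On the closed interval the measure dC is c_t dt with c > 0.  That identity
   says nothing about the single time tau1; the last clause makes the interval
   closed on the right: consumption has not stopped at tau1, i.e. C increases
   immediately after it. *)
Definition free_interval (C : Omega -> cumulative R R)
    (tau0 tau1 : Omega -> R) : Prop :=
  exists c : R -> Omega -> R, {ae P, forall w,
    [/\ measurable_fun [set: R] (c ^~ w),
        forall t, tau0 w <= t <= tau1 w -> 0 < c t w,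
        forall A : set R, measurable A -> A `<=` `[tau0 w, tau1 w] ->
          (dC C w A = \int[lebesgue_measure]_(t in A) (c t w)%:E)%E &
        forall t, tau1 w < t <= T -> C w (tau1 w) < C w t]}.

End market.

Arguments equivalent_on {d Omega R} T P F Pstar.
Arguments condA4 {d Omega R} T P F Pstar alpha.
Arguments state_price_density {d Omega R} T P F Pstar r psi.
Arguments affordable {d Omega R} T F Pstar r wealth C.
Arguments optimal_plan {d Omega R} T P F Pstar f eta beta r wealth C U.

(* Main.v *)
(* Put a_s = beta e^{-beta s} F_s and let Z_t = e^{rt} psi_t, a nonnegative
   martingale.  Removing the conditional expectation, the slack M psi_t - G_t of the
   first-order condition is e^{beta t} times the projection on F_t of
     gap_t = M e^{-(beta+r)t} Z_T - int_t^T a_s ds.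
   The complementary slackness, rewritten by the time change t = C^{-1}(u), says
   that the slack vanishes at the first time after sigma when C has grown by u,
   for almost every u.  If C increases right after the stopping time sigma, letting
   u decrease to 0 gives E[gap_sigma; A] = 0 for A in F_sigma, since gap has
   continuous paths dominated by an integrable variable.
   Applied to sigma = (tau0 \/ t) /\ tau1 and combined with the martingale
   property of Z, this shows that
     int_0^t 1_{tau0 <= q < tau1} (a_q - M (beta + r) e^{-(beta+r)q} Z_q) dq
   is a martingale.  Being continuous and of finite variation it vanishes, hence
   beta F_q = M (beta + r) psi_q for almost every q in ]tau0, tau1[; the
   identity passes to the times at which F is right-continuous. *)
Require Import Defs.
From mathcomp Require Import all_boot all_order all_algebra.
From mathcomp Require Import all_classical all_reals all_analysis measurable_realfun.
From mathcomp Require Import ring lra.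
Import Order.TTheory GRing.Theory Num.Theory.
Import numFieldNormedType.Exports.

Set Implicit Arguments.
Unset Strict Implicit.
Unset Printing Implicit Defensive.
Local Open Scope classical_set_scope.
Local Open Scope ring_scope.

(** * Right-continuous processes *)

(** The obstacle is that the times charged by [dC] are random and the first-order condition binds
    only [dC]-almost everywhere, whereas the projection [G] can be exploited only at stopping times.
    Parametrizing by the consumption level turns the random measure into Lebesgue measure, and a
    level fixed independently of the state yields a stopping time; Tonelli then gives almost every
    level. The filtration is not known to be right-continuous, which is why levels are reached in
    the closed sense and why optional stopping is derived from events known at the right end points
    of a grid. No conditional expectation is formed: projection identities are tested on events and
    extended to bounded factors by [integral_mul_eq0]. The integrability behind the dominations
    comes from time 0, where G_0 <= M psi_0 and psi_0 has mean 1. The constant (r + beta) / beta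
    comes from the rate beta + r at which e^{-(beta+r)t} decays, against the weight beta in a_t. *)

Lemma measurable_true d (Om : measurableType d) (b : Om -> bool) :
  measurable_fun setT b -> measurable [set w | b w].
Proof. by move=> mb; rewrite -[X in measurable X]setTI; exact: (mb _ [set true]). Qed.

Section grid.
Context {R : realType}.
Variable T : R.

(* [grid n s] is the smallest multiple of [1 / (n + 1)] exceeding [s], cut at [T]. *)
Definition grid (n : nat) (s : R) : R :=
  Num.min T ((Num.trunc (s * n.+1%:R)).+1%:R / n.+1%:R).

Lemma grid_le n s : grid n s <= T.
Proof. by rewrite ge_min lexx. Qed.

Lemma grid_ge n s : 0 <= s <= T -> s <= grid n s.
Proof.
move=> /andP[s0 sT]; rewrite le_min sT /= ler_pdivlMr ?ltr0n//.
by have /andP[_ /ltW] := truncn_itv (mulr_ge0 s0 (ler0n R n.+1)).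
Qed.

Lemma grid_gt n s : 0 <= s < T -> s < grid n s.
Proof.
move=> /andP[s0 sT]; rewrite lt_min sT /= ltr_pdivlMr ?ltr0n//.
by have /andP[_] := truncn_itv (mulr_ge0 s0 (ler0n R n.+1)).
Qed.

Lemma grid_ub n s : 0 <= s -> grid n s <= s + n.+1%:R^-1.
Proof.
move=> s0; rewrite ge_min; apply/orP; right.
rewrite ler_pdivrMr ?ltr0n// mulrDl mulVf ?pnatr_eq0// -natr1 lerD2r.
by have /andP[] := truncn_itv (mulr_ge0 s0 (ler0n R n.+1)).
Qed.

Lemma grid_cvg s : 0 <= s <= T -> grid n s @[n --> \oo] --> s.
Proof.
move=> s0T; apply: (@squeeze_cvgr _ _ _ _ (fun=> s) (fun n => s + n.+1%:R^-1)).
- by near=> n; rewrite grid_ge//= grid_ub//; case/andP: s0T.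
- exact: cvg_cst.
- rewrite -[X in _ --> X]addr0; apply: cvgD; first exact: cvg_cst.
  exact: cvg_harmonic.
Unshelve. all: by end_near. Qed.

(** Below [T] the grid points lie strictly to the right of [s], as a right limit requires; at
    [s = T] the sequence is constantly [T] and no limit is asked for. *)
Lemma cvg_grid (x : R -> R) s : 0 <= s <= T ->
  (s < T -> x q @[q --> s^'+] --> x s) -> x (grid n s) @[n --> \oo] --> x s.
Proof.
move=> /andP[s0 sT] xs; move: sT; rewrite le_eqVlt => /predU1P[sT|sT].
  suff -> : (fun n => x (grid n s)) = cst (x s) by exact: cvg_cst.
  apply/funext => n; congr x; apply/le_anti.
  rewrite grid_ge ?andbT; last by rewrite s0 sT lexx.
  by rewrite (le_trans (grid_le n s))// sT.
apply: (iffLR (cvg_at_rightP x s (x s)) (xs sT)); split.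
  by move=> n; rewrite grid_gt// s0.
by apply: grid_cvg; rewrite s0 ltW.
Qed.

End grid.

(** Processes are controlled on [0, T] only; composing with this projection gives total functions of
    time, with no domain to carry along. *)
Definition clip {R : realType} (T s : R) : R := Num.max 0 (Num.min T s).

Section joint_measurability.
Context {R : realType}.
Implicit Types T s : R.

Lemma clip_itv T s : 0 <= T -> 0 <= clip T s <= T.
Proof. by move=> T0; rewrite le_max lexx ge_max T0 ge_min lexx. Qed.

Lemma clip_id T s : 0 <= s <= T -> clip T s = s.
Proof. by move=> /andP[s0 sT]; rewrite /clip min_r// max_r. Qed.

Lemma measurable_clip T : measurable_fun setT (clip T).
Proof.
apply: measurable_maxr; first exact: measurable_cst.
exact: measurable_minr.
Qed.

(** After rounding, the random time takes countably many values: on the cell [E k] the process is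
    frozen at one deterministic time. *)
Lemma measurable_fun_grid d (Om : measurableType d) T (X : R -> Om -> R)
    (tau : Om -> R) n :
  0 <= T -> (forall w, 0 <= tau w <= T) -> measurable_fun setT tau ->
  (forall s, 0 <= s <= T -> measurable_fun setT (X s)) ->
  measurable_fun setT (fun w => X (grid T n (tau w)) w).
Proof.
move=> T0 tauT mtau mX.
pose E (k : nat) : set Om := tau @^-1` `[k%:R / n.+1%:R, k.+1%:R / n.+1%:R[.
have mE k : measurable (E k) by rewrite -[E k]setTI; apply: mtau.
have Etrunc k w : E k w -> Num.trunc (tau w * n.+1%:R) = k.
  rewrite /E/= in_itv/= ler_pdivrMr ?ltr0n// ltr_pdivlMr ?ltr0n//.
  exact: truncn_def.
have -> : [set: Om] = \bigcup_k E k.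
  apply/esym; rewrite -subTset => w _; exists (Num.trunc (tau w * n.+1%:R)) => //.
  rewrite /E/= in_itv/= ler_pdivrMr ?ltr0n// ltr_pdivlMr ?ltr0n//.
  by apply/truncn_itv/mulr_ge0; [case/andP: (tauT w)|].
apply/measurable_fun_bigcup => // k.
apply: (eq_measurable_fun (X (Num.min T (k.+1%:R / n.+1%:R)))).
  by move=> w /set_mem /Etrunc; rewrite /grid => ->.
apply: measurable_funTS; apply: mX.
by rewrite le_min T0 divr_ge0//= ge_min lexx.
Qed.

Lemma measurable_fun_stopped d (Om : measurableType d) T (X : R -> Om -> R)
    (tau : Om -> R) :
  0 <= T -> (forall w, 0 <= tau w <= T) -> measurable_fun setT tau ->
  (forall s, 0 <= s <= T -> measurable_fun setT (X s)) ->
  (forall w s, 0 <= s < T -> X q w @[q --> s^'+] --> X s w) ->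
  measurable_fun setT (fun w => X (tau w) w).
Proof.
move=> T0 tauT mtau mX rcX.
apply: (@measurable_fun_cvg _ _ _ _ (fun n w => X (grid T n (tau w)) w)).
  by move=> n; exact: measurable_fun_grid.
move=> w _; apply: (@cvg_grid _ _ (fun s => X s w)) => // h.
by apply: rcX; case/andP: (tauT w) => ->.
Qed.

(** The clipped time coordinate is itself a random time on the product space, so joint measurability
    is [measurable_fun_stopped] read there. *)
Lemma measurable_fun_clip d (Om : measurableType d) T (X : R -> Om -> R) :
  0 <= T ->
  (forall s, 0 <= s <= T -> measurable_fun setT (X s)) ->
  (forall w s, 0 <= s < T -> X q w @[q --> s^'+] --> X s w) ->
  measurable_fun setT (fun p : R * Om => X (clip T p.1) p.2).
Proof.
move=> T0 mX rcX.
apply: (@measurable_fun_stopped _ (R * Om)%type T (fun s p => X s p.2)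
  (fun p => clip T p.1)) => //.
- by move=> p; exact: clip_itv.
- exact: (measurableT_comp (measurable_clip T)).
- by move=> s s0; apply: measurableT_comp; first exact: mX.
- by move=> p s s0; apply: rcX.
Qed.

End joint_measurability.

(** * Measurability and orthogonality relative to a sub-sigma-algebra *)

Section sub_sigma_algebra.
Context {d : measure_display} {Om : measurableType d} {R : realType}.
Variable G : set (set Om).
Hypothesis sG : sigma_algebra setT G.

Lemma measurable_sigma_algebraE (A : set Om) :
  measurable (A : set (g_sigma_algebraType G)) = G A.
Proof. by rewrite /measurable/= /measurable/= sigma_algebra_id. Qed.

Lemma measurable_wrtP d' (V : measurableType d') (X : Om -> V) :
  measurable_wrt G X <-> forall S, measurable S -> G (X @^-1` S).
Proof.
split=> [mX S mS|GX _ S mS]; rewrite -?measurable_sigma_algebraE.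
  by rewrite -[X in measurable X]setTI; exact: mX.
by rewrite setTI measurable_sigma_algebraE; exact: GX.
Qed.

Lemma measurable_wrtT d' (V : measurableType d') (X : Om -> V) :
  G `<=` d.-measurable -> measurable_wrt G X -> measurable_fun setT X.
Proof.
by move=> Gm /measurable_wrtP GX _ S mS; rewrite setTI; exact/Gm/GX.
Qed.

Lemma measurable_wrtS H d' (V : measurableType d') (X : Om -> V) :
  sigma_algebra setT H -> G `<=` H -> measurable_wrt G X -> measurable_wrt H X.
Proof.
move=> sH GH /measurable_wrtP GX _ S mS; rewrite setTI.
by apply: sub_sigma_algebra; exact/GH/GX.
Qed.

Lemma sub_sigma_algebraT : G setT.
Proof. by rewrite -measurable_sigma_algebraE; exact: measurableT. Qed.

End sub_sigma_algebra.

Lemma integral_EFin_indic d (Om : measurableType d) (R : realType)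
    (P : {measure set Om -> \bar R}) (A : set Om) (W : Om -> R) :
  (\int[P]_w (\1_A w * W w)%:E = \int[P]_(w in A) (W w)%:E)%E.
Proof.
rewrite [RHS]integral_mkcond; apply: eq_integral => w _.
by rewrite patchE indicE; case: ifPn => wA; rewrite ?mul1r ?mul0r.
Qed.

Lemma integrableM_bounded d (Om : measurableType d) (R : realType)
    (P : {measure set Om -> \bar R}) (W Y : Om -> R) (K : R) :
  P.-integrable setT (EFin \o W) -> measurable_fun setT Y ->
  (forall w, `|Y w| <= K) -> P.-integrable setT (fun w => (Y w * W w)%:E).
Proof.
move=> iW mY YK; apply: (le_integrable measurableT (g := fun w => (K * W w)%:E)).
- apply/measurable_EFinP/measurable_funM => //.
  by apply/measurable_EFinP; exact: measurable_int iW.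
- move=> w _ /=; rewrite lee_fin !normrM ler_wpM2r//.
  by rewrite (le_trans (YK w))// ler_norm.
- by under eq_fun do rewrite EFinM; exact: integrableZl.
Qed.

(** Substitute for conditioning: a variable averaging to zero on every event of [G] is orthogonal to
    bounded [G]-measurable factors. The factor is rounded down to finitely many values, and
    dominated convergence removes the rounding. *)
Lemma integral_mul_eq0 d (Om : measurableType d) (R : realType)
    (P : {measure set Om -> \bar R}) (G : set (set Om)) (W Y : Om -> R) (K : R) :
  sigma_algebra setT G -> G `<=` d.-measurable ->
  P.-integrable setT (EFin \o W) ->
  (forall A, G A -> (\int[P]_(w in A) (W w)%:E = 0)%E) ->
  measurable_wrt G Y -> (forall w, `|Y w| <= K) ->
  (\int[P]_w (Y w * W w)%:E = 0)%E.
Proof.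
move=> sG Gm iW W0 mY YK.
have mW : measurable_fun setT W by apply/measurable_EFinP; exact: measurable_int iW.
have K0 w : 0 <= Y w + K by have := ler_norm (- Y w); rewrite normrN; have := YK w; lra.
have K2 w : Y w + K <= 2 * K by have := ler_norm (Y w); have := YK w; lra.
(* The shift by [K] makes the factor nonnegative, as rounding by [Num.trunc] requires; it is undone
   at the end because [W] has integral 0. *)
pose z n w : R := (Num.trunc ((Y w + K) * n.+1%:R))%:R / n.+1%:R.
have zb n w : Y w + K - n.+1%:R^-1 <= z n w <= Y w + K.
  have /andP[h1 h2] := truncn_itv (mulr_ge0 (K0 w) (ler0n R n.+1)).
  rewrite lerBlDr /z -[X in _ <= _ + X]mul1r -mulrDl natr1.
  by rewrite ler_pdivlMr ?ltr0n// ltW//= ler_pdivrMr ?ltr0n.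
have z0 n w : 0 <= z n w by rewrite divr_ge0.
have mYT : measurable_fun setT Y by exact: measurable_wrtT mY.
pose A n k : set Om := (fun w => Y w + K) @^-1` `[k%:R / n.+1%:R, k.+1%:R / n.+1%:R[.
have GA n k : G (A n k).
  rewrite -measurable_sigma_algebraE// -[X in measurable X]setTI.
  suff : measurable_wrt G (fun w => Y w + K) by apply => //; exact: measurable_itv.
  by apply: measurable_funD => //; exact: measurable_cst.
have AE n k w : (w \in A n k) = (Num.trunc ((Y w + K) * n.+1%:R) == k).
  rewrite truncn_eq ?mulr_ge0//; apply/idP/idP => [/set_mem|h]; last apply/mem_set; rewrite /A/= in_itv/=.
    by rewrite ler_pdivrMr ?ltr0n// ltr_pdivlMr ?ltr0n//.
  by rewrite ler_pdivrMr ?ltr0n// ltr_pdivlMr ?ltr0n//.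
have zE n w : z n w = \sum_(k < (Num.trunc (2 * K * n.+1%:R)).+1) k%:R / n.+1%:R * \1_(A n k) w.
  have lt : (Num.trunc ((Y w + K) * n.+1%:R) < (Num.trunc (2 * K * n.+1%:R)).+1)%N.
    by rewrite ltnS; apply: le_truncn; rewrite ler_wpM2r.
  rewrite (bigD1 (Ordinal lt))//= indicE AE eqxx mulr1 big1 ?addr0// => k.
  by rewrite indicE AE -val_eqE/= eq_sym => /negbTE ->; rewrite mulr0.
have mz n : measurable_fun setT (z n).
  rewrite (funext (zE n)).
  apply: measurable_sum => k; apply: measurable_funM => //.
  by apply: measurable_indic; exact/Gm.
have i0 n : (\int[P]_w (z n w * W w)%:E = 0)%E.
  under eq_integral do rewrite zE mulr_suml.
  under eq_integral do rewrite -sumEFin.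
  rewrite integral_sum//.
    rewrite big1// => k _; under eq_integral => w _ do
      rewrite -(mulrA (k%:R / n.+1%:R)) EFinM.
    rewrite integralZl//.
      by rewrite integral_EFin_indic W0// mule0.
    apply: (@integrableM_bounded _ _ _ _ _ _ 1) => //.
      by apply: measurable_indic; exact/Gm.
    by move=> w; rewrite indicE; case: (_ \in _); rewrite ?normr1 ?normr0.
  move=> k; apply: (@integrableM_bounded _ _ _ _ _ _ (k%:R/n.+1%:R)) => //.
    by apply: measurable_funM => //; apply: measurable_indic; exact/Gm.
  move=> w; rewrite indicE normrM ger0_norm ?divr_ge0// ler_piMr ?divr_ge0//.
  by case: (_ \in _); rewrite ?normr1 ?normr0.
have [] := @dominated_convergence _ _ _ P setT measurableT
  (fun n w => (z n w * W w)%:E) (fun w => ((Y w + K) * W w)%:E)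
  (fun w => (2 * K)%:E * `|W w|%:E)%E.
- by move=> n; apply/measurable_EFinP/measurable_funM.
- by apply/measurable_EFinP/measurable_funM => //; apply: measurable_funD.
- apply: aeW => w _; apply: cvg_EFin; first by near=> n.
  apply: cvgMr_tmp.
  apply: (@squeeze_cvgr _ _ _ _ (fun n => Y w + K - n.+1%:R^-1) (fun=> Y w + K)).
  + by near=> n; exact: zb.
  + rewrite -[X in _ --> X]subr0; apply: cvgB; first exact: cvg_cst.
    exact: cvg_harmonic.
  + exact: cvg_cst.
- by apply: integrableZl => //; exact: integrable_norm.
- apply: aeW => w n _; rewrite -EFinM lee_fin normrM ler_wpM2r// ger0_norm//.
  by rewrite (le_trans _ (K2 w))//; case/andP: (zb n w).
move=> iZ _.
rewrite (_ : [sequence _]_n = cst 0%E); last by apply/funext => n; exact: i0.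
move=> /cvg_lim -/(_ (@ereal_hausdorff _)); rewrite lim_cst// => Z0.
have W00 : (\int[P]_w (W w)%:E = 0)%E by apply: W0; exact: sub_sigma_algebraT.
have YWE w : Y w * W w = (Y w + K) * W w - K * W w by rewrite mulrDl addrK.
under eq_integral do rewrite YWE.
rewrite integralB_EFin//; last first.
  exact: (@integrableM_bounded _ _ _ P W (fun=> K) `|K| iW (measurable_cst _) (fun=> lexx _)).
rewrite -Z0 sub0e; under eq_integral do rewrite EFinM.
by rewrite integralZl// W00 mule0 oppe0.
Unshelve. all: by end_near. Qed.

(** * Stopping times and optional stopping *)

Definition filtration {d : measure_display} {Om : measurableType d}
    {R : realType} (T : R) (F : R -> set (set Om)) : Prop :=
  [/\ forall t, 0 <= t <= T -> sigma_algebra setT (F t),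
      forall s t, 0 <= s -> s <= t -> t <= T -> F s `<=` F t &
      forall t, 0 <= t <= T -> F t `<=` d.-measurable].

(** Sublevel sets below 0 are empty and those from [T] on are everything. Leaving out x = T matters
    for times such as [level_time], which are characterized only before [T]. *)
Lemma measurable_fun_le_itv d (Om : measurableType d) (R : realType) (T : R)
    (tau : Om -> R) : (forall w, 0 <= tau w <= T) ->
  (forall x, 0 <= x < T -> measurable [set w | tau w <= x]) ->
  measurable_fun setT tau.
Proof.
move=> tauT mtau; apply: (measurability _ (RGenOInfty.measurableE R)).
move=> _ [_ [x ->] <-]; rewrite setTI.
rewrite (_ : _ @^-1` _ = ~` [set w | tau w <= x]); last first.
  by apply/seteqP; split=> w /=; rewrite in_itv/= andbT ltNge => /negP.
apply: measurableC; have [x0|x0] := ltP x 0.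
  rewrite (_ : [set w | _] = set0)//; apply/seteqP; split=> // w /= h.
  by case/andP: (tauT w) => /le_trans/(_ h); rewrite leNgt x0.
have [Tx|xT] := leP T x; last by apply: mtau; rewrite x0.
rewrite (_ : [set w | _] = setT)//; apply/seteqP; split=> // w _ /=.
by case/andP: (tauT w) => _ /le_trans; apply.
Qed.

Section stopping_times.
Context {d : measure_display} {Om : measurableType d} {R : realType}.
Variables (T : R) (F : R -> set (set Om)).
Hypotheses (T0 : 0 <= T) (filtF : filtration T F).

Let TT : 0 <= T <= T. Proof. by rewrite T0 lexx. Qed.

Lemma filtration_algebra t : 0 <= t <= T -> sigma_algebra setT (F t).
Proof. by case: filtF => + _ _; apply. Qed.

Lemma filtration_le s t : 0 <= s -> s <= t -> t <= T -> F s `<=` F t.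
Proof. by case: filtF => _ + _; apply. Qed.

Lemma filtration_measurable t : 0 <= t <= T -> F t `<=` d.-measurable.
Proof. by case: filtF => _ _; apply. Qed.

Lemma filtrationE t (A : set Om) : 0 <= t <= T ->
  measurable (A : set (g_sigma_algebraType (F t))) = F t A.
Proof. by move=> tT; exact/measurable_sigma_algebraE/filtration_algebra. Qed.

Lemma filtrationI t A B : 0 <= t <= T -> F t A -> F t B -> F t (A `&` B).
Proof.
by move=> tT; rewrite -!filtrationE//; exact: measurableI.
Qed.

Lemma filtrationD t A B : 0 <= t <= T -> F t A -> F t B -> F t (A `\` B).
Proof.
by move=> tT; rewrite -!filtrationE//; exact: measurableD.
Qed.

Lemma adaptedT X t : adapted T F X -> 0 <= t <= T -> measurable_fun setT (X t).
Proof.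
move=> aX tT; apply: measurable_wrtT (aX t tT); first exact: filtration_algebra.
exact: filtration_measurable.
Qed.

Lemma adapted_le X s t : adapted T F X -> 0 <= s -> s <= t -> t <= T ->
  measurable_wrt (F t) (X s).
Proof.
move=> aX s0 st tT; have sT : 0 <= s <= T by rewrite s0 (le_trans st).
have tT' : 0 <= t <= T by rewrite (le_trans s0).
apply: measurable_wrtS (aX s sT); try exact: filtration_algebra.
exact: filtration_le.
Qed.

Variable tau : Om -> R.
Hypothesis stau : stopping_time T F tau.

Let tauT w : 0 <= tau w <= T. Proof. by case: stau => + _; apply. Qed.

(** The strict event is the union of the events {tau <= b - 1/(n+1)}, each decided before [b]. The
    index is cut at [T] because the filtration is controlled only up to there. *)
Lemma stopped_sigma_algebra_lt A b : stopped_sigma_algebra T F tau A ->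
  0 <= b -> F (Num.min T b) (A `&` [set w | tau w < b]).
Proof.
move=> [AT At] b0.
have [Tb|bT] := ltP T b.
  rewrite (_ : [set w | _] = setT) ?setIT//; apply/seteqP; split=> // w _ /=.
  by rewrite (le_lt_trans _ Tb)//; case/andP: (tauT w).
have bT' : 0 <= b <= T by rewrite b0.
rewrite (_ : _ `&` _ = \bigcup_n (A `&` [set w | tau w <= b - n.+1%:R^-1])).
  rewrite -filtrationE//; apply: bigcup_measurable => n _; rewrite filtrationE//.
  have [h|h] := leP 0 (b - n.+1%:R^-1).
    have hb : b - n.+1%:R^-1 <= b by rewrite gerBl.
    by apply: (filtration_le h hb bT); apply: At; rewrite h (le_trans hb).
  rewrite (_ : _ `&` _ = set0).
    by rewrite -filtrationE//; exact: measurable0.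
  apply/seteqP; split=> // w [_ /= h1]; case/andP: (tauT w) => h2 _.
  by have := lt_le_trans h (le_trans h2 h1); rewrite ltxx.
apply/seteqP; split=> [w [Aw /= wb]|w [n _ [Aw /= wb]]]; last first.
  by split=> //=; rewrite (le_lt_trans wb)// gtrBl.
(* Any n with 1/(n+1) <= b - tau serves; the integer part of the inverse is one. *)
exists (Num.trunc ((b - tau w)^-1)) => //; split=> //=.
rewrite lerBrDr -lerBrDl invf_ple ?posrE ?ltr0n ?subr_gt0//.
have /truncn_itv/andP[_ /ltW] // : 0 <= (b - tau w)^-1.
by rewrite invr_ge0 subr_ge0 ltW.
Qed.

(** Used on the cells of the grid: the trace of [A] on a cell is known at its right end point, which
    is the value of [grid] there. *)
Lemma stopped_sigma_algebra_itv A a b : stopped_sigma_algebra T F tau A ->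
  0 <= a -> a <= b -> F (Num.min T b) (A `&` [set w | a <= tau w < b]).
Proof.
move=> sA a0 ab; have b0 := le_trans a0 ab.
have mT x : 0 <= x -> 0 <= Num.min T x <= T by move=> x0; rewrite le_min T0 x0 ge_min lexx.
rewrite (_ : _ `&` _ = (A `&` [set w | tau w < b]) `\` (A `&` [set w | tau w < a])).
  apply: filtrationD; [exact: mT|exact: stopped_sigma_algebra_lt|].
  have /andP[h1 _] := mT _ a0; have /andP[_ h2] := mT _ b0.
  apply: (filtration_le h1 _ h2); last exact: stopped_sigma_algebra_lt.
  by rewrite le_min ge_min lexx/= ge_min ab orbT.
apply/seteqP; split=> [w [Aw /= /andP[aw wb]]|w [[Aw /= wb] /not_andP[//|/=]]].
  by split=> // -[_ /=]; rewrite ltNge aw.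
by move/negP; rewrite -leNgt => aw; split=> //=; rewrite aw.
Qed.

Lemma stopping_timeT : stopped_sigma_algebra T F tau setT.
Proof.
split; first by rewrite -filtrationE//; exact: measurableT.
by move=> t tT; rewrite setTI; case: stau => _; apply.
Qed.

Lemma stopping_time_measurable : measurable_fun setT tau.
Proof.
apply: measurable_fun_le_itv tauT _ => x /andP[x0 xT].
have xT' : 0 <= x <= T by rewrite x0 ltW.
by apply: (filtration_measurable xT'); case: stau => _; exact.
Qed.

Lemma stopped_sub_sigma_algebra :
  sigma_algebra setT (stopped_sigma_algebra T F tau).
Proof.
have [_ st] := stau; split.
- split; first by rewrite -filtrationE//; exact: measurable0.
  by move=> t tT; rewrite set0I -filtrationE//; exact: measurable0.
- move=> A [AT At]; rewrite setTD; split.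
    by rewrite -filtrationE//; apply: measurableC; rewrite filtrationE.
  move=> t tT; rewrite (_ : _ `&` _ = [set w | tau w <= t] `\` (A `&` [set w | tau w <= t])).
    by apply: filtrationD => //; [exact: st|exact: At].
  apply/seteqP; split=> [w [nA /= h]|w [/= h /not_andP[//|//]]].
  by split=> // -[].
- move=> A sA; split.
    rewrite -filtrationE//; apply: bigcup_measurable => n _; rewrite filtrationE//.
    by case: (sA n).
  move=> t tT; rewrite setI_bigcupl -filtrationE//; apply: bigcup_measurable => n _.
  by rewrite filtrationE//; case: (sA n) => _; apply.
Qed.

Lemma stopped_sub_measurable : stopped_sigma_algebra T F tau `<=` d.-measurable.
Proof. by move=> A [AT _]; exact: filtration_measurable AT. Qed.

Lemma stopping_time_wrt : measurable_wrt (stopped_sigma_algebra T F tau) tau.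
Proof.
have [_ st] := stau; have sF := stopped_sub_sigma_algebra.
apply: (@measurable_fun_le_itv _ (g_sigma_algebraType _) _ T) => // x /andP[x0 xT].
rewrite measurable_sigma_algebraE//.
have xT' : 0 <= x <= T by rewrite x0 ltW.
split; first by apply: (filtration_le x0 (ltW xT)) => //; exact: st.
move=> t /andP[t0 tT].
rewrite (_ : _ `&` _ = [set w | tau w <= Num.min x t]).
  have h : 0 <= Num.min x t <= T by rewrite le_min x0 t0 ge_min tT orbT.
  apply: (@filtration_le (Num.min x t) t) => //; first by case/andP: h.
    by rewrite ge_min lexx orbT.
  exact: st.
apply/seteqP; split=> w /=; first by case=> h1 h2; rewrite le_min h1.
by rewrite le_min => /andP[].
Qed.

End stopping_times.

Lemma cvg_minl (R : realFieldType) (u : R^nat) (l c : R) :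
  u n @[n --> \oo] --> l -> Num.min (u n) c @[n --> \oo] --> Num.min l c.
Proof.
move=> /cvgrPdist_le ul; apply/cvgrPdist_le => e e0; near=> n.
have : `|l - u n| <= e by near: n; exact: ul.
rewrite !ler_norml => /andP[h1 h2].
by case: (leP (u n) c) => h3; case: (leP l c) => h4; apply/andP; split; lra.
Unshelve. all: by end_near. Qed.

(** * Optional stopping for nonnegative right-continuous martingales *)

Section optional_stopping.
Context {d : measure_display} {Om : measurableType d} {R : realType}.
Variables (T : R) (P : probability Om R) (F : R -> set (set Om)).
Hypotheses (T0 : 0 <= T) (filtF : filtration T F).
Variable Z : R -> Om -> R.
Hypotheses (aZ : adapted T F Z)
  (rcZ : forall w s, 0 <= s < T -> Z q w @[q --> s^'+] --> Z s w)
  (Z0 : forall s w, 0 <= Z s w)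
  (iZT : P.-integrable setT (EFin \o Z T))
  (martZ : forall t, 0 <= t <= T -> forall A, F t A ->
     (\int[P]_(w in A) (Z t w)%:E = \int[P]_(w in A) (Z T w)%:E)%E).
Variable tau : Om -> R.
Hypothesis stau : stopping_time T F tau.

Let TT : 0 <= T <= T. Proof. by rewrite T0 lexx. Qed.
Let tauT w : 0 <= tau w <= T. Proof. by case: stau => + _; apply. Qed.
Let mtau : measurable_fun setT tau.
Proof. exact: (stopping_time_measurable filtF stau). Qed.
Let mZ s : 0 <= s <= T -> measurable_fun setT (Z s).
Proof. exact: adaptedT aZ. Qed.
Let mZg n : measurable_fun setT (fun w => Z (grid T n (tau w)) w).
Proof. by apply: measurable_fun_grid => //; exact: mZ. Qed.
Let mZtau : measurable_fun setT (fun w => Z (tau w) w).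
Proof. by apply: (measurable_fun_stopped T0) => //; exact: mZ. Qed.

Let cvgZ w : Z (grid T n (tau w)) w @[n --> \oo] --> Z (tau w) w.
Proof.
apply: (@cvg_grid _ _ (fun s => Z s w)) => // h.
by apply: rcZ; case/andP: (tauT w) => ->.
Qed.

Let cell n k : set Om := [set w | k%:R / n.+1%:R <= tau w < k.+1%:R / n.+1%:R].

Let cellP n k w : cell n k w -> Num.trunc (tau w * n.+1%:R) = k.
Proof.
by rewrite /cell/= ler_pdivrMr ?ltr0n// ltr_pdivlMr ?ltr0n//; exact: truncn_def.
Qed.

Let bigcup_cell n : \bigcup_k cell n k = setT.
Proof.
rewrite -subTset => w _; exists (Num.trunc (tau w * n.+1%:R)) => //.
rewrite /cell/= ler_pdivrMr ?ltr0n// ltr_pdivlMr ?ltr0n//.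
by apply/truncn_itv/mulr_ge0; [case/andP: (tauT w)|].
Qed.

(** On each cell the grid time is deterministic, so the martingale property applies cell by cell.
    Only the traces of [A] on the cells must be known, which admits events about Z at the grid time
    that need not be known at [tau]. *)
Lemma optional_stopping_grid n A :
  (forall k, F (Num.min T (k.+1%:R / n.+1%:R)) (A `&` cell n k)) ->
  (\int[P]_(w in A) (Z (grid T n (tau w)) w)%:E =
   \int[P]_(w in A) (Z T w)%:E)%E.
Proof.
move=> FA.
have vT k : 0 <= Num.min T (k.+1%:R / n.+1%:R) <= T.
  by rewrite le_min T0 divr_ge0//= ge_min lexx.
have -> : A = \bigcup_k (A `&` cell n k).
  by rewrite -setI_bigcupr bigcup_cell setIT.
have tA : trivIset setT (fun k => A `&` cell n k).
  apply/trivIsetP => i j _ _ /eqP ij; rewrite -subset0 => w [[_ wi] [_ wj]].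
  by apply: ij; rewrite -(cellP wi) -(cellP wj).
have mA k : measurable (A `&` cell n k).
  exact: (filtration_measurable filtF (vT k)).
rewrite !ge0_integral_bigcup//; last 4 first.
- by apply: measurable_funTS; exact/measurable_EFinP/mZ.
- by move=> w _; rewrite lee_fin.
- by apply: measurable_funTS; exact/measurable_EFinP.
- by move=> w _; rewrite lee_fin.
apply: eq_eseriesr => k _; rewrite -(martZ (vT k))//.
by apply: eq_integral => w /set_mem [_ /cellP]; rewrite /grid => ->.
Qed.

Let fatouA A : measurable A -> (forall n,
   (\int[P]_(w in A) (Z (grid T n (tau w)) w)%:E =
   \int[P]_(w in A) (Z T w)%:E)%E) ->
  (\int[P]_(w in A) (Z (tau w) w)%:E <= \int[P]_(w in A) (Z T w)%:E)%E.
Proof.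
move=> mA eA.
have := @fatou _ _ _ P A mA (fun n w => (Z (grid T n (tau w)) w)%:E).
rewrite [X in (_ <= limn_einf X)%E](_ : _ = cst (\int[P]_(w in A) (Z T w)%:E)%E);
  last exact/funext.
rewrite (cvg_limn_einf_sup (cvg_cst _)).1.
under eq_integral => w _.
  have cvgw : (Z (grid T n (tau w)) w)%:E @[n --> \oo] --> (Z (tau w) w)%:E.
    by apply: cvg_EFin; [by near=> n|exact: cvgZ].
  rewrite (cvg_limn_einf_sup cvgw).1; over.
apply=> [n|n w _]; last by rewrite lee_fin.
by apply: measurable_funTS; exact/measurable_EFinP.
Unshelve. all: by end_near. Qed.

(** Fatou gives only the opposite inequality; here truncation replaces uniform integrability. On
    [S n K] the variable at the grid time equals its cut at [K], and the cut variables converge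
    boundedly. The sets [B K], where the bound holds along the whole sequence, exhaust the space
    because a convergent sequence is bounded. *)
Let totalT : (\int[P]_w (Z T w)%:E <= \int[P]_w (Z (tau w) w)%:E)%E.
Proof.
pose S n (K : nat) : set Om := [set w | Z (grid T n (tau w)) w <= K%:R].
pose B (K : nat) : set Om := \bigcap_n S n K.
have mS n K : measurable (S n K).
  by apply: measurable_true; apply: measurable_fun_ler.
have mB K : measurable (B K) by exact: bigcap_measurableType.
have BT : \bigcup_K B K = setT.
  rewrite -subTset => w _.
  have : bounded_fun (fun n => Z (grid T n (tau w)) w).
    by apply: cvg_seq_bounded; apply/cvg_ex; exists (Z (tau w) w); exact: cvgZ.
  move=> [N [_ /(_ (Num.max N 0 + 1))]].
  have -> : (N < Num.max N 0 + 1) by rewrite ltr_pwDr// le_max lexx.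
  move=> /(_ isT) NB; exists (Num.trunc (Num.max N 0 + 1)).+1 => // n _; rewrite /S/=.
  rewrite (le_trans (ler_norm _))// (le_trans (NB n _))//.
  have /truncn_itv/andP[_ /ltW] // : 0 <= Num.max N 0 + 1.
  by rewrite addr_ge0// le_max lexx orbT.
have ZSn n K : (\int[P]_(w in S n K) (Z T w)%:E =
    \int[P]_(w in S n K) (Z (grid T n (tau w)) w)%:E)%E.
  rewrite optional_stopping_grid// => k.
  set v := Num.min _ _.
  have vT : 0 <= v <= T by rewrite le_min T0 divr_ge0//= ge_min lexx.
  rewrite (_ : _ `&` _ = Z v @^-1` `]-oo, K%:R] `&` cell n k).
    apply: (filtrationI filtF vT).
      by have /(measurable_wrtP (filtration_algebra filtF vT)) := aZ vT; apply.
    have := @stopped_sigma_algebra_itv _ _ _ _ _ T0 filtF _ stau setT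
      (k%:R / n.+1%:R) (k.+1%:R / n.+1%:R).
    rewrite setTI; apply; [exact: stopping_timeT|by rewrite divr_ge0|].
    by rewrite ler_pM2r ?ler_nat// invr_gt0.
  apply/seteqP; split => w [+ h]; rewrite /S/= in_itv/= /grid (cellP h); by split.
have minK n K : (\int[P]_(w in B K) (Z T w)%:E <=
    \int[P]_w (Num.min (Z (grid T n (tau w)) w) K%:R)%:E)%E.
  have nnmin w : 0 <= Num.min (Z (grid T n (tau w)) w) K%:R by rewrite le_min Z0 ler0n.
  apply: (@le_trans _ _ (\int[P]_(w in S n K) (Z T w)%:E)%E).
    apply: ge0_subset_integral => //; last by move=> w Bw; exact: Bw.
    + by apply: measurable_funTS; exact/measurable_EFinP/mZ.
    + by move=> w _; rewrite lee_fin.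
  rewrite ZSn.
  apply: (@le_trans _ _ (\int[P]_(w in S n K)
      (Num.min (Z (grid T n (tau w)) w) K%:R)%:E)%E).
    apply: ge0_le_integral => //.
    + by move=> w _; rewrite lee_fin.
    + by apply: measurable_funTS; exact/measurable_EFinP.
    + by apply: measurable_funTS; apply/measurable_EFinP/measurable_minr.
    + by move=> w Sw; rewrite lee_fin le_min lexx.
  apply: ge0_subset_integral => //.
  - by apply/measurable_EFinP/measurable_minr.
  - by move=> w _; rewrite lee_fin.
have leK K : (\int[P]_(w in B K) (Z T w)%:E <= \int[P]_w (Z (tau w) w)%:E)%E.
  apply: (@le_trans _ _ (\int[P]_w (Num.min (Z (tau w) w) K%:R)%:E)%E); last first.
    apply: ge0_le_integral => //.
    + by move=> w _; rewrite lee_fin le_min Z0 ler0n.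
    + by apply/measurable_EFinP/measurable_minr.
    + exact/measurable_EFinP.
    + by move=> w _; rewrite lee_fin ge_min lexx.
  have [] := @dominated_convergence _ _ _ P setT measurableT
    (fun n w => (Num.min (Z (grid T n (tau w)) w) K%:R)%:E)
    (fun w => (Num.min (Z (tau w) w) K%:R)%:E) (cst K%:R%:E).
  - by move=> n; apply/measurable_EFinP/measurable_minr.
  - by apply/measurable_EFinP/measurable_minr.
  - apply: aeW => w _; apply: cvg_EFin; first by near=> n.
    exact/cvg_minl/cvgZ.
  - exact: finite_measure_integrable_cst.
  - apply: aeW => w n _; rewrite lee_fin ger0_norm ?ge_min ?lexx ?orbT//.
    by rewrite le_min Z0 ler0n.
  move=> _ _ /=; apply: cvge_ge; near=> n; exact: minK.
have := @ge0_nondecreasing_set_cvg_integral _ _ _ B (fun w => (Z T w)%:E) P.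
rewrite BT => h; apply: cvge_le (h _ mB _ _); first by near=> K; exact: leK.
- move=> m n mn; apply/subsetPset => w Bw k _; move: (Bw k I).
  by rewrite /S/= => /le_trans; apply; rewrite ler_nat.
- by move=> i; apply: measurable_funTS; exact/measurable_EFinP/mZ.
- by move=> i w _; rewrite lee_fin.
Unshelve. all: by end_near. Qed.

(** Fatou's inequality holds on [A] and on its complement, while [totalT] bounds the sum from the
    other side; the finite mass of the complement is then cancelled. *)
Theorem optional_stopping A : stopped_sigma_algebra T F tau A ->
  (\int[P]_(w in A) (Z (tau w) w)%:E = \int[P]_(w in A) (Z T w)%:E)%E.
Proof.
move=> sA.
have le B : stopped_sigma_algebra T F tau B ->
    (\int[P]_(w in B) (Z (tau w) w)%:E <= \int[P]_(w in B) (Z T w)%:E)%E.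
  move=> sB; apply: fatouA; first exact: (stopped_sub_measurable T0 filtF sB).
  move=> n; apply: optional_stopping_grid => k.
  apply: (stopped_sigma_algebra_itv T0 filtF stau sB); first by rewrite divr_ge0.
  by rewrite ler_pM2r ?ler_nat// invr_gt0.
have mA : measurable A by exact: (stopped_sub_measurable T0 filtF sA).
have sAC : stopped_sigma_algebra T F tau (~` A).
  by case: (stopped_sub_sigma_algebra T0 filtF stau) => _ /(_ _ sA); rewrite setTD.
have leA := le _ sA; have leAC := le _ sAC.
apply/le_anti; rewrite leA/=.
have split (f : Om -> R) : measurable_fun setT f -> (forall w, 0 <= f w) ->
    (\int[P]_w (f w)%:E = \int[P]_(w in A) (f w)%:E + \int[P]_(w in ~` A) (f w)%:E)%E.
  move=> mf f0; rewrite -(setUv A) ge0_integral_setU//.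
  - exact: measurableC.
  - by rewrite setUv; exact/measurable_EFinP.
  - by move=> w _; rewrite lee_fin.
  - by apply/disj_setPCl.
have fA B : measurable B -> (\int[P]_(w in B) (Z T w)%:E)%E \is a fin_num.
  by move=> mB; apply: integrable_fin_num => //; exact: integrableS iZT.
have := totalT; rewrite (split (Z T))//; last exact: mZ.
rewrite (split (fun w => Z (tau w) w))//.
move: leAC => /(leeD2l (\int[P]_(w in A) (Z (tau w) w)%:E)%E).
move=> h1 h2; have := le_trans h2 h1.
by rewrite leeD2rE// fA//; exact: measurableC.
Qed.

End optional_stopping.

(** * Time change of Stieltjes integrals *)

Section time_change.
Context {R : realType}.
Variable T : R.
Hypothesis T0 : 0 <= T.

(* The generalized inverse of [c], equal to [T] at the levels not reached by [c]. *)
Definition level_time (c : R -> R) (v : R) : R :=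
  inf [set t | 0 <= t <= T /\ (v <= c t \/ t = T)].

Let lb (c : R -> R) v : lbound [set t : R | 0 <= t <= T /\ (v <= c t \/ t = T)] 0.
Proof. by move=> t [/andP[]]. Qed.

Lemma level_time_itv c v : 0 <= level_time c v <= T.
Proof.
rewrite /level_time; apply/andP; split.
  apply: lb_le_inf; last exact: lb.
  by exists T => /=; rewrite T0 lexx; split=> //; right.
by apply: ge_inf; [exists 0; exact: lb|split; [rewrite T0 lexx|right]].
Qed.

(** Right continuity makes the infimum attained, hence non-strict inequalities on both sides. At t =
    T the equivalence would fail for levels never reached, since these are sent to [T]. *)
Lemma level_time_le (c : cumulative R R) v t : 0 <= t < T ->
  (level_time c v <= t) = (v <= c t).
Proof.
move=> /andP[t0 tT]; apply/idP/idP => [h|h]; last first.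
  apply: ge_inf; first by exists 0; exact: lb.
  by split; [rewrite t0 ltW|left].
rewrite leNgt; apply/negP => ctv.
(* Spending only half of the missing height keeps [c] below [v] on a whole interval after [t]. *)
have e0 : 0 < (v - c t) / 2 by lra.
have [e ce] := nondecreasing_right_continuousP t c e0.
have et : t < Num.min (t + e%:num) T by rewrite lt_min tT ltrDl andbT.
suff : Num.min (t + e%:num) T <= level_time c v by rewrite leNgt (le_lt_trans h et).
apply: lb_le_inf; first by exists T; split; [rewrite T0 lexx|right].
move=> q [/andP[q0 qT] [vq|->]]; last by rewrite ge_min lexx orbT.
rewrite ge_min leNgt; apply/orP; left; apply/negP => qe.
have := cumulative_is_nondecreasing c _ _ (ltW qe); lra.
Qed.

Lemma measurable_level_time d (Om : measurableType d) (C : Om -> cumulative R R)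
    (v : Om -> R) :
  (forall t, 0 <= t <= T -> measurable_fun setT (fun w => C w t)) ->
  measurable_fun setT v -> measurable_fun setT (fun w => level_time (C w) (v w)).
Proof.
move=> mC mv; apply: (@measurable_fun_le_itv _ _ _ T).
  by move=> w; exact: level_time_itv.
move=> x xT; rewrite (_ : [set w | _] = [set w | v w <= C w x]).
  apply: measurable_true; apply: measurable_fun_ler => //.
  by apply: mC; case/andP: xT => -> /ltW.
by apply/seteqP; split=> w /=; rewrite level_time_le.
Qed.

End time_change.

Lemma stieltjes_itvoc (R : realType) (c : cumulative R R) (a b : R) : a <= b ->
  lebesgue_stieltjes_measure c `]a, b]%classic = (c b - c a)%:E.
Proof.
move=> ab; rewrite /lebesgue_stieltjes_measure /measure_extension.
rewrite measurable_mu_extE/=; last exact: is_ocitv.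
by rewrite wlength_itv_bnd.
Qed.

Lemma ex_pushforward d1 d2 (T1 : measurableType d1) (T2 : measurableType d2)
    (R : realType) (m : {measure set T1 -> \bar R}) (f : T1 -> T2) :
  measurable_fun setT f ->
  exists mu : {measure set T2 -> \bar R}, forall A, mu A = m (f @^-1` A).
Proof.
by move=> mf; unshelve refine (ex_intro _ (pushforward m f : {measure set T2 -> \bar R}) _).
Qed.

Lemma ge0_integral_image d1 d2 (T1 : measurableType d1) (T2 : measurableType d2)
    (R : realType) (m1 : {measure set T1 -> \bar R})
    (m2 : {measure set T2 -> \bar R}) (f : T1 -> T2) (D : set T2)
    (g : T2 -> \bar R) :
  measurable_fun setT f -> measurable D ->
  (forall A, measurable A -> A `<=` D -> m2 A = m1 (f @^-1` A)) ->
  measurable_fun D g -> (forall t, 0%R <= g t)%E ->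
  (\int[m2]_(t in D) g t = \int[m1]_(u in f @^-1` D) g (f u))%E.
Proof.
move=> mf mD m12 mg g0; have [nu nuE] := ex_pushforward m1 mf.
rewrite (@eq_measure_integral _ _ _ _ nu); last first.
  by move=> A mA AD; rewrite nuE m12.
rewrite -(ge0_integral_pushforward mf m1 mD mg)//.
unshelve apply: (@eq_measure_integral _ _ _ _ (pushforward m1 f)).
by move=> A _ _; rewrite nuE.
Qed.

Section time_change_formula.
Context {R : realType}.
Variables (T : R) (c : cumulative R R) (k : R).
Hypotheses (T0 : 0 <= T) (c0 : forall t, t < 0 -> c t = 0)
  (cT : forall t, T <= t -> c t = c T).

(** The levels [k + u] with [u] in [D] fill ]0, c T]. The offset [k] is free: it will be the level
    at a stopping time, so that [u] measures the growth since then. *)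
Let D : set R := `](- k), (c T - k)].

Let phi u := level_time T c (k + u).

Let mphi : measurable_fun setT phi.
Proof.
apply: (@measurable_level_time _ _ T0 _ R (fun=> c) (fun u => k + u)) => //.
exact: measurable_funD.
Qed.

Lemma cumulative_ge0 t : 0 <= c t.
Proof.
have [/c0->//|t0] := ltP t 0.
by rewrite -(c0 (ltrN10 R)) cumulative_is_nondecreasing// (le_trans _ t0)// lerN10.
Qed.

Lemma cumulative_leT t : c t <= c T.
Proof.
by have [tT|/ltW/cT->//] := leP t T; rewrite cumulative_is_nondecreasing.
Qed.

Let phi_le u x : D u -> (phi u <= x) = (k + u <= c x).
Proof.
rewrite /D/= in_itv/= => /andP[h1 h2].
have /andP[p0 pT] := level_time_itv T0 c (k + u).
have [x0|x0] := ltP x 0.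
  apply/idP/idP => h; first by have := le_trans p0 h; lra.
  by rewrite c0// in h; lra.
have [xT|Tx] := ltP x T; first by rewrite /phi level_time_le// x0.
by rewrite (le_trans pT Tx) cT//; apply/esym; lra.
Qed.

Let mD : measurable D. Proof. exact: measurable_itv. Qed.

(** It suffices to compare half-open intervals: by [phi_le] the preimage of ]a, b] is ]c a - k, c b
    - k]. An atom of [c] becomes an interval of levels on which [phi] is constant. *)
Let stieltjesE A : measurable A ->
  lebesgue_stieltjes_measure c A = lebesgue_measure (phi @^-1` A `&` D).
Proof.
have [mu muE'] := @ex_pushforward _ _ (measurableTypeR R) (measurableTypeR R) _
  (mrestr (@lebesgue_measure R) (mD : measurable (D : set (measurableTypeR R)))) phi mphi.
suff muE : forall A, ocitv A -> lebesgue_stieltjes_measure c A = mu A.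
  by by move=> mA; rewrite (lebesgue_stieltjes_measure_unique muE mA) muE'.
move=> _ [[a b] _ <-] /=.
have [ba|ab] := ltP b a.
  by rewrite set_itv_ge ?bnd_simp -?leNgt ?(ltW ba)// !measure0.
rewrite stieltjes_itvoc// muE' /= /mrestr/=.
rewrite [X in lebesgue_measure X](_ : _ = `](c a - k), (c b - k)]%classic); last first.
  apply/seteqP; split=> [u [/= + Du]|u /=]; rewrite !in_itv/=.
    by rewrite ltNge !phi_le// -ltNge => h; lra.
  move=> h; have Du : D u.
    by rewrite /D/= in_itv/=; have := cumulative_ge0 a; have := cumulative_leT b; lra.
  by split=> //; rewrite ltNge !phi_le// -ltNge; lra.
rewrite lebesgue_measure_itv/= lte_fin.
have := cumulative_is_nondecreasing c _ _ ab.
rewrite le_eqVlt => /predU1P[->|cab]; first by rewrite ltxx subrr.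
by rewrite ltrD2r cab -EFinB; congr EFin; lra.
Qed.

Lemma stieltjes_time_change (g : R -> \bar R) : measurable_fun setT g ->
  (forall t, 0%R <= g t)%E ->
  (\int[lebesgue_stieltjes_measure c]_(t in `[0%R, T]) g t =
   \int[lebesgue_measure]_(u in `](- k)%R, (c T - k)%R])
     g (level_time T c (k + u)))%E.
Proof.
move=> mg g0.
(* Levels outside [D] are sent to -1, off [0, T], so that a map defined everywhere has the right
   preimages. *)
pose psi u := if u \in D then phi u else -1.
have mpsi : measurable_fun setT psi.
  apply: measurable_fun_ifT => //.
  rewrite (_ : (fun u => u \in D) = (fun u => (- k < u) && (u <= c T - k))).
    by apply: measurable_and; [exact: measurable_fun_ltr|exact: measurable_fun_ler].
  by apply/funext => u; rewrite mem_setE.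
have psiA (A : set R) : A `<=` `[0, T] -> psi @^-1` A = phi @^-1` A `&` D.
  move=> A0; apply/seteqP; split=> [u|u [Au /mem_set Du]] /=; rewrite /psi.
    by case: ifPn => [/set_mem//|_ /A0/=]; rewrite in_itv/= lerNr oppr0 ler10.
  by rewrite Du.
rewrite (@ge0_integral_image _ _ _ (measurableTypeR R) _ (@lebesgue_measure R) _ psi)//.
- rewrite [X in integral _ X](_ : _ = D).
    by apply: eq_integral => u Du /=; rewrite /psi Du.
  rewrite psiA// (_ : phi @^-1` _ = setT) ?setTI//.
  by rewrite -subTset => u _ /=; rewrite in_itv/= level_time_itv.
- by move=> A mA AT; rewrite psiA//; exact: stieltjesE.
- exact: measurable_funTS.
Qed.

End time_change_formula.

(** With horizon [t] the inverse looks at the path only up to time [t], which is what progressive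
    measurability needs; for a level reached by then the longer horizon changes nothing. *)
Lemma level_time_horizon (R : realType) (T t : R) (c : cumulative R R) (u : R) :
  0 <= t <= T -> u <= c t -> level_time T c u = level_time t c u.
Proof.
move=> /andP[t0 tT] ut; have T0 := le_trans t0 tT.
have /andP[a0 aT] := level_time_itv T0 c u.
have /andP[b0 bt] := level_time_itv t0 c u.
have at_ : level_time T c u <= t.
  have [tT'|Tt] := ltP t T; first by rewrite level_time_le// t0.
  by rewrite (le_trans aT).
apply/le_anti/andP; split.
- have [{}bt|tb] := ltP (level_time t c u) t; last by rewrite (le_trans at_).
  have := @level_time_le _ _ t0 c u (level_time t c u).
  rewrite b0 bt lexx => /(_ isT)/esym h.
  by rewrite level_time_le// b0 (lt_le_trans bt).
- have [{}at_|ta] := ltP (level_time T c u) t; last by rewrite (le_trans bt).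
  have := @level_time_le _ _ T0 c u (level_time T c u).
  rewrite a0 (lt_le_trans at_ tT) lexx => /(_ isT)/esym h.
  by rewrite level_time_le// a0.
Qed.

Lemma stieltjes_time_change_le (R : realType) (T s t : R) (c : cumulative R R)
    (g : R -> \bar R) : 0 <= s -> s <= t -> t <= T ->
  (forall t, t < 0 -> c t = 0) -> (forall t, T <= t -> c t = c T) ->
  measurable_fun setT g -> (forall q, 0%R <= g q)%E ->
  (\int[lebesgue_stieltjes_measure c]_(q in `[0%R, s]) g q =
   \int[lebesgue_measure]_(u in `]0%R, c s]) g (level_time t c u))%E.
Proof.
move=> s0 st tT c0 cT mg g0.
have T0 : 0 <= T by rewrite (le_trans s0)// (le_trans st).
have -> : `[0, s]%classic = `[0, T]%classic `&` `]-oo, s]%classic.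
  apply/seteqP; split=> q /=; rewrite !in_itv/=; first by move=> /andP[-> qs]; split=> //; lra.
  by case=> /andP[-> _ ->].
rewrite integral_mkcondr (stieltjes_time_change 0 T0 c0 cT); last 2 first.
- by apply/(measurable_restrictT _ _).1 => //; exact: measurable_funTS.
- by move=> q; rewrite patchE; case: ifP.
rewrite !oppr0 addr0 [RHS](_ : _ = \int[lebesgue_measure]_(u in `]0%R, c T] `&` `]-oo, c s]%classic) g (level_time t c u))%E.
  rewrite [RHS]integral_mkcondr; apply: eq_integral => u /set_mem/=; rewrite in_itv/= => uT.
  rewrite !patchE add0r !mem_setE.
  have lets : (level_time T c u <= s) = (u <= c s).
    have [sT|Ts] := ltP s T; first by rewrite level_time_le// s0.
    have <- : T = s by apply/le_anti; rewrite Ts (le_trans st).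
    by have /andP[_ ->] := level_time_itv T0 c u; case/andP: uT.
  rewrite !in_itv/= lets; case: ifPn => // us.
  rewrite (@level_time_horizon _ T t)//; first by rewrite (le_trans s0).
  by rewrite (le_trans us)// cumulative_is_nondecreasing.
congr integral; apply/seteqP; split=> u /=; rewrite !in_itv/=.
  move=> /andP[-> us]; split=> //=; rewrite (le_trans us)//.
  by rewrite cumulative_is_nondecreasing// (le_trans st).
by case=> /andP[-> _] ->.
Qed.

(** * Measurability of the marginal felicity *)

Lemma harmonic_dnbhs (R : realType) : (n.+1%:R^-1 : R) @[n --> \oo] `=>` 0^'.
Proof.
move=> A A0; have {}A0 : \forall n \near \oo, (n.+1%:R^-1 != 0 :> R) -> A n.+1%:R^-1.
  exact: cvg_harmonic A0.
suff : \forall n \near \oo, A n.+1%:R^-1 by [].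
by apply: filterS A0 => n; apply; rewrite invr_eq0 pnatr_eq0.
Qed.

Section partial_derivatives.
Context {R : realType}.
Variables (T : R) (f : R -> R -> R -> R).
Hypotheses (hf : measurable_fun (aggregator_domain T)
    (fun x : R * R * R => f x.1.1 x.1.2 x.2)) (hA1 : condA1 T f).

Let mdomain : measurable (aggregator_domain T).
Proof.
rewrite (_ : aggregator_domain T = (`[0, T] `*` `[0, +oo[) `*` [set: R]).
  by apply: measurableX => //; apply: measurableX; exact: measurable_itv.
apply/seteqP; split=> [[[s y] u] [/= h1 h2]|[[s y] u] [[/= +  +] _]].
  by split=> //=; split; rewrite /= in_itv/= ?andbT.
by rewrite !in_itv/= andbT.
Qed.

(** The increments 1/(n+1) are positive, hence admissible even at y = 0, and they exhibit the
    derivative as the limit of a sequence of measurable functions. *)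
Lemma cvg_partial_y s y u : 0 <= s <= T -> 0 <= y ->
  diff_quotient_y f s y u n.+1%:R^-1 @[n --> \oo] --> partial_y f s y u.
Proof.
move=> sT y0; have [_ [+ _ _ _] _] := hA1 sT; move=> /(_ y u y0) h.
apply: (cvg_comp (fun n : nat => n.+1%:R^-1) _ _ h) => A /harmonic_dnbhs A0.
have {}A0 : \forall n \near \oo, 0 <= y + n.+1%:R^-1 -> A n.+1%:R^-1 := A0.
suff : \forall n \near \oo, A n.+1%:R^-1 by [].
by apply: filterS A0 => n; apply; rewrite addr_ge0.
Qed.

Lemma partial_y_ge0 s y u : 0 <= s <= T -> 0 <= y -> 0 <= partial_y f s y u.
Proof.
move=> sT y0; have [_ _ fy] := hA1 sT.
have /cvgr_to_ge := @cvg_partial_y s y u sT y0; apply.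
near=> n; rewrite /diff_quotient_y mulr_ge0 ?invr_ge0// subr_ge0 ltW// fy//.
by rewrite ltrDl invr_gt0.
Unshelve. all: by end_near. Qed.

Lemma cvg_partial_u s y u : 0 <= s <= T -> 0 <= y ->
  n.+1%:R * (f s y (u + n.+1%:R^-1) - f s y u) @[n --> \oo] --> partial_u f s y u.
Proof.
move=> sT y0; have [_ [_ + _ _] _] := hA1 sT; move=> /(_ y u y0) h.
rewrite /partial_u derive1E /derive.
have := cvg_comp (fun n : nat => n.+1%:R^-1) _ (@harmonic_dnbhs R) h.
rewrite (_ : _ \o _ = (fun n : nat => n.+1%:R * (f s y (u + n.+1%:R^-1) - f s y u)))//.
by apply/funext => n /=; rewrite invrK /GRing.scale/= mulr1 (addrC u).
Qed.

Variables (d : measure_display) (X : measurableType d) (s y u : X -> R).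
Hypotheses (sT : forall x, 0 <= s x <= T) (y0 : forall x, 0 <= y x)
  (ms : measurable_fun setT s) (my : measurable_fun setT y)
  (mu : measurable_fun setT u).

Let measurable_f (y' u' : X -> R) : (forall x, 0 <= y' x) ->
  measurable_fun setT y' -> measurable_fun setT u' ->
  measurable_fun setT (fun x => f (s x) (y' x) (u' x)).
Proof.
move=> y'0 my' mu'.
apply: (measurable_comp mdomain _ hf (g := fun x => (s x, y' x, u' x))).
  by move=> _ [x _ <-]; split; [exact: sT|exact: y'0].
exact: measurable_fun_pair (measurable_fun_pair _ _) _.
Qed.

Lemma measurable_partial_y :
  measurable_fun setT (fun x => partial_y f (s x) (y x) (u x)).
Proof.
apply: (@measurable_fun_cvg _ _ _ _
  (fun n x => diff_quotient_y f (s x) (y x) (u x) n.+1%:R^-1)); last first.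
  by move=> x _; exact: cvg_partial_y.
move=> n; apply: measurable_funM => //; apply: measurable_funB.
  by apply: measurable_f => //; [move=> x; rewrite addr_ge0|exact: measurable_funD].
exact: measurable_f.
Qed.

Lemma measurable_partial_u :
  measurable_fun setT (fun x => partial_u f (s x) (y x) (u x)).
Proof.
apply: (@measurable_fun_cvg _ _ _ _
  (fun n x => n.+1%:R * (f (s x) (y x) (u x + n.+1%:R^-1) - f (s x) (y x) (u x)))); last first.
  by move=> x _; exact: cvg_partial_u.
move=> n; apply: measurable_funM => //; apply: measurable_funB.
  by apply: measurable_f => //; exact: measurable_funD.
exact: measurable_f.
Qed.

End partial_derivatives.

(** No integrability enters: the integral of a signed kernel is the difference of those of its two
    parts, and Tonelli applies to each. *)
Lemma measurable_fun_integral d1 d2 (X1 : measurableType d1)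
    (X2 : measurableType d2) (R : realType)
    (m : {sigma_finite_measure set X2 -> \bar R}) (k : X1 -> X2 -> \bar R) :
  measurable_fun setT (fun p => k p.1 p.2) ->
  measurable_fun setT (fun x => \int[m]_z k x z)%E.
Proof.
move=> mk; under eq_fun do rewrite integralE.
apply: emeasurable_funB.
- have := measurable_funepos mk; rewrite funepos.unlock => h.
  apply: (measurable_fun_fubini_tonelli_F (fun p => maxe (k p.1 p.2) 0) h).
  by move=> p; rewrite le_max lexx orbT.
- have := measurable_funeneg mk; rewrite funeneg.unlock => h.
  apply: (measurable_fun_fubini_tonelli_F (fun p => maxe (- k p.1 p.2) 0)%E h).
  by move=> p; rewrite le_max lexx orbT.
Qed.

Section progressive_measurability.
Context {R : realType} {d : measure_display} {Om : measurableType d}.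
Variables (T t : R) (C : Om -> cumulative R R) (U : R -> Om -> R).
Hypotheses (t0 : 0 <= t) (tT : t <= T)
  (C0 : forall w s, s < 0 -> C w s = 0) (CT : forall w s, T <= s -> C w s = C w T)
  (mC : forall s, 0 <= s <= t -> measurable_fun setT (fun w => C w s))
  (mU : forall s, 0 <= s <= t -> measurable_fun setT (U s))
  (rcU : forall w s, 0 <= s < t -> U q w @[q --> s^'+] --> U s w).
Variables (f : R -> R -> R -> R) (eta beta : R).
Hypotheses (hf : measurable_fun (aggregator_domain T)
    (fun x : R * R * R => f x.1.1 x.1.2 x.2)) (hA1 : condA1 T f)
  (eta0 : 0 <= eta) (beta0 : 0 <= beta).

Lemma measurable_plan_clip : measurable_fun setT (fun p : R * Om => C p.2 (clip t p.1)).
Proof.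
apply: (@measurable_fun_clip _ _ _ _ (fun s w => C w s)) => // w s _.
exact: cumulative_is_right_continuous.
Qed.

Lemma satisfaction_ge0 s w : 0 <= satisfaction eta beta C s w.
Proof.
rewrite addr_ge0 ?mulr_ge0 ?expR_ge0//.
by apply: Rintegral_ge0 => q _; rewrite mulr_ge0 ?expR_ge0.
Qed.

(** The time change turns the state-dependent Stieltjes measure in the level of satisfaction into
    Lebesgue measure on levels, leaving this kernel, jointly measurable in time, state and level. *)
Let dose (p : R * Om) (u : R) : R :=
  if (0 < u) && (u <= C p.2 (clip t p.1)) then
    beta * expR (- (beta * (clip t p.1 - level_time t (C p.2) u))) else 0.

Let satisfaction_clip p : satisfaction eta beta C (clip t p.1) p.2 =
  eta * expR (- (beta * clip t p.1)) +
  fine (\int[lebesgue_measure]_u (dose p u)%:E)%E.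
Proof.
have /andP[s0 st] := clip_itv p.1 t0.
congr (_ + fine _).
rewrite (@stieltjes_time_change_le _ T _ t)//; last 4 first.
- by move=> q; exact: C0.
- by move=> q; exact: CT.
- apply/measurable_EFinP; apply: measurable_funM => //.
  apply: measurableT_comp => //; apply: measurable_funN.
  by apply: measurable_funM => //; apply: measurable_funB.
- by move=> q; rewrite lee_fin mulr_ge0 ?expR_ge0.
rewrite integral_mkcond; apply: eq_integral => u _.
by rewrite patchE mem_setE in_itv/= /dose; case: ifP.
Qed.

Lemma measurable_satisfaction :
  measurable_fun setT (fun p : R * Om => satisfaction eta beta C (clip t p.1) p.2).
Proof.
rewrite (funext satisfaction_clip).
have mclip : measurable_fun setT (fun p : R * Om => clip t p.1).
  by apply: measurableT_comp => //; exact: measurable_clip.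
apply: measurable_funD.
  apply: measurable_funM => //; apply: measurableT_comp => //.
  by apply: measurable_funN; apply: measurable_funM.
apply: measurableT_comp; first exact: fine_measurable.
apply: measurable_fun_integral; apply/measurable_EFinP.
apply: measurable_fun_ifT => //.
- apply: measurable_and; first exact: measurable_fun_ltr.
  apply: measurable_fun_ler => //.
  by apply: (measurableT_comp measurable_plan_clip).
- apply: measurable_funM => //; apply: measurableT_comp => //.
  apply: measurable_funN; apply: measurable_funM => //; apply: measurable_funB.
    exact: (measurableT_comp mclip).
  apply: (@measurable_level_time _ t t0 _ _ (fun x : (R * Om) * R => C x.1.2)) => //.
  move=> s st; apply: (measurableT_comp (mC st)).
  exact: measurableT_comp.
Qed.

(** The measurable structure of [Om] is a parameter: the full one with t = T gives joint
    measurability, that of F_t gives progressive measurability. *)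
Lemma measurable_marginal_felicity :
  measurable_fun setT
    (fun p : R * Om => marginal_felicity f eta beta C U (clip t p.1) p.2).
Proof.
have cT s : 0 <= clip t s <= T.
  by have /andP[-> /le_trans ->] := clip_itv s t0.
have mUc := measurable_fun_clip t0 mU rcU.
apply: measurable_funM; last first.
  apply: (@measurable_partial_y _ T) => //.
  - by move=> p; exact: satisfaction_ge0.
  - by apply: measurableT_comp => //; exact: measurable_clip.
  - exact: measurable_satisfaction.
apply: measurableT_comp => //.
apply: measurableT_comp; first exact: fine_measurable.
rewrite [X in measurable_fun _ X](_ : _ = (fun p : R * Om =>
  \int[lebesgue_measure]_z (if (0 <= z) && (z <= clip t p.1) then
    partial_u f (clip t z) (satisfaction eta beta C (clip t z) p.2)
      (U (clip t z) p.2) else 0)%:E)%E); last first.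
  apply/funext => p; rewrite integral_mkcond; apply: eq_integral => z _.
  rewrite patchE mem_setE in_itv/=; case: ifP => // /andP[z0 zp].
  by rewrite !clip_id// z0 (le_trans zp)//; case/andP: (clip_itv p.1 t0).
apply: measurable_fun_integral; apply/measurable_EFinP.
have mzp : measurable_fun setT (fun x : (R * Om) * R => (x.2, x.1.2)).
  by apply: measurable_fun_pair => //; exact: measurableT_comp.
apply: measurable_fun_ifT => //.
- apply: measurable_and; apply: measurable_fun_ler => //.
  apply: (measurableT_comp (measurable_clip t)).
  exact: measurableT_comp.
- apply: (@measurable_partial_u _ T) => //.
  + by move=> p; exact: satisfaction_ge0.
  + by apply: measurableT_comp => //; exact: measurable_clip.
  + exact: (measurableT_comp measurable_satisfaction mzp).
  + exact: (measurableT_comp mUc mzp).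
Qed.

Lemma marginal_felicity_ge0 s w : 0 <= s <= T ->
  0 <= marginal_felicity f eta beta C U s w.
Proof.
move=> sT; rewrite mulr_ge0 ?expR_ge0//.
by apply: (partial_y_ge0 hA1) => //; exact: satisfaction_ge0.
Qed.

End progressive_measurability.

(** * Continuous martingales of finite variation *)

Section huber.
Context {R : realType}.
Implicit Types x y : R.

(* The Huber function, convex and vanishing only at 0, stands in for the square:
   its derivative [clamp] is bounded, so that only the integrability of the total
   variation is needed of the martingale. *)
Definition clamp x : R := Num.max (-1) (Num.min 1 x).
Definition huber x : R := clamp x * x - clamp x ^+ 2 / 2.

Lemma clampP x : [\/ x <= -1 /\ clamp x = -1, -1 <= x <= 1 /\ clamp x = x | 1 <= x /\ clamp x = 1].
Proof.
rewrite /clamp; case/orP: (le_total x (-1)) => x1.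
  by constructor 1; rewrite min_r ?max_l//; lra.
case/orP: (le_total 1 x) => x2.
  by constructor 3; rewrite min_l ?max_r//; lra.
by constructor 2; rewrite min_r// max_r// x1 x2.
Qed.

Lemma normr_clamp x : `|clamp x| <= 1.
Proof. by rewrite ler_norml; case: (clampP x) => -[? ->]; lra. Qed.

Lemma clamp_lipschitz x y : `|clamp x - clamp y| <= `|x - y|.
Proof.
have := ler_norm (x - y); have := ler_norm (- (x - y)); rewrite normrN.
by case: (clampP x) => -[? ->]; case: (clampP y) => -[? ->]; rewrite ler_norml; lra.
Qed.

Lemma huber_ge0 x : 0 <= huber x.
Proof. by rewrite /huber; case: (clampP x) => -[? ->]; nra. Qed.

Lemma huber_eq0 x : huber x = 0 -> x = 0.
Proof. by rewrite /huber; case: (clampP x) => -[? ->]; nra. Qed.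

(** Tangent inequality at [y], the later end of an increment. Writing clamp y as clamp x plus a
    difference splits the bound into a term with a coefficient known at the start and a second-order
    term. *)
Lemma huber_convex x y : huber y - huber x <= clamp y * (y - x).
Proof.
have := sqr_ge0 (1 + y); have := sqr_ge0 (1 - y); have := sqr_ge0 (x - y).
have := sqr_ge0 (1 + x); have := sqr_ge0 (1 - x); rewrite /huber.
case: (clampP x) => -[hx ->]; case: (clampP y) => -[hy ->]; nra.
Qed.

Lemma huber_le x : huber x <= `|x|.
Proof.
have := ler_norm x; have := ler_norm (- x); rewrite normrN /huber.
by case: (clampP x) => -[? ->]; nra.
Qed.

End huber.

(** * A running integral that is a martingale has a null integrand *)

Section null_martingale.
Context {d : measure_display} {Om : measurableType d} {R : realType}.
Variables (T : R) (P : probability Om R) (F : R -> set (set Om)) (l : R -> Om -> R).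
Hypotheses (T0 : 0 < T) (filtF : filtration T F)
  (ml : measurable_fun setT (fun p : R * Om => l (clip T p.1) p.2)).
Let V w := (\int[lebesgue_measure]_(q in `[0%R, T]) `|(l q w)%:E|)%E.
Hypothesis iV : (\int[P]_w V w < +oo)%E.
Let L t w := \int[lebesgue_measure]_(q in `[0, t]) l q w.
Hypotheses (aL : forall t, 0 <= t < T -> measurable_wrt (F t) (L t))
  (martL : forall s t A, 0 <= s -> s <= t -> t < T -> F s A ->
     (\int[P]_(w in A) (L t w - L s w)%:E = 0)%E).

Let T0' : 0 <= T. Proof. exact: ltW. Qed.

Let V_ge0 w : (0 <= V w)%E. Proof. exact: integral_ge0. Qed.

Let ml_itv w : measurable_fun `[0, T] (fun q => l q w).
Proof.
apply: (eq_measurable_fun (fun q => l (clip T q) w)).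
  by move=> q /set_mem; rewrite /= in_itv/= => qT; rewrite clip_id.
exact: measurable_funTS (measurable_fun_pair1 w ml).
Qed.

Let mV : measurable_fun setT V.
Proof.
rewrite (_ : V = (fun w => \int[lebesgue_measure]_q
    (if (0 <= q) && (q <= T) then `|l (clip T q) w| else 0)%:E)%E).
  apply: measurable_fun_integral; apply/measurable_EFinP.
  apply: measurable_fun_ifT => //.
    by apply: measurable_and; apply: measurable_fun_ler.
  apply: measurableT_comp => //.
  have mp : measurable_fun setT (fun x : Om * R => (x.2, x.1)).
    exact: measurable_fun_pair.
  exact: (measurableT_comp ml mp).
apply/funext => w; rewrite /V integral_mkcond; apply: eq_integral => q _.
rewrite patchE mem_setE in_itv/=; case: ifP => // qT.
by rewrite clip_id.
Qed.

Let aeV : {ae P, forall w, (V w < +oo)%E}.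
Proof.
have : P.-integrable setT V.
  apply/integrableP; split; first exact: mV.
  by under eq_integral do rewrite gee0_abs//.
move=> /(integrable_ae measurableT); apply: filterS => w /(_ I).
by rewrite ge0_fin_numE.
Qed.

Let integrable_path w : (V w < +oo)%E ->
  lebesgue_measure.-integrable `[0, T] (EFin \o l ^~ w).
Proof.
move=> Vw; apply/integrableP; split; last exact: Vw.
by apply/measurable_EFinP; exact: ml_itv.
Qed.

Let incr (g : R -> R) s t : lebesgue_measure.-integrable `[0, T] (EFin \o g) ->
  0 <= s -> s <= t -> t <= T ->
  \int[lebesgue_measure]_(q in `[0, t]) g q - \int[lebesgue_measure]_(q in `[0, s]) g q =
  \int[lebesgue_measure]_(q in `]s, t]) g q.
Proof.
move=> ig s0 st tT; rewrite Rintegral_itvB ?bnd_simp//.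
by apply: integrableS ig => //; apply: subset_itvl; rewrite bnd_simp.
Qed.

Let LA t w := \int[lebesgue_measure]_(q in `[0, t]) `|l q w|.

Let integrable_abs_path w : (V w < +oo)%E ->
  lebesgue_measure.-integrable `[0, T] (EFin \o (fun q => `|l q w|)).
Proof. by move=> /integrable_path ig; exact: integrable_norm. Qed.

Let L_LA w s t : (V w < +oo)%E -> 0 <= s -> s <= t -> t <= T ->
  `|L t w - L s w| <= LA t w - LA s w.
Proof.
move=> Vw s0 st tT; rewrite /L /LA !incr//; last 2 first.
- exact: integrable_abs_path.
- exact: integrable_path.
apply: le_normr_Rintegral => //; apply: integrableS (integrable_path Vw) => //.
move=> q; rewrite /= !in_itv/= => /andP[sq qt].
by rewrite (le_trans s0 (ltW sq))/= (le_trans qt tT).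
Qed.

Let LA0 w : LA 0 w = 0.
Proof. by rewrite /LA set_itv1 Rintegral_set1. Qed.

Let L0 w : L 0 w = 0.
Proof. by rewrite /L set_itv1 Rintegral_set1. Qed.

Let LAT w : (V w < +oo)%E -> LA T w = fine (V w).
Proof. by []. Qed.

Let LA_le w s t : (V w < +oo)%E -> 0 <= s -> s <= t -> t <= T -> LA s w <= LA t w.
Proof.
move=> Vw s0 st tT; rewrite -subr_ge0.
exact: le_trans (L_LA Vw s0 st tT).
Qed.

(** Absolute continuity of the integral: one [dl] serves all short intervals of the path at once. *)
Let LA_unif w e : (V w < +oo)%E -> 0 < e -> exists2 dl, 0 < dl &
  forall s t, 0 <= s -> s <= t -> t <= T -> t - s < dl -> LA t w - LA s w <= e.
Proof.
move=> Vw e0.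
have := @integral_normr_continuous _ _ _ (@lebesgue_measure R) ((l ^~ w) \_ `[0, T]) _ _ e0.
case.
  rewrite -restrict_EFin; apply/integrable_restrict => //=.
  by rewrite setTI; exact: integrable_path.
move=> dl [dl0 h]; exists dl => // s t s0 st tT tsd.
rewrite /LA incr//; last exact: integrable_abs_path.
have mst : measurable (`]s, t]%classic : set R) by exact: measurable_itv.
have lst : (@lebesgue_measure R `]s, t]%classic < dl%:E)%E.
  by rewrite lebesgue_measure_itv/= lte_fin; case: ifP => _; rewrite ?lte_fin// -EFinD lte_fin.
have := h _ mst lst => /ltW; apply: le_trans; rewrite le_eqVlt; apply/predU1P; left.
apply: eq_Rintegral => q /set_mem; rewrite /= in_itv/= => /andP[sq qt].
by rewrite patchE ifT// inE/= in_itv/= (le_trans s0 (ltW sq))/= (le_trans qt tT).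
Qed.

Section fixed_time.
Variable t : R.
Hypothesis tT : 0 <= t < T.

Let x n i : R := t * (i%:R / n.+1%:R).

Let x_ge0 n i : 0 <= x n i.
Proof. by rewrite mulr_ge0 ?divr_ge0//; case/andP: tT. Qed.

Let x_le n i : (i <= n.+1)%N -> x n i <= t.
Proof.
move=> i_n; rewrite ler_piMr//; first by case/andP: tT.
by rewrite ler_pdivrMr ?ltr0n// mul1r ler_nat.
Qed.

Let x_lt n i : (i <= n.+1)%N -> x n i < T.
Proof. by move=> /x_le /le_lt_trans; apply; case/andP: tT. Qed.

Let x_mono n i : x n i <= x n i.+1.
Proof.
rewrite ler_wpM2l//; first by case/andP: tT.
by rewrite ler_pM2r ?invr_gt0// ler_nat.
Qed.

Let x_step n i : x n i.+1 - x n i = t / n.+1%:R.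
Proof. by rewrite /x -mulrBr -mulrBl -natrB// subSnn mul1r. Qed.

Let D n i w := L (x n i.+1) w - L (x n i) w.
Let drift n w := \sum_(i < n.+1) clamp (L (x n i) w) * D n i w.
Let qvar n w := \sum_(i < n.+1)
  (clamp (L (x n i.+1) w) - clamp (L (x n i) w)) * D n i w.

Let mL s : 0 <= s < T -> measurable_fun setT (L s).
Proof.
move=> /andP[s0 sT]; have sT' : 0 <= s <= T by rewrite s0 ltW.
apply: (measurable_wrtT (filtration_algebra filtF sT') (filtration_measurable filtF sT')).
by apply: aL; rewrite s0.
Qed.

Let mLx n i : (i <= n.+1)%N -> measurable_fun setT (L (x n i)).
Proof. by move=> i_n; apply: mL; rewrite x_ge0 x_lt. Qed.

Let L_bound s w : 0 <= s <= T -> (V w < +oo)%E -> `|L s w| <= fine (V w).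
Proof.
move=> /andP[s0 sT] Vw; rewrite -(LAT Vw) -[L s w]subr0 -(L0 w).
rewrite (le_trans (L_LA Vw _ s0 sT))// LA0 subr0.
exact: LA_le.
Qed.

Let iL s : 0 <= s < T -> P.-integrable setT (EFin \o L s).
Proof.
move=> sT; have sT' : 0 <= s <= T by case/andP: sT => -> /ltW.
apply/integrableP; split; first exact/measurable_EFinP/mL.
apply: le_lt_trans iV; apply: ae_ge0_le_integral => //.
- by apply: measurableT_comp => //; exact/measurable_EFinP/mL.
- apply: filterS aeV => w Vw _; rewrite -[V w]fineK ?ge0_fin_numE//.
  by rewrite lee_fin; exact: L_bound.
Qed.

Let iD n i : (i < n.+1)%N -> P.-integrable setT (EFin \o D n i).
Proof.
move=> i_n; rewrite (_ : _ \o _ = (fun w => (L (x n i.+1) w)%:E - (L (x n i) w)%:E)%E)//.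
apply: integrableB => //; apply: iL; rewrite x_ge0 x_lt//.
exact: ltnW.
Qed.

Let mclamp : measurable_fun setT (@clamp R).
Proof.
by apply: measurable_maxr; [exact: measurable_cst|exact: measurable_minr].
Qed.

Let iclampD n i (Y : Om -> R) K : (i < n.+1)%N -> measurable_fun setT Y ->
  (forall w, `|Y w| <= K) -> P.-integrable setT (fun w => (Y w * D n i w)%:E).
Proof. by move=> i_n mY YK; exact: integrableM_bounded (iD i_n) mY YK. Qed.

Let idrift n : P.-integrable setT (EFin \o drift n).
Proof.
rewrite (_ : _ \o _ = (fun w => \sum_(i < n.+1) (clamp (L (x n i) w) * D n i w)%:E)%E).
  apply: integrable_sum => // i _; apply: (iclampD (K := 1)) => //.
    by apply: measurableT_comp => //; apply: mLx; exact: ltnW.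
  by move=> w; exact: normr_clamp.
by apply/funext => w; rewrite sumEFin.
Qed.

Let iqvar n : P.-integrable setT (EFin \o qvar n).
Proof.
rewrite (_ : _ \o _ = (fun w => \sum_(i < n.+1)
    ((clamp (L (x n i.+1) w) - clamp (L (x n i) w)) * D n i w)%:E)%E).
  apply: integrable_sum => // i _; apply: (iclampD (K := 2)) => //.
    by apply: measurable_funB; apply: measurableT_comp => //; apply: mLx => //; exact: ltnW.
  move=> w; rewrite (le_trans (ler_normB _ _))// (_ : 2 = 1 + 1)//.
  by rewrite lerD// normr_clamp.
by apply/funext => w; rewrite sumEFin.
Qed.

(** Each coefficient is bounded and known at the start of its step, hence orthogonal to the
    increment of the martingale. *)
Let integral_drift n : (\int[P]_w (drift n w)%:E = 0)%E.
Proof.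
rewrite /drift; under eq_integral do rewrite -sumEFin.
rewrite integral_sum//.
  rewrite big1// => i _.
  have xT : 0 <= x n i <= T by rewrite x_ge0 ltW// x_lt// ltnW.
  apply: (integral_mul_eq0 (filtration_algebra filtF xT)
    (filtration_measurable filtF xT) (iD (ltn_ord i)) (K := 1)).
  - by move=> A FA; apply: martL => //; exact: x_lt.
  - have := aL (t := x n i); rewrite x_ge0 x_lt// 1?ltnW// => /(_ isT) h.
    exact: (measurableT_comp mclamp h).
  - by move=> w; exact: normr_clamp.
move=> i; apply: (iclampD (K := 1)) => //.
  by apply: measurableT_comp => //; apply: mLx; exact: ltnW.
by move=> w; exact: normr_clamp.
Qed.

Let x0 n : x n 0 = 0. Proof. by rewrite /x mul0r mulr0. Qed.
Let xn n : x n n.+1 = t. Proof. by rewrite /x divff ?mulr1// pnatr_eq0. Qed.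

Let huber_le_sum n w : huber (L t w) <= qvar n w + drift n w.
Proof.
have -> : huber (L t w) = \sum_(i < n.+1) (huber (L (x n i.+1) w) - huber (L (x n i) w)).
  rewrite -(big_mkord xpredT (fun i => huber (L (x n i.+1) w) - huber (L (x n i) w))).
  rewrite (telescope_sumr (fun i => huber (L (x n i) w)))// xn x0 L0.
  by rewrite [X in _ - X](_ : _ = 0) ?subr0// /huber /clamp min_r ?max_r ?mulr0 ?expr0n/= ?mul0r ?subr0//; lra.
rewrite /qvar /drift -big_split/=; apply: ler_sum => i _.
by rewrite -mulrDl subrK; exact: huber_convex.
Qed.

Let sum_D n w : (V w < +oo)%E -> \sum_(i < n.+1) `|D n i w| <= fine (V w).
Proof.
move=> Vw; have /andP[t0 tT'] := tT.
apply: (@le_trans _ _ (\sum_(i < n.+1) (LA (x n i.+1) w - LA (x n i) w))).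
  by apply: ler_sum => i _; apply: L_LA => //; exact/ltW/x_lt.
rewrite -(big_mkord xpredT (fun i => LA (x n i.+1) w - LA (x n i) w)).
rewrite (telescope_sumr (fun i => LA (x n i) w))// xn x0 LA0 subr0 -LAT//.
by apply: LA_le => //; exact: ltW.
Qed.

Let qvar_le n w e : (V w < +oo)%E -> 0 <= e ->
  (forall i, (i < n.+1)%N -> `|clamp (L (x n i.+1) w) - clamp (L (x n i) w)| <= e) ->
  `|qvar n w| <= e * fine (V w).
Proof.
move=> Vw e0 h; rewrite (le_trans (ler_norm_sum _ _ _))//.
apply: (@le_trans _ _ (\sum_(i < n.+1) e * `|D n i w|)).
  by apply: ler_sum => i _; rewrite normrM ler_wpM2r// h.
by rewrite -mulr_sumr ler_wpM2l// sum_D.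
Qed.

(** The sum is at most the largest oscillation of [L] over the mesh times the total variation. *)
Let qvar_cvg w : (V w < +oo)%E -> qvar n w @[n --> \oo] --> 0.
Proof.
move=> Vw; apply/cvgrPdist_le => e e0.
have V0 : 0 <= fine (V w) by rewrite fine_ge0.
(* The added 1 keeps the denominator positive when the path has no variation. *)
have e'0 : 0 < e / (fine (V w) + 1) by rewrite divr_gt0// ltr_wpDl.
have [dl dl0 hdl] := LA_unif Vw e'0.
have hcvg : t / n.+1%:R @[n --> \oo] --> 0.
  rewrite -[X in _ --> X](mulr0 t); apply: cvgMl_tmp; exact: cvg_harmonic.
near=> n.
have tn : t / n.+1%:R < dl by near: n; exact: (cvgr_lt _ hcvg).
rewrite sub0r normrN; apply: (@le_trans _ _ (e / (fine (V w) + 1) * fine (V w))).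
  apply: qvar_le => //; first exact: ltW.
  move=> i i_n; apply: (le_trans (clamp_lipschitz _ _)).
  apply: (le_trans (L_LA Vw (x_ge0 n i) (x_mono n i) (ltW (x_lt i_n)))).
  by apply: hdl => //; [exact/ltW/x_lt|rewrite x_step].
rewrite -mulrA ler_piMr//; first exact: ltW.
by rewrite mulrC ler_pdivrMr ?ltr_wpDl// mul1r lerDl.
Unshelve. all: by end_near. Qed.

Let ihuber : P.-integrable setT (EFin \o (fun w => huber (L t w))).
Proof.
have mLt : measurable_fun setT (L t) by exact: mL.
have mh : measurable_fun setT (fun w => huber (L t w)).
  apply: measurable_funB.
    by apply: measurable_funM => //; exact: measurableT_comp.
  apply: measurable_funM => //; apply: measurable_funX.
  exact: measurableT_comp.
apply: (le_integrable measurableT _ _ (iL tT)); first exact/measurable_EFinP.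
by move=> w _ /=; rewrite lee_fin ger0_norm ?huber_ge0// huber_le.
Qed.

(** For every mesh the mean of [huber (L t)] is at most that of [qvar n], which tends to 0 under the
    dominating variable 2 V; a nonnegative variable of mean 0 vanishes almost surely. *)
Lemma null_martingale_at : {ae P, forall w, L t w = 0}.
Proof.
have le_qvar n : (\int[P]_w (huber (L t w))%:E <= \int[P]_w (qvar n w)%:E)%E.
  rewrite -[leRHS]adde0 -(integral_drift n) -integralD_EFin//.
  by apply: le_integral => //; [exact: (integrableD measurableT (iqvar n) (idrift n))|
    move=> w _; rewrite lee_fin huber_le_sum].
have mqvar n : measurable_fun setT (fun w => (qvar n w)%:E).
  exact: measurable_int (iqvar n).
have [] := @dominated_convergence _ _ _ P setT measurableT
  (fun n w => (qvar n w)%:E) (cst 0%E) (fun w => 2%:E * V w)%E.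
- by [].
- exact: measurable_cst.
- apply: filterS aeV => w Vw _; apply: cvg_EFin; [by near=> n|exact: qvar_cvg].
- apply: integrableZl => //; apply/integrableP; split; first exact: mV.
  by under eq_integral do rewrite gee0_abs//.
- apply: filterS aeV => w Vw n _; rewrite -[V w]fineK ?ge0_fin_numE// lee_fin.
  apply: qvar_le => // i i_n; rewrite (le_trans (ler_normB _ _))// (_ : 2 = 1 + 1)//.
  by rewrite lerD// normr_clamp.
move=> _ _; rewrite integral0 => lim0.
have : (\int[P]_w (huber (L t w))%:E <= 0)%E.
  by apply: (cvge_ge _ lim0); near=> n; exact: le_qvar.
move=> le0.
have h0 : (\int[P]_w `|(huber (L t w))%:E| = 0)%E.
  apply/le_anti; rewrite integral_ge0// andbT.
  by under eq_integral do rewrite gee0_abs ?lee_fin ?huber_ge0//.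
have := (ae_eq_integral_abs P measurableT (measurable_int _ ihuber)).1 h0.
by apply: filterS => w /(_ I) [] /huber_eq0.
Unshelve. all: by end_near. Qed.

End fixed_time.

Let L_cvg w (x : R^nat) t : (V w < +oo)%E -> (forall n, 0 <= x n <= T) -> 0 <= t <= T ->
  x n @[n --> \oo] --> t -> (forall n, L (x n) w = 0) -> L t w = 0.
Proof.
move=> Vw xT /andP[t0 tT] xt Lx.
apply: (@cvg_unique _ (@Rhausdorff R) (L (x n) w @[n --> \oo])); last first.
  by rewrite (funext Lx); exact: cvg_cst.
apply/cvgrPdist_le => e e0; have [dl dl0 hdl] := LA_unif Vw e0.
near=> n; have : `|t - x n| < dl by near: n; move/cvgrPdist_lt : xt; exact.
have /andP[x0 xT'] := xT n; have [tx|/ltW xt'] := leP t (x n).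
  rewrite distrC (distrC (L t w)) ger0_norm ?subr_ge0// => xd.
  exact: (le_trans (L_LA Vw t0 tx xT') (hdl _ _ t0 tx xT' xd)).
rewrite ger0_norm ?subr_ge0// => xd.
exact: (le_trans (L_LA Vw x0 xt' tT) (hdl _ _ x0 xt' tT xd)).
Unshelve. all: by end_near. Qed.

(** The times k/(n+1) share one null set; continuity of the path extends the vanishing to all times,
    and Lebesgue differentiation of a null primitive concludes. *)
Theorem null_martingale :
  {ae P, forall w, {ae lebesgue_measure, forall q, 0 <= q <= T -> l q w = 0}}.
Proof.
have Lgrid : {ae P, forall w, forall n k : nat, k%:R / n.+1%:R < T -> L (k%:R / n.+1%:R) w = 0}.
  apply/ae_foralln => n; apply/ae_foralln => k.
  have [kT|_] := ltP (k%:R / n.+1%:R) T; last exact: aeW.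
  have kT' : 0 <= (k%:R / n.+1%:R : R) < T by apply/andP; split=> //; exact: divr_ge0.
  by apply: filterS (null_martingale_at kT') => w.
apply: filterS2 aeV Lgrid => w Vw Lw.
have Lt t : 0 <= t < T -> L t w = 0.
  move=> /andP[t0 tT].
  pose s n : R := (Num.trunc (t * n.+1%:R))%:R / n.+1%:R.
  have sb n : t - n.+1%:R^-1 <= s n <= t.
    have /andP[h1 h2] := truncn_itv (mulr_ge0 t0 (ler0n R n.+1)).
    rewrite lerBlDr /s -[X in _ <= _ + X]mul1r -mulrDl natr1.
    by rewrite ler_pdivlMr ?ltr0n// ltW//= ler_pdivrMr ?ltr0n.
  apply: (@L_cvg w s t Vw); rewrite ?t0 ?(ltW tT)//.
  - move=> n; rewrite divr_ge0//=; have /andP[_ h] := sb n.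
    by rewrite (le_trans h)// ltW.
  - apply: (@squeeze_cvgr _ _ _ _ (fun n => t - n.+1%:R^-1) (fun=> t)).
    + by near=> n; exact: sb.
    + rewrite -[X in _ --> X]subr0; apply: cvgB; first exact: cvg_cst.
      exact: cvg_harmonic.
    + exact: cvg_cst.
  - by move=> n; apply: Lw; have /andP[_ h] := sb n; rewrite -/(s n) (le_lt_trans h).
(* The martingale property is available only before [T], so the end point is approached from the
   left. *)
have LT : L T w = 0.
  apply: (@L_cvg w (fun n => T - T * n.+1%:R^-1) T Vw); rewrite ?T0' ?lexx//.
  - move=> n; rewrite subr_ge0 ler_piMr//= ?invf_le1 ?ltr0n ?ler1n//.
    by rewrite gerBl mulr_ge0.
  - rewrite -[X in _ --> X]subr0; apply: cvgB; first exact: cvg_cst.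
    by rewrite -[X in _ --> X](mulr0 T); apply: cvgMl_tmp; exact: cvg_harmonic.
  - move=> n; apply: Lt; rewrite subr_ge0 ler_piMr//= ?invf_le1 ?ltr0n ?ler1n//.
    by rewrite gtrBl mulr_gt0// invr_gt0.
(* Extension by 0 off [0, T] makes the primitive from minus infinity the function just shown to
   vanish. *)
have ig : lebesgue_measure.-integrable setT (EFin \o ((l ^~ w) \_ `[0, T])).
  rewrite -restrict_EFin; apply/integrable_restrict => //=.
  by rewrite setTI; exact: integrable_path.
have ifs (y : R) : lebesgue_measure.-integrable `]-oo, y] (EFin \o ((l ^~ w) \_ `[0, T])).
  exact: integrableS ig.
have /= ae_der := FTC1Ny ifs (integrable_locally (measurable_itv _) (integrable_path Vw)).
have [N [mN N0 NQ]] := ae_der; exists N; split=> // q nq; apply: NQ => /= -[_ hq].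
apply: nq => qT; move: hq.
rewrite (_ : (fun y : R => _) = cst 0).
  by rewrite derive1_cst patchE ifT ?inE/= ?in_itv.
apply/funext => y /=; rewrite -Rintegral_mkcondr.
have [y0|y0] := ltP y 0.
  rewrite (_ : _ `&` _ = set0) ?Rintegral_set0//; apply/seteqP; split=> // z /=.
  by rewrite !in_itv/= => -[zy /andP[z0 _]]; move: (le_trans z0 zy); rewrite leNgt y0.
rewrite (_ : _ `&` _ = `[0, Num.min y T]%classic).
  have [yT|Ty] := ltP y T; last exact: LT.
  by apply: Lt; rewrite y0.
apply/seteqP; split=> z /=; rewrite !in_itv/=.
  by move=> [zy /andP[-> zT]]; rewrite le_min zy.
by rewrite le_min => /and3P[-> -> ->].
Unshelve. all: by end_near. Qed.

End null_martingale.

Lemma Rintegral_expR_decay (R : realType) (c x y : R) : x <= y ->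
  \int[lebesgue_measure]_(q in `[x, y]) (c * expR (- (c * q))) =
  expR (- (c * x)) - expR (- (c * y)).
Proof.
rewrite le_eqVlt => /predU1P[->|xy].
  by rewrite set_itv1 Rintegral_set1 subrr.
have dF (q : R) : is_derive q 1 (fun q => - expR (- (c * q)) : R) (c * expR (- (c * q))).
  apply: is_derive_eq.
  by rewrite /GRing.scale/= mulr1 mulrN opprK mulrC.
have cf : continuous (fun q : R => c * expR (- (c * q))).
  move=> q; apply: cvgMl_tmp; apply: continuous_cvg; first exact: continuous_expR.
  by apply: cvgN; apply: cvgMl_tmp; exact: cvg_id.
have cF : continuous (fun q : R => - expR (- (c * q))).
  move=> q; apply: cvgN; apply: continuous_cvg; first exact: continuous_expR.
  by apply: cvgN; apply: cvgMl_tmp; exact: cvg_id.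
rewrite /Rintegral (continuous_FTC2 xy (F := fun q => - expR (- (c * q)))).
- by rewrite /= opprK addrC.
- exact: continuous_subspaceT.
- split.
  + by move=> q _; exact: ex_derive.
  + exact/cvg_at_right_filter/cF.
  + exact/cvg_at_left_filter/cF.
- by move=> q _; rewrite derive1E; exact: derive_val.
Qed.

Lemma ae_lebesgue_exists (R : realType) (Q : R -> Prop) (a b : R) : a < b ->
  {ae lebesgue_measure, forall u : R, Q u} -> exists u, a < u <= b /\ Q u.
Proof.
move=> ab [N [mN N0 NQ]]; apply: contrapT => nex.
have : `]a, b]%classic `<=` N.
  move=> u; rewrite /= in_itv/= => ue; apply: NQ => /= Qu.
  by apply: nex; exists u.
move=> /(le_measure (@lebesgue_measure R)); rewrite !inE => /(_ _ mN).
have mab : measurable (`]a, b]%classic : set R) by exact: measurable_itv.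
move=> /(_ mab) le0; have : (lebesgue_measure (`]a, b]%classic : set R) <= 0)%E.
  by rewrite -N0.
by rewrite lebesgue_measure_itv/= lte_fin ab -EFinB lee_fin subr_le0 leNgt ab.
Qed.

(** Generators suffice, and they come from adapted cadlag processes, which are jointly measurable by
    [measurable_fun_clip]. *)
Lemma measurable_optional d (Om : measurableType d) (R : realType) (T : R)
    (F : R -> set (set Om)) (G : R -> Om -> \bar R) d' (X : measurableType d')
    (s : X -> R) (w : X -> Om) :
  0 <= T -> filtration T F -> optional T F G ->
  (forall x, 0 <= s x <= T) -> measurable_fun setT s -> measurable_fun setT w ->
  measurable_fun setT (fun x => G (s x) (w x)).
Proof.
move=> T0 filtF oG sT ms mw.
pose phi x : R * Om := (s x, w x).
have mphi : @measurable_fun _ _ X (g_sigma_algebraType (optional_gen T F)) setT phi.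
  apply: (@measurability _ _ X (g_sigma_algebraType (optional_gen T F)) setT phi
    (optional_gen T F)) => //.
  move=> _ [_ [Y [S mS [aY cY ->]]] <-]; rewrite setTI.
  rewrite (_ : _ @^-1` _ = (fun x => Y (clip T (s x)) (w x)) @^-1` S).
    rewrite -[X in measurable X]setTI.
    suff : measurable_fun setT (fun x => Y (clip T (s x)) (w x)) by exact.
    have mY : measurable_fun setT (fun p : R * Om => Y (clip T p.1) p.2).
      apply: measurable_fun_clip => //; first by move=> q qT; exact: adaptedT aY qT.
      by move=> v q /andP[q0 qT]; apply: (cY v).1.
    exact: (measurableT_comp mY (measurable_fun_pair ms mw)).
  by apply/seteqP; split=> x /=; rewrite clip_id// => -[].
move=> _ S mS; rewrite setTI.
have -> : (fun x => G (s x) (w x)) @^-1` S =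
    phi @^-1` ([set p | 0 <= p.1 <= T] `&` (fun p : R * Om => G p.1 p.2) @^-1` S).
  by apply/seteqP; split=> x /= => [|[]].
rewrite -[X in measurable X]setTI; apply: mphi => //; apply: oG => //.
(* The whole strip of times in [0, T] is the generator attached to the zero process. *)
apply: sub_sigma_algebra; exists (fun _ _ => 0); exists setT => //; split.
- by move=> t tT; exact: measurable_cst.
- by move=> v; split=> t t1 t2; [exact: cvg_cst|exact: is_cvg_cst].
- by apply/seteqP; split=> p /=; [split|case].
Qed.

(** * First-order condition *)

Section first_order_condition.
Context {d : measure_display} {Om : measurableType d} {R : realType}.
Variables (T : R) (P : probability Om R) (F : R -> set (set Om)).
Hypotheses (T0 : 0 < T) (filtF : filtration T F).
Variables (r beta M : R) (psi : R -> Om -> R).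
Let Z t w := expR (r * t) * psi t w.
Hypotheses (apsi : adapted T F psi)
  (rcpsi : forall w s, 0 <= s < T -> psi q w @[q --> s^'+] --> psi s w)
  (psi0 : forall s w, 0 <= psi s w)
  (iZT : P.-integrable setT (EFin \o Z T))
  (martZ : forall t, 0 <= t <= T -> forall A, F t A ->
     (\int[P]_(w in A) (Z t w)%:E = \int[P]_(w in A) (Z T w)%:E)%E).
Variable C : Om -> cumulative R R.
Hypotheses (C0 : forall w s, s < 0 -> C w s = 0)
  (CT : forall w s, T <= s -> C w s = C w T)
  (aC : adapted T F (fun t w => C w t)).
Variable a : R -> Om -> R.
Hypotheses (ma : measurable_fun setT (fun p : R * Om => a (clip T p.1) p.2))
  (a0 : forall s w, 0 <= s <= T -> 0 <= a s w).
Let aint t w := (\int[lebesgue_measure]_(s in `[t, T]) (a s w)%:E)%E.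
Hypothesis iA : (\int[P]_w aint 0 w < +oo)%E.
Variable G : R -> Om -> \bar R.
Hypotheses (oG : optional T F G)
  (projG : forall tau, stopping_time T F tau ->
     forall A, stopped_sigma_algebra T F tau A ->
     (\int[P]_(w in A) G (tau w) w =
      \int[P]_(w in A) ((expR (beta * tau w))%:E * aint (tau w) w))%E)
  (leG : {ae P, forall w, forall t, 0 <= t <= T -> (G t w <= (M * psi t w)%:E)%E})
  (slackG : (\int[P]_w \int[lebesgue_stieltjes_measure (C w)]_(t in `[0%R, T])
     (G t w - (M * psi t w)%:E) = 0)%E).

Let T0' : 0 <= T. Proof. exact: ltW. Qed.
Let TT : 0 <= T <= T. Proof. by rewrite T0' lexx. Qed.

Let aZ : adapted T F Z.
Proof.
by move=> t tT; apply: measurable_funM; [exact: measurable_cst|exact: apsi].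
Qed.

Let rcZ w s : 0 <= s < T -> Z q w @[q --> s^'+] --> Z s w.
Proof.
move=> sT; apply: cvgM; last exact: rcpsi.
apply: cvg_at_right_filter; apply: (@continuous_comp _ _ _ (fun q => r * q) expR).
  by apply: continuousM; [exact: cvg_cst|exact: cvg_id].
exact: continuous_expR.
Qed.

Let Z0 s w : 0 <= Z s w. Proof. by rewrite mulr_ge0 ?expR_ge0. Qed.

Lemma measurable_aint : measurable_fun setT (fun p : R * Om => aint (clip T p.1) p.2).
Proof.
rewrite [X in measurable_fun _ X](_ : _ = (fun p : R * Om =>
  \int[lebesgue_measure]_s (if (clip T p.1 <= s) && (s <= T) then
    a (clip T s) p.2 else 0)%:E)%E); last first.
  apply/funext => p; rewrite /aint integral_mkcond; apply: eq_integral => s _.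
  rewrite patchE mem_setE in_itv/=; case: ifP => // /andP[s0 sT].
  by rewrite clip_id// sT (le_trans _ s0)//; case/andP: (clip_itv p.1 T0').
apply: measurable_fun_integral; apply/measurable_EFinP.
apply: measurable_fun_ifT => //.
- apply: measurable_and; apply: measurable_fun_ler => //.
  by apply: (measurableT_comp (measurable_clip T)); exact: measurableT_comp.
- have mp : measurable_fun setT (fun x : (R * Om) * R => (x.2, x.1.2)).
    by apply: measurable_fun_pair => //; exact: measurableT_comp.
  exact: (measurableT_comp ma mp).
Qed.

Let ma_section w : measurable_fun setT (fun s => a (clip T s) w).
Proof. exact: measurable_fun_pair1 ma. Qed.

Let aint_ge0 t w : 0 <= t -> (0 <= aint t w)%E.
Proof.
move=> t0; apply: integral_ge0 => s; rewrite /= in_itv/= => /andP[ts sT].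
by rewrite lee_fin a0// sT (le_trans t0).
Qed.

Let ma_itv t w : 0 <= t -> measurable_fun `[t, T] (fun s => (a s w)%:E).
Proof.
move=> t0; apply/measurable_EFinP.
apply: (eq_measurable_fun (fun s => a (clip T s) w)).
  by move=> s /set_mem; rewrite /= in_itv/= => /andP[ts sT]; rewrite clip_id// sT (le_trans t0).
exact: measurable_funTS.
Qed.

Let aint_le t w : 0 <= t -> (aint t w <= aint 0 w)%E.
Proof.
move=> t0; apply: ge0_subset_integral => //.
- exact: ma_itv.
- move=> s; rewrite /= in_itv/= => sT; by rewrite lee_fin a0.
- by move=> s; rewrite /= !in_itv/= => /andP[/(le_trans t0) -> ->].
Qed.

Let measurable_aint_at (s : Om -> R) : (forall w, 0 <= s w <= T) -> measurable_fun setT s ->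
  measurable_fun setT (fun w => aint (s w) w).
Proof.
move=> sT ms.
have := measurableT_comp measurable_aint (measurable_fun_pair ms (@measurable_id _ _ setT)).
by apply: eq_measurable_fun => w _ /=; rewrite clip_id.
Qed.

Lemma ae_aint_fin : {ae P, forall w, (aint 0 w < +oo)%E}.
Proof.
have : P.-integrable setT (aint 0).
  apply/integrableP; split.
    by apply: (@measurable_aint_at (fun=> 0)) => // w; rewrite lexx.
  by under eq_integral do rewrite gee0_abs ?aint_ge0//.
move=> /(integrable_ae measurableT); apply: filterS => w /(_ I).
by rewrite ge0_fin_numE// aint_ge0.
Qed.

(* Conditioning on F_t turns [expR (beta * t) * gap t] into M psi_t - G_t, the
   slack of the first-order condition; unlike the latter, [gap] has explicit paths. *)
Let gap t w : R := M * (expR (- ((beta + r) * t)) * Z T w) - fine (aint t w).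

(** The sign of beta + r is not fixed, hence the absolute value in the exponent. *)
Let gap_dom w : R := `|M| * (expR (`|beta + r| * T) * Z T w) + fine (aint 0 w).

Lemma gap_bound t w : 0 <= t <= T -> (aint 0 w < +oo)%E -> `|gap t w| <= gap_dom w.
Proof.
move=> /andP[t0 tT] aw; rewrite (le_trans (ler_normB _ _))// lerD//.
  rewrite normrM ler_wpM2l// ger0_norm ?mulr_ge0 ?expR_ge0//.
  rewrite ler_wpM2r// ler_expR (le_trans (ler_norm _))// normrN normrM.
  by rewrite ler_wpM2l// ger0_norm.
rewrite ger0_norm ?fine_ge0 ?aint_ge0// fine_le//; last exact: aint_le.
- by rewrite ge0_fin_numE ?aint_ge0// (le_lt_trans (aint_le _ t0)).
- by rewrite ge0_fin_numE ?aint_ge0.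
Qed.

Lemma gap_dom_integrable : P.-integrable setT (EFin \o gap_dom).
Proof.
rewrite (_ : _ \o _ = (fun w => (`|M|%:E * ((expR (`|beta + r| * T))%:E * (Z T w)%:E) + (fine (aint 0 w))%:E)%E))//.
apply: integrableD => //.
  by apply: integrableZl => //; apply: integrableZl.
apply/integrableP; split.
  apply/measurable_EFinP; apply: measurableT_comp => //.
  by apply: (@measurable_aint_at (fun=> 0)) => // w; rewrite lexx.
apply: le_lt_trans iA; apply: ge0_le_integral => //.
- apply: measurableT_comp => //; apply/measurable_EFinP; apply: measurableT_comp => //.
  by apply: (@measurable_aint_at (fun=> 0)) => // w; rewrite lexx.
- by apply: (@measurable_aint_at (fun=> 0)) => // w; rewrite lexx.
- move=> w _; have := aint_ge0 w (lexx 0); case: (aint 0 w) => [x| |]//= x0.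
    by rewrite lee_fin ger0_norm.
  exact: leey.
Qed.

Let mgap_at (s : Om -> R) : (forall w, 0 <= s w <= T) -> measurable_fun setT s ->
  measurable_fun setT (fun w => gap (s w) w).
Proof.
move=> sT ms; apply: measurable_funB.
  apply: measurable_funM => //; apply: measurable_funM; last exact: (adaptedT filtF aZ).
  by apply: measurableT_comp => //; apply: measurable_funN; apply: measurable_funM.
by apply: measurableT_comp; [exact: fine_measurable|exact: measurable_aint_at].
Qed.

Let integrable_fine_aint (s : Om -> R) : (forall w, 0 <= s w <= T) -> measurable_fun setT s ->
  P.-integrable setT (fun w => (fine (aint (s w) w))%:E).
Proof.
move=> sT ms; apply/integrableP; split.
  apply/measurable_EFinP.
  by apply: measurableT_comp; [exact: fine_measurable|exact: measurable_aint_at].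
apply: le_lt_trans iA; apply: ge0_le_integral => //.
- apply: measurableT_comp => //; apply/measurable_EFinP.
  by apply: measurableT_comp; [exact: fine_measurable|exact: measurable_aint_at].
- by apply: (@measurable_aint_at (fun=> 0)) => // w; rewrite lexx.
- move=> w _; have /andP[s0 _] := sT w.
  apply: le_trans (aint_le w s0); have := aint_ge0 w s0.
  case: (aint (s w) w) => [x| |]//= x0; first by rewrite lee_fin ger0_norm.
  exact: leey.
Qed.

(** Two variables orthogonal to F_tau are combined: [W1], the increment of Z from tau to T, by
    optional stopping, and [W2], because on [B] the contact replaces M psi by [G], which averages
    like the projected integral. On [B] the gap equals e^{-beta tau} W2 - M e^{-(beta+r) tau} W1. *)
Lemma integral_gap_contact tau B : stopping_time T F tau ->
  stopped_sigma_algebra T F tau B ->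
  {ae P, forall w, B w -> G (tau w) w = (M * psi (tau w) w)%:E} ->
  (\int[P]_(w in B) (gap (tau w) w)%:E = 0)%E.
Proof.
move=> stau sB contact.
have tauT w : 0 <= tau w <= T by case: stau => + _; apply.
have mtau : measurable_fun setT tau := stopping_time_measurable filtF stau.
have sF := stopped_sub_sigma_algebra T0' filtF stau.
have Fm := stopped_sub_measurable T0' filtF (tau := tau).
have mB : measurable B := Fm _ sB.
have mZT : measurable_fun setT (Z T) := adaptedT filtF aZ TT.
have mZtau : measurable_fun setT (fun w => Z (tau w) w).
  by apply: (measurable_fun_stopped T0') => // q qT; exact: (adaptedT filtF aZ).
have OS := optional_stopping T0' filtF aZ rcZ Z0 iZT martZ stau.
have iZtau : P.-integrable setT (fun w => (Z (tau w) w)%:E).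
  apply/integrableP; split; first exact/measurable_EFinP.
  under eq_integral do rewrite gee0_abs ?lee_fin//.
  rewrite OS; last exact: (stopping_timeT T0' filtF stau).
  have /integrableP[_] := iZT; apply: le_lt_trans.
  by apply: ge0_le_integral => //; [move=> w _; rewrite lee_fin|exact/measurable_EFinP|
    exact/measurableT_comp/measurable_EFinP|move=> w _; rewrite lee_fin ler_norm].
have wtau := stopping_time_wrt T0' filtF stau.
have wexp (k : R) : measurable_wrt (stopped_sigma_algebra T F tau)
    (fun w => expR (- (k * tau w))).
  by apply: measurableT_comp => //; apply: measurable_funN; apply: measurable_funM.
have expb (k : R) w : `|expR (- (k * tau w))| <= expR (`|k| * T).
  rewrite ger0_norm ?expR_ge0// ler_expR (le_trans (ler_norm _))// normrN normrM.
  by rewrite ler_wpM2l// ger0_norm; case/andP: (tauT w).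
have mexp (k : R) : measurable_fun setT (fun w => expR (- (k * tau w))).
  by apply: measurableT_comp => //; apply: measurable_funN; apply: measurable_funM.
have ipsi : P.-integrable setT (fun w => (psi (tau w) w)%:E).
  have -> : (fun w => (psi (tau w) w)%:E) =
      (fun w => (expR (- (r * tau w)) * Z (tau w) w)%:E).
    by apply/funext => w; rewrite /Z mulrA -expRD addNr expR0 mul1r.
  exact: integrableM_bounded iZtau (mexp r) (expb r).
pose W1 w := Z (tau w) w - Z T w.
have iW1 : P.-integrable setT (EFin \o W1).
  rewrite (_ : _ \o _ = (fun w => (Z (tau w) w)%:E - (Z T w)%:E)%E)//.
  exact: integrableB.
have W10 : (\int[P]_w ((expR (- ((beta + r) * tau w)) * \1_B w) * W1 w)%:E = 0)%E.
  apply: (integral_mul_eq0 sF Fm iW1 (K := expR (`|beta + r| * T))).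
  - move=> A sA; have mA := Fm _ sA.
    rewrite /W1 integralB_EFin//; [|exact: integrableS iZtau|exact: integrableS iZT].
    by rewrite OS// subee// integrable_fin_num//; exact: integrableS iZT.
  - apply: measurable_funM; first exact: wexp.
    by apply: measurable_indic; rewrite measurable_sigma_algebraE.
  - move=> w; rewrite normrM (le_trans _ (expb _ w))// ler_piMr//.
    by rewrite indicE; case: (_ \in _); rewrite ?normr1 ?normr0.
pose W2 w := \1_B w * (M * psi (tau w) w - expR (beta * tau w) * fine (aint (tau w) w)).
have mexp' : measurable_fun setT (fun w => expR (beta * tau w)).
  by apply: measurableT_comp => //; apply: measurable_funM.
have iea : P.-integrable setT (fun w => (expR (beta * tau w) * fine (aint (tau w) w))%:E).
  apply: (integrableM_bounded (integrable_fine_aint tauT mtau) mexp' (K := expR (`|- beta| * T))).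
  by move=> w; have := expb (- beta) w; rewrite mulNr opprK.
have iMpsi : P.-integrable setT (fun w => (M * psi (tau w) w)%:E).
  by under eq_fun do rewrite EFinM; exact: integrableZl.
have iW2 : P.-integrable setT (EFin \o W2).
  apply: (@integrableM_bounded _ _ _ _ _ (\1_B) 1).
  - rewrite (_ : _ \o _ = (fun w => (M * psi (tau w) w)%:E - (expR (beta * tau w) * fine (aint (tau w) w))%:E)%E)//.
    exact: integrableB.
  - exact: measurable_indic.
  - by move=> w; rewrite indicE; case: (_ \in _); rewrite ?normr1 ?normr0.
have W20 : (\int[P]_w (expR (- (beta * tau w)) * W2 w)%:E = 0)%E.
  apply: (integral_mul_eq0 sF Fm iW2 _ (wexp beta) (expb beta)) => A sA.
  have sAB : stopped_sigma_algebra T F tau (A `&` B).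
    rewrite -measurable_sigma_algebraE//.
    by apply: measurableI; rewrite measurable_sigma_algebraE.
  have mA := Fm _ sA; have mAB := Fm _ sAB.
  rewrite -integral_EFin_indic.
  under eq_integral do rewrite /W2 mulrA.
  have -> : (fun w => (\1_A w * \1_B w * (M * psi (tau w) w - expR (beta * tau w) * fine (aint (tau w) w)))%:E) =
      (fun w => (\1_(A `&` B) w * (M * psi (tau w) w - expR (beta * tau w) * fine (aint (tau w) w)))%:E).
    by apply/funext => w; rewrite indicI.
  rewrite integral_EFin_indic integralB_EFin//; last 2 first.
  - exact: integrableS iMpsi.
  - exact: integrableS iea.
  have e1 : (\int[P]_(w in A `&` B) (M * psi (tau w) w)%:E = \int[P]_(w in A `&` B) G (tau w) w)%E.
    apply: ae_eq_integral => //.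
    - by apply: measurable_funTS; exact: measurable_int iMpsi.
    - apply: measurable_funTS.
      exact: (measurable_optional T0' filtF oG tauT mtau (@measurable_id _ _ setT)).
    - by apply: filterS contact => w h [_ Bw]; rewrite h.
  have e2 : (\int[P]_(w in A `&` B) (expR (beta * tau w) * fine (aint (tau w) w))%:E =
      \int[P]_(w in A `&` B) G (tau w) w)%E.
    rewrite projG//; apply: ae_eq_integral => //.
    - by apply: measurable_funTS; exact: measurable_int iea.
    - apply: measurable_funTS; apply: emeasurable_funM.
        exact/measurable_EFinP.
      exact: measurable_aint_at.
    - apply: filterS ae_aint_fin => w aw _; rewrite EFinM fineK// ge0_fin_numE.
        by apply: le_lt_trans aw; apply: aint_le; case/andP: (tauT w).
      by apply: aint_ge0; case/andP: (tauT w).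
  by rewrite e1 e2 subee// -e1 integrable_fin_num//; exact: integrableS iMpsi.
rewrite -integral_EFin_indic.
have gapE w : \1_B w * gap (tau w) w = expR (- (beta * tau w)) * W2 w -
    M * ((expR (- ((beta + r) * tau w)) * \1_B w) * W1 w).
  rewrite /W2 /W1 /gap /Z.
  have -> : expR (- ((beta + r) * tau w)) = expR (- (beta * tau w)) * expR (- (r * tau w)).
    by rewrite -expRD; congr expR; ring.
  have h1 : expR (- (beta * tau w)) * expR (beta * tau w) = 1 by rewrite -expRD addNr expR0.
  have h2 : expR (- (r * tau w)) * expR (r * tau w) = 1 by rewrite -expRD addNr expR0.
  (* Exponentials are atoms for [ring]: the products equal to 1 stay visible, and the last summand
     collects the defect of one of them. *)
  rewrite mulrBr [RHS](_ : _ = \1_B w * (M * (expR (- (beta * tau w)) * expR (- (r * tau w)) *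
     (expR (r * T) * psi T w))) - \1_B w * ((expR (- (beta * tau w)) * expR (beta * tau w)) * fine (aint (tau w) w))
    + \1_B w * M * psi (tau w) w * expR (- (beta * tau w)) * (1 - expR (- (r * tau w)) * expR (r * tau w))); last by ring.
  by rewrite h1 h2 subrr mulr0 addr0 mul1r.
under eq_integral do rewrite gapE.
rewrite integralB_EFin//.
- rewrite W20 sub0e; under eq_integral do rewrite EFinM.
  rewrite integralZl// ?W10 ?mule0 ?oppe0//.
  apply: (integrableM_bounded iW1 (K := expR (`|beta + r| * T))).
    by apply: measurable_funM.
  move=> w; rewrite normrM (le_trans _ (expb _ w))// ler_piMr//.
  by rewrite indicE; case: (_ \in _); rewrite ?normr1 ?normr0.
- exact: integrableM_bounded iW2 (mexp beta) (expb beta).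
- rewrite (_ : _ \o _ = (fun w => M%:E * ((expR (- ((beta + r) * tau w)) * \1_B w) * W1 w)%:E)%E)//.
  apply: integrableZl => //.
  apply: (integrableM_bounded iW1 (K := expR (`|beta + r| * T))).
    by apply: measurable_funM.
  move=> w; rewrite normrM (le_trans _ (expb _ w))// ler_piMr//.
  by rewrite indicE; case: (_ \in _); rewrite ?normr1 ?normr0.
Qed.

(* The first time at which [C] exceeds the level [k] by [u]. *)
Let hit (k : Om -> R) (u : R) (w : Om) : R := level_time T (C w) (k w + u).

Let hit_itv k u w : 0 <= hit k u w <= T.
Proof. exact: level_time_itv. Qed.

Let mC s : 0 <= s <= T -> measurable_fun setT (fun w => C w s).
Proof. exact: (adaptedT filtF aC). Qed.

Let mhit k : measurable_fun setT k ->
  measurable_fun setT (fun p : Om * R => hit k p.2 p.1).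
Proof.
move=> mk; apply: (@measurable_level_time _ _ T0' _ _ (fun p : Om * R => C p.1)).
  by move=> t tT; apply: (measurableT_comp (mC tT)).
by apply: measurable_funD => //; exact: measurableT_comp.
Qed.

Let hit_dom k w u : bool := (- k w < u) && (u <= C w T - k w).

Let mhit_dom k : measurable_fun setT k ->
  measurable_fun setT (fun p : Om * R => hit_dom k p.1 p.2).
Proof.
move=> mk; apply: measurable_and.
  apply: measurable_fun_ltr => //; apply: measurable_funN.
  exact: measurableT_comp.
apply: measurable_fun_ler => //; apply: measurable_funB; last exact: measurableT_comp.
exact: (measurableT_comp (mC TT)).
Qed.

Let stieltjes_hit k (g : R -> Om -> \bar R) w :
  measurable_fun setT (fun p : R * Om => g (clip T p.1) p.2) ->
  (forall t w, 0 <= t <= T -> (0%R <= g t w)%E) ->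
  (\int[lebesgue_stieltjes_measure (C w)]_(t in `[0%R, T]) g t w =
   \int[lebesgue_measure]_u (if hit_dom k w u then g (hit k u w) w else 0))%E.
Proof.
move=> mg g0.
transitivity (\int[lebesgue_stieltjes_measure (C w)]_(t in `[0%R, T]) g (clip T t) w)%E.
  by apply: eq_integral => t /set_mem; rewrite /= in_itv/= => tT; rewrite clip_id.
rewrite (@stieltjes_time_change _ T (C w) (k w))//.
- rewrite integral_mkcond; apply: eq_integral => u _.
  by rewrite patchE mem_setE in_itv/= -/(hit_dom k w u) clip_id//; exact: level_time_itv.
- by move=> t; exact: C0.
- by move=> t; exact: CT.
- exact: (measurable_fun_pair1 w mg).
- by move=> t; apply: g0; exact: clip_itv.
Qed.

Let mg_hit k (g : R -> Om -> \bar R) : measurable_fun setT k ->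
  measurable_fun setT (fun p : R * Om => g (clip T p.1) p.2) ->
  measurable_fun setT (fun p : Om * R =>
    (if hit_dom k p.1 p.2 then g (hit k p.2 p.1) p.1 else 0)%E).
Proof.
move=> mk mg; apply: measurable_fun_ifT => //; first exact: mhit_dom.
have := measurableT_comp mg (measurable_fun_pair (mhit mk) (@measurable_fst _ _ _ _)).
by apply: eq_measurable_fun => p _ /=; rewrite clip_id//; exact: level_time_itv.
Qed.

Let ge0_measurable_stieltjes (g : R -> Om -> \bar R) :
  measurable_fun setT (fun p : R * Om => g (clip T p.1) p.2) ->
  (forall t w, 0 <= t <= T -> (0%R <= g t w)%E) ->
  measurable_fun setT (fun w =>
    \int[lebesgue_stieltjes_measure (C w)]_(t in `[0%R, T]) g t w)%E.
Proof.
move=> mg g0; under eq_fun do rewrite (stieltjes_hit (fun=> 0))//.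
by apply: measurable_fun_integral; apply: mg_hit.
Qed.

Lemma measurable_stieltjes (g : R -> Om -> \bar R) :
  measurable_fun setT (fun p : R * Om => g (clip T p.1) p.2) ->
  measurable_fun setT (fun w =>
    \int[lebesgue_stieltjes_measure (C w)]_(t in `[0%R, T]) g t w)%E.
Proof.
move=> mg; under eq_fun do rewrite integralE funepos.unlock funeneg.unlock.
apply: emeasurable_funB.
- apply: (@ge0_measurable_stieltjes (fun t w => maxe (g t w) 0)%E).
    by have := measurable_funepos mg; rewrite funepos.unlock.
  by move=> t w _; rewrite le_max lexx orbT.
- apply: (@ge0_measurable_stieltjes (fun t w => maxe (- g t w) 0)%E).
    by have := measurable_funeneg mg; rewrite funeneg.unlock.
  by move=> t w _; rewrite le_max lexx orbT.
Qed.

(** The bound [leG] holds only almost surely; the positive part gives Tonelli a kernel that is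
    nonnegative everywhere. *)
Let slack t w : \bar R := maxe ((M * psi t w)%:E - G t w)%E 0%E.

Let mGclip : measurable_fun setT (fun p : R * Om => G (clip T p.1) p.2).
Proof.
apply: (measurable_optional T0' filtF oG) => //.
- by move=> p; exact: clip_itv.
- by apply: measurableT_comp => //; exact: measurable_clip.
Qed.

Let mMpsi : measurable_fun setT (fun p : R * Om => (M * psi (clip T p.1) p.2)%:E).
Proof.
apply/measurable_EFinP; apply: measurable_funM => //.
by apply: measurable_fun_clip => // s sT; exact: (adaptedT filtF apsi).
Qed.

Let mslack : measurable_fun setT (fun p : R * Om => slack (clip T p.1) p.2).
Proof. by apply: measurable_maxe => //; exact: emeasurable_funB. Qed.

Let slack_ge0 t w : (0 <= slack t w)%E.
Proof. by rewrite le_max lexx orbT. Qed.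

Lemma slack_eq0 : (\int[P]_w \int[lebesgue_stieltjes_measure (C w)]_(t in `[0%R, T])
  slack t w = 0)%E.
Proof.
have ms : measurable_fun setT (fun w =>
    \int[lebesgue_stieltjes_measure (C w)]_(t in `[0%R, T]) slack t w)%E.
  exact: ge0_measurable_stieltjes.
apply/eqP; rewrite -oppe_eq0 -integral_ge0N; last by move=> w _; exact: integral_ge0.
apply/eqP; rewrite -[RHS]slackG; apply: ae_eq_integral => //.
- exact: measurableT_comp.
- apply: (@measurable_stieltjes (fun t w => (G t w - (M * psi t w)%:E)%E)).
  exact: emeasurable_funB.
- apply: filterS leG => w h _; rewrite -integral_ge0N//.
  apply: eq_integral => t /set_mem; rewrite /= in_itv/= => tT.
  rewrite /slack max_l; last by rewrite sube_ge0 ?orbT// h.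
  by rewrite oppeB// addeC.
Qed.

(** A nonnegative kernel of total mass 0 vanishes almost everywhere. Exchanging the integrals puts
    the level outside: for almost every fixed [u], contact holds almost surely at one random time,
    which [stopping_time_hit] will show to be a stopping time. *)
Lemma contact_at_hits k : measurable_fun setT k ->
  {ae lebesgue_measure, forall u, {ae P, forall w, hit_dom k w u ->
     G (hit k u w) w = (M * psi (hit k u w) w)%:E}}.
Proof.
move=> mk.
have mPhi := mg_hit mk mslack.
set Phi := (fun p : Om * R => _) in mPhi.
have Phi0 p : (0 <= Phi p)%E by rewrite /Phi; case: ifP.
have : (\int[P]_w \int[lebesgue_measure]_u Phi (w, u) = 0)%E.
  rewrite -slack_eq0; apply: eq_integral => w _.
  by rewrite (@stieltjes_hit k).
rewrite fubini_tonelli// => int0.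
have mF : measurable_fun setT (fun u : R => \int[P]_w Phi (w, u))%E.
  exact: (measurable_fun_fubini_tonelli_G (m1 := P) Phi mPhi Phi0).
have := (ae_eq_integral_abs (@lebesgue_measure R) measurableT mF).1.
move=> h; have {}h := h _.
have : ae_eq (@lebesgue_measure R) setT (fun u : R => \int[P]_w Phi (w, u))%E (cst 0%E).
  apply: h; rewrite -[RHS]int0; apply: eq_integral => u _.
  by rewrite gee0_abs// integral_ge0.
apply: filterS => u /(_ I) /= Phiu.
have mPu : measurable_fun setT (fun w => Phi (w, u)).
  exact: (measurable_fun_pair1 u mPhi).
have := (ae_eq_integral_abs P measurableT mPu).1.
under eq_integral do rewrite gee0_abs//.
move=> /(_ Phiu) aePhi; near=> w => dom.
have : Phi (w, u) = 0%E by near: w; apply: filterS aePhi => w; apply.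
have leGw : (G (hit k u w) w <= (M * psi (hit k u w) w)%:E)%E.
  have lew t : 0 <= t <= T -> (G t w <= (M * psi t w)%:E)%E.
    by move: t; near: w; exact: leG.
  exact/lew/hit_itv.
rewrite /Phi/= dom /slack max_l ?sube_ge0 ?orbT//.
case: (G _ _) leGw => [g| |]//= _ /eqP.
by rewrite -EFinB eqe subr_eq0 => /eqP ->.
Unshelve. all: by end_near. Qed.

Lemma gap_cvg w (x : R^nat) t : (aint 0 w < +oo)%E -> 0 <= t <= T ->
  (forall n, 0 <= x n <= T) -> x n @[n --> \oo] --> t ->
  gap (x n) w @[n --> \oo] --> gap t w.
Proof.
move=> aw tT xT xt.
have ia : lebesgue_measure.-integrable `[0, T] (EFin \o a ^~ w).
  apply/integrableP; split; first exact: ma_itv.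
  apply: le_lt_trans aw; rewrite le_eqVlt; apply/predU1P; left.
  apply: eq_integral => s /set_mem; rewrite /= in_itv/= => sT.
  by rewrite ger0_norm// a0.
have aintE s : 0 <= s <= T -> fine (aint s w) =
    \int[lebesgue_measure]_(q in `[0, T]) a q w - \int[lebesgue_measure]_(q in `[0, s]) a q w.
  move=> /andP[s0 sT].
  rewrite (Rintegral_itvB ia) ?bnd_simp// Rintegral_itv_obnd_cbnd//.
  by apply: integrableS ia => //; apply: subset_itvr; rewrite bnd_simp.
apply: cvgB.
  apply: cvgMl_tmp; apply: cvgMr_tmp; apply: continuous_cvg; first exact: continuous_expR.
  by apply: cvgN; apply: cvgMl_tmp.
rewrite aintE//; under eq_fun do rewrite aintE//.
apply: cvgB; first exact: cvg_cst.
have := parameterized_integral_continuous T0' ia.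
move=> /subspace_continuousP /(_ t) h; have {}h := h _.
have tT' : `[0, T]%classic t by rewrite /= in_itv.
apply: (cvg_comp x _ _ (h tT')) => B; rewrite /within/= => BT.
suff : \forall n \near \oo, B (x n) by [].
have := xt _ BT; rewrite /nbhs/= => hB.
have {}hB : \forall n \near \oo, `[0, T]%classic (x n) -> B (x n) := hB.
by apply: filterS hB => n; apply; rewrite /= in_itv/=.
Qed.

Lemma stopping_time_min_wrt sigma t : stopping_time T F sigma -> 0 <= t <= T ->
  measurable_wrt (F t) (fun w => Num.min (sigma w) t).
Proof.
move=> [sigmaT ssigma] tT; have [t0 tT'] := andP tT.
apply: (@measurable_fun_le_itv _ (g_sigma_algebraType (F t)) _ t).
  by move=> w; rewrite le_min t0 ge_min lexx orbT; case/andP: (sigmaT w) => ->.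
move=> x /andP[x0 xt]; rewrite (filtrationE filtF)//.
rewrite (_ : [set w | _] = [set w | sigma w <= x]).
  apply: (filtration_le filtF x0 (ltW xt) tT').
  by apply: ssigma; rewrite x0 (le_trans (ltW xt)).
apply/seteqP; split=> w /=; last by rewrite ge_min => ->.
by rewrite ge_min => /orP[//|]; rewrite leNgt xt.
Qed.

(** * Averages of the gap at a stopping time after which consumption increases *)

Section increase.
Variable sigma : Om -> R.
Hypothesis ssigma : stopping_time T F sigma.
Let sigmaT w : 0 <= sigma w <= T. Proof. by case: ssigma => + _; apply. Qed.
Let msigma : measurable_fun setT sigma := stopping_time_measurable filtF ssigma.
Let k w := C w (sigma w).
Let mk : measurable_fun setT k.
Proof.
apply: (@measurable_fun_stopped _ _ _ T (fun s w => C w s)) => //.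
by move=> w s _; exact: cumulative_is_right_continuous.
Qed.

Let level_wrt t : 0 <= t <= T -> measurable_wrt (F t) (fun w => C w (Num.min (sigma w) t)).
Proof.
move=> tT; have [t0 tT'] := andP tT.
apply: (@measurable_fun_stopped _ _ (g_sigma_algebraType (F t)) t (fun s w => C w s)) => //.
- by move=> w; rewrite le_min t0 ge_min lexx orbT; case/andP: (sigmaT w) => ->.
- exact: stopping_time_min_wrt.
- by move=> s /andP[s0 st]; exact: (adapted_le filtF aC).
- by move=> w s _; exact: cumulative_is_right_continuous.
Qed.

(** The level [k] need not be known at [t]. But for u > 0 the event forces sigma <= t, and there [k]
    is the level at the minimum of sigma and [t], which is known. *)
Let level_event u t : 0 < u -> 0 <= t <= T -> F t [set w | k w + u <= C w t].
Proof.
move=> u0 tT; have sF := filtration_algebra filtF tT.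
rewrite (_ : [set w | _] = [set w | sigma w <= t] `&`
    [set w | C w (Num.min (sigma w) t) + u <= C w t]).
  apply: (filtrationI filtF tT); first by case: ssigma => _; apply.
  rewrite -measurable_sigma_algebraE//; apply: measurable_true.
  apply: measurable_fun_ler; last exact: aC.
  by apply: measurable_funD; [exact: level_wrt|exact: measurable_cst].
apply/seteqP; split=> w /=; rewrite /k; last first.
  by case=> st; rewrite min_l.
have [st|ts] := leP (sigma w) t; first by split.
have := cumulative_is_nondecreasing (C w) _ _ (ltW ts); lra.
Qed.

Let hit_le u w t : 0 <= t < T -> (hit k u w <= t) = (k w + u <= C w t).
Proof. exact: level_time_le. Qed.

Lemma stopping_time_hit u : 0 < u -> stopping_time T F (hit k u).
Proof.
move=> u0; split=> [w|t /andP[t0 tT]]; first exact: hit_itv.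
have [tT'|Tt] := ltP t T.
  rewrite (_ : [set w | _] = [set w | k w + u <= C w t]).
    by apply: level_event => //; rewrite t0.
  by apply/seteqP; split=> w /=; rewrite hit_le// t0.
rewrite (_ : [set w | _] = setT).
  by apply: sub_sigma_algebraT; apply: (filtration_algebra filtF); rewrite t0.
rewrite -subTset => w _ /=; apply: le_trans Tt.
by case/andP: (hit_itv k u w).
Qed.

(* Since [C] increases right after sigma, the times [hit k u], at which the
   first-order condition binds for almost every u, decrease to sigma as u -> 0. *)
Lemma integral_gap_increase A : stopped_sigma_algebra T F sigma A ->
  {ae P, forall w, sigma w < T -> forall t, sigma w < t <= T -> C w (sigma w) < C w t} ->
  (\int[P]_(w in A `&` [set w | (sigma w < T)%R]) (gap (sigma w) w)%:E = 0)%E.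
Proof.
move=> sA inc.
(* A level in ]0, 1/(n+1)] is picked outside the Lebesgue-null set of exceptional ones. *)
have /choice[u uP] : forall n : nat, exists u : R, 0 < u <= n.+1%:R^-1 /\
    {ae P, forall w, hit_dom k w u -> G (hit k u w) w = (M * psi (hit k u w) w)%:E}.
  by move=> n; apply: ae_lebesgue_exists; [rewrite invr_gt0|exact: contact_at_hits].
have u0 n : 0 < u n by case: (uP n) => /andP[].
have ucvg : u n @[n --> \oo] --> 0.
  apply: (@squeeze_cvgr _ _ _ _ (fun=> 0) (fun n => n.+1%:R^-1)).
  - by near=> n; case: (uP n) => /andP[/ltW -> ->].
  - exact: cvg_cst.
  - exact: cvg_harmonic.
(* On [B n] the level is reached by [T], so that [hit] is a true crossing time and not its default
   value [T]. *)
pose B n := A `&` [set w | sigma w < T] `&` [set w | k w + u n <= C w T].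
have sT : F T [set w | sigma w < T].
  have := stopped_sigma_algebra_lt filtF ssigma (stopping_timeT T0' filtF ssigma) T0'.
  by rewrite setTI minxx.
(* Before [T], reaching the level forces sigma to have occurred, so [A] is already decided; at t = T
   the event only has to lie in F_T. *)
have sB n : stopped_sigma_algebra T F (hit k (u n)) (B n).
  have BT : F T (B n).
    apply: (filtrationI filtF TT); last exact: level_event.
    by apply: (filtrationI filtF TT) => //; case: sA.
  split=> // t /andP[t0 tT]; have tT2 : 0 <= t <= T by rewrite t0.
  have [tT'|Tt] := ltP t T; last first.
    have -> : t = T by apply/le_anti; rewrite tT.
    rewrite (_ : [set w | _] = setT) ?setIT//.
    by rewrite -subTset => w _ /=; case/andP: (hit_itv k (u n) w).
  rewrite (_ : _ `&` _ = (A `&` [set w | sigma w <= t]) `&` [set w | k w + u n <= C w t]).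
    apply: (filtrationI filtF tT2); last exact: level_event.
    by case: sA => _; apply.
  apply/seteqP; split=> w /=.
    rewrite hit_le ?t0// => -[[[Aw sw] kT] kt]; split=> //; split=> //.
    rewrite leNgt; apply/negP => ts.
    have := cumulative_is_nondecreasing (C w) _ _ (ltW ts).
    by have := u0 n; rewrite /k in kt; lra.
  rewrite hit_le ?t0// => -[[Aw st] kt]; split=> //; split; first by split=> //; exact: le_lt_trans tT'.
  by apply: (le_trans kt); rewrite cumulative_is_nondecreasing.
have mB n : measurable (B n) := stopped_sub_measurable T0' filtF (sB n).
have mA : measurable (A `&` [set w | sigma w < T]).
  apply: measurableI; first exact: (stopped_sub_measurable T0' filtF sA).
  exact: (filtration_measurable filtF TT sT).
have gap0 n : (\int[P]_w (\1_(B n) w * gap (hit k (u n) w) w)%:E = 0)%E.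
  rewrite integral_EFin_indic; apply: integral_gap_contact => //; first exact: stopping_time_hit.
  case: (uP n) => _; apply: filterS => w h [_ /= kT]; apply: h.
  rewrite /hit_dom; have := u0 n; have := cumulative_ge0 (C0 w) (sigma w).
  by rewrite -/(k w) => h1 h2; apply/andP; split; lra.
have mhit_n n : measurable_fun setT (hit k (u n)).
  by apply: (stopping_time_measurable filtF); exact: stopping_time_hit.
have [] := @dominated_convergence _ _ _ P setT measurableT
  (fun n w => (\1_(B n) w * gap (hit k (u n) w) w)%:E)
  (fun w => (\1_(A `&` [set w | sigma w < T]) w * gap (sigma w) w)%:E)
  (fun w => (gap_dom w)%:E).
- move=> n; apply/measurable_EFinP; apply: measurable_funM; first exact: measurable_indic.
  by apply: mgap_at => // w; exact: hit_itv.
- apply/measurable_EFinP; apply: measurable_funM; first exact: measurable_indic.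
  exact: mgap_at.
- apply: filterS2 ae_aint_fin inc => w aw incw _.
  suff h : \1_(B n) w * gap (hit k (u n) w) w @[n --> \oo] -->
      \1_(A `&` [set w | sigma w < T]) w * gap (sigma w) w.
    by apply: cvg_EFin; [near=> n|exact: h].
  have [|nA] := pselect ((A `&` [set w | sigma w < T]) w); last first.
    have -> : (fun n => \1_(B n) w * gap (hit k (u n) w) w) = cst 0.
      apply/funext => n; rewrite indicE memNset ?mul0r//.
      by move=> [Aw _]; exact: nA.
    by rewrite indicE memNset// mul0r; exact: cvg_cst.
  move=> [Aw /= sw].
  have near_level t : sigma w < t <= T -> \forall n \near \oo, k w + u n <= C w t.
    move=> st; have kt : 0 < C w t - k w by rewrite subr_gt0 incw.
    near=> n; have : u n <= C w t - k w by near: n; exact: (cvgr_le _ ucvg).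
    lra.
  apply: cvgM.
    have h : \forall n \near \oo, \1_(B n) w = \1_(A `&` [set w0 | sigma w0 < T]) w :> R.
      have : \forall n \near \oo, k w + u n <= C w T by apply: near_level; rewrite sw lexx.
      by apply: filterS => n kn; rewrite !indicE !mem_set.
    by apply: cvg_near_cst.
  apply: (@gap_cvg w (fun n => hit k (u n) w) (sigma w) aw (sigmaT w)).
    by move=> n; exact: hit_itv.
  have hs n : sigma w <= hit k (u n) w.
    rewrite leNgt; apply/negP => h.
    have hT : 0 <= hit k (u n) w < T.
      by have /andP[-> _] := hit_itv k (u n) w; exact: lt_trans sw.
    have := lexx (hit k (u n) w); rewrite hit_le//.
    have := cumulative_is_nondecreasing (C w) _ _ (ltW h); rewrite -/(k w).
    by have := u0 n; lra.
  apply/cvgrPdist_le => e e0.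
  have st : sigma w < Num.min (sigma w + e) T <= T.
    by rewrite lt_min sw ltrDl e0 ge_min lexx orbT.
  have := near_level _ st; apply: filterS => n kn.
  have hle : hit k (u n) w <= Num.min (sigma w + e) T.
    have [tT|Tt] := ltP (Num.min (sigma w + e) T) T.
      rewrite hit_le// tT andbT ltW//; case/andP: st => + _; apply: le_lt_trans.
      by case/andP: (sigmaT w).
    by apply: le_trans Tt; case/andP: (hit_itv k (u n) w).
  rewrite ler_distlC; have := hs n.
  by move: hle; rewrite le_min => /andP[h1 _] h2; apply/andP; split; lra.
- exact: gap_dom_integrable.
- apply: filterS ae_aint_fin => w aw n _; rewrite lee_fin normrM.
  apply: (le_trans _ (gap_bound (hit_itv k (u n) w) aw)).
  by rewrite ler_piMl// indicE; case: (_ \in _); rewrite ?normr1 ?normr0.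
move=> _ _.
rewrite (_ : [sequence _]_n = cst 0%E); last by apply/funext => n; exact: gap0.
move=> /cvg_lim -/(_ (@ereal_hausdorff _)); rewrite lim_cst// => h.
by rewrite -integral_EFin_indic; exact/esym/h.
Unshelve. all: by end_near. Qed.

End increase.

(** * Vanishing of the excess on the free interval *)

Section free_region.
Variables tau0 tau1 : Om -> R.
Hypotheses (stau0 : stopping_time T F tau0) (stau1 : stopping_time T F tau1)
  (lt01 : {ae P, forall w, tau0 w < tau1 w})
  (inc : {ae P, forall w, forall t q, tau0 w <= t <= tau1 w -> t < q <= T -> C w t < C w q})
  (pa : forall t, 0 <= t <= T -> measurable_fun setT
     (fun p : R * g_sigma_algebraType (F t) => a (clip t p.1) p.2)).

Let free q w : bool := (tau0 w <= q) && (q < tau1 w).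

Let decay q : R := expR (- ((beta + r) * q)).

Let excess q w : R :=
  if free q w then a q w - M * (beta + r) * (decay q * Z q w) else 0.

Let tau0T w : 0 <= tau0 w <= T. Proof. by case: stau0 => + _; apply. Qed.
Let tau1T w : 0 <= tau1 w <= T. Proof. by case: stau1 => + _; apply. Qed.

Let sg t w : R := Num.min (Num.max (tau0 w) t) (tau1 w).

Let sg_stopping t : 0 <= t <= T -> stopping_time T F (sg t).
Proof.
move=> /andP[t0 tT]; split=> [w|q qT].
  have := tau0T w; have := tau1T w; rewrite /sg => /andP[h1 h2] /andP[h3 h4].
  by rewrite le_min le_max h3 h1/= ge_min h2 orbT.
have [_ /(_ _ qT) F0] := stau0; have [_ /(_ _ qT) F1] := stau1.
have -> : [set w | sg t w <= q] =
    (if t <= q then [set w | tau0 w <= q] else set0) `|` [set w | tau1 w <= q].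
  apply/seteqP; split=> w /=; rewrite /sg ge_min ge_max; case: (t <= q) => //=.
  - by rewrite andbT => /orP[|]; [left|right].
  - by rewrite andbF => h; right.
  - by rewrite andbT => -[->|->]; rewrite ?orbT.
  - by case=> // ->; rewrite orbT.
rewrite -(filtrationE filtF)//; apply: measurableU; last by rewrite (filtrationE filtF _ qT).
by case: ifP => _; [rewrite (filtrationE filtF _ qT)|exact: measurable0].
Qed.

(** Moving [s] and [t] into [tau0, tau1] cuts [s, t[ down to its free part; the half-open
    conventions make this exact. *)
Let sg_free s t q w : 0 <= s -> s <= t ->
  (s <= q < t) && free q w = (sg s w <= q < sg t w).
Proof.
move=> s0 st; rewrite /free /sg !ge_min !lt_min !ge_max !lt_max.
by apply/idP/idP; lra.
Qed.

Let mfree : measurable_fun setT (fun p : R * Om => free p.1 p.2).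
Proof.
have m0 := stopping_time_measurable filtF stau0.
have m1 := stopping_time_measurable filtF stau1.
apply: measurable_and.
  by apply: measurable_fun_ler => //; exact: measurableT_comp.
by apply: measurable_fun_ltr => //; exact: measurableT_comp.
Qed.

Let mdecay : measurable_fun setT decay.
Proof.
by apply: measurableT_comp => //; apply: measurable_funN; exact: measurable_funM.
Qed.

Let mZclip : measurable_fun setT (fun p : R * Om => Z (clip T p.1) p.2).
Proof. by apply: measurable_fun_clip => // s sT; exact: (adaptedT filtF aZ). Qed.

Let mclip1 d' (X : measurableType d') t : measurable_fun setT (fun p : R * X => clip t p.1).
Proof. by apply: measurableT_comp => //; exact: measurable_clip. Qed.

Let mexcess : measurable_fun setT (fun p : R * Om => excess (clip T p.1) p.2).
Proof.
apply: measurable_fun_ifT => //.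
  have mp : measurable_fun setT (fun p : R * Om => (clip T p.1, p.2)).
    by apply: measurable_fun_pair => //; exact: mclip1.
  exact: (measurableT_comp mfree mp).
apply: measurable_funB => //; apply: measurable_funM => //.
apply: measurable_funM; last exact: mZclip.
by apply: measurableT_comp => //; exact: mclip1.
Qed.

(** Before [t] the comparison may use the minimum of tau and [t], which is known at [t]. At the time
    [t] itself that minimum would make the inequality always true, and {tau <= t} is used
    directly. *)
Let tau_le_progressive tau t : stopping_time T F tau -> 0 <= t <= T ->
  measurable_fun setT (fun p : R * g_sigma_algebraType (F t) => tau p.2 <= clip t p.1).
Proof.
move=> stau tT; have [t0 tT'] := andP tT.
rewrite (_ : (fun p : R * _ => _) = (fun p : R * g_sigma_algebraType (F t) =>
    if clip t p.1 < t then Num.min (tau p.2) t <= clip t p.1 else tau p.2 <= t)).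
  apply: measurable_fun_ifT.
  - by apply: measurable_fun_ltr => //; exact: mclip1.
  - apply: measurable_fun_ler; last exact: mclip1.
    exact: (measurableT_comp (stopping_time_min_wrt stau tT)).
  - have mt : measurable_fun setT (fun w : g_sigma_algebraType (F t) => tau w <= t).
      apply: (measurable_fun_bool true); rewrite setTI.
      rewrite (filtrationE filtF)//.
      by case: stau => _ /(_ t tT).
    exact: (measurableT_comp mt).
apply/funext => p; have /andP[_ ct] := clip_itv p.1 t0.
case: ifPn => h; last by congr (_ <= _); apply/le_anti; rewrite ct leNgt.
by rewrite ge_min [X in _ || X]leNgt h orbF.
Qed.

Let excess_progressive t : 0 <= t <= T ->
  measurable_fun setT (fun p : R * g_sigma_algebraType (F t) => excess (clip t p.1) p.2).
Proof.
move=> tT; have [t0 tT'] := andP tT.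
apply: measurable_fun_ifT => //.
  apply: measurable_and; first exact: tau_le_progressive.
  under eq_fun do rewrite ltNge.
  by apply: measurable_neg; exact: tau_le_progressive.
apply: measurable_funB; first exact: pa.
apply: measurable_funM => //; apply: measurable_funM.
  by apply: measurableT_comp => //; exact: mclip1.
apply: measurable_fun_clip => //.
  by move=> s /andP[s0 st]; exact: (adapted_le filtF aZ).
by move=> w s /andP[s0 st]; apply: rcZ; rewrite s0 (lt_le_trans st).
Qed.

Let mean_Z q : 0 <= q <= T -> (\int[P]_w (Z q w)%:E = \int[P]_w (Z T w)%:E)%E.
Proof.
by move=> qT; apply: martZ => //; exact: (sub_sigma_algebraT (filtration_algebra filtF qT)).
Qed.

Let EZ_fin : (\int[P]_w (Z T w)%:E < +oo)%E.
Proof.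
rewrite -ge0_fin_numE; last by apply: integral_ge0 => w _; rewrite lee_fin.
exact: integrable_fin_num.
Qed.

Let zint w := (\int[lebesgue_measure]_(q in `[0%R, T]) (decay q * Z q w)%:E)%E.

Let zintE w : zint w = (\int[lebesgue_measure]_q
  (if (0 <= q)%R && (q <= T)%R then decay q * Z (clip T q) w else 0)%:E)%E.
Proof.
rewrite /zint integral_mkcond; apply: eq_integral => q _.
by rewrite patchE mem_setE in_itv/=; case: ifP => // qT; rewrite clip_id.
Qed.

Let mzkernel : measurable_fun setT (fun p : Om * R =>
  (if (0 <= p.2) && (p.2 <= T) then decay p.2 * Z (clip T p.2) p.1 else 0)%:E).
Proof.
apply/measurable_EFinP; apply: measurable_fun_ifT => //.
  by apply: measurable_and; apply: measurable_fun_ler.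
apply: measurable_funM; first exact: (measurableT_comp mdecay).
have mp : measurable_fun setT (fun x : Om * R => (x.2, x.1)) by exact: measurable_fun_pair.
exact: (measurableT_comp mZclip mp).
Qed.

Let mzint : measurable_fun setT zint.
Proof. by rewrite (funext zintE); apply: measurable_fun_integral; exact: mzkernel. Qed.

Let zint_ge0 w : (0 <= zint w)%E.
Proof. by apply: integral_ge0 => q _; rewrite lee_fin mulr_ge0 ?expR_ge0. Qed.

(** Tonelli and the constancy in time of the mean of Z; [K] bounds [decay] on [0, T] whatever the
    sign of beta + r. *)
Let izint : (\int[P]_w zint w < +oo)%E.
Proof.
under eq_integral do rewrite zintE.
rewrite [ltLHS](_ : _ = \int[lebesgue_measure]_q \int[P]_w
  (if (0 <= q)%R && (q <= T)%R then decay q * Z (clip T q) w else 0)%:E)%E; last first.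
  have k0 (p : Om * R) : (0 <= (if (0 <= p.2)%R && (p.2 <= T)%R then
      decay p.2 * Z (clip T p.2) p.1 else 0)%:E)%E.
    by rewrite lee_fin; case: ifP => // _; rewrite mulr_ge0 ?expR_ge0.
  exact: (fubini_tonelli (m1 := P) (m2 := @lebesgue_measure R) _ mzkernel k0).
pose K := expR (`|beta + r| * T).
apply: (@le_lt_trans _ _ (\int[lebesgue_measure]_q
    ((K * fine (\int[P]_w (Z T w)%:E)) * \1_(`[0%R, T]) q)%:E)%E).
  apply: ge0_le_integral => //.
  - move=> q _; apply: integral_ge0 => w _; rewrite lee_fin.
    by case: ifP => // _; rewrite mulr_ge0 ?expR_ge0.
  - apply: (measurable_fun_fubini_tonelli_G (m1 := P) _ mzkernel) => p.
    by rewrite lee_fin; case: ifP => // _; rewrite mulr_ge0 ?expR_ge0.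
  - by apply/measurable_EFinP; apply: measurable_funM => //; exact: measurable_indic.
  - move=> q _; rewrite indicE mem_setE in_itv/=.
    case: (boolP ((0 <= q) && (q <= T))) => [qT|_] /=; last by rewrite integral0 mulr0.
    under eq_integral do rewrite clip_id// EFinM.
    rewrite ge0_integralZl//; last 3 first.
    + by apply/measurable_EFinP; exact: (adaptedT filtF aZ).
    + by move=> w _; rewrite lee_fin.
    + by rewrite lee_fin expR_ge0.
    rewrite mean_Z// mulr1 EFinM fineK; last first.
      by rewrite ge0_fin_numE// integral_ge0// => w _; rewrite lee_fin.
    rewrite lee_wpmul2r//; first by rewrite integral_ge0// => w _; rewrite lee_fin.
    rewrite lee_fin ler_expR (le_trans (ler_norm _))// normrN normrM ler_wpM2l//.
    by case/andP: qT => q0 qT; rewrite ger0_norm.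
under eq_integral do rewrite EFinM.
rewrite ge0_integralZl//; last 2 first.
- by apply/measurable_EFinP; exact: measurable_indic.
- rewrite lee_fin mulr_ge0 ?expR_ge0// fine_ge0// integral_ge0// => w _.
  by rewrite lee_fin.
rewrite integral_indic// setIT.
suff : ((K * fine (\int[P]_w (Z T w)%:E))%:E *
    lebesgue_measure (`[0%R, T]%classic : set R) < +oo)%E by exact.
by rewrite lebesgue_measure_itv/= lte_fin T0 oppr0 adde0 -EFinM ltry.
Qed.

Let ae_zint_fin : {ae P, forall w, (zint w < +oo)%E}.
Proof.
have : P.-integrable setT zint.
  apply/integrableP; split; first exact: mzint.
  by under eq_integral do rewrite gee0_abs//.
move=> /(integrable_ae measurableT); apply: filterS => w /(_ I).
by rewrite ge0_fin_numE.
Qed.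

Let excess_dom w : (\int[lebesgue_measure]_(q in `[0%R, T]) `|(excess q w)%:E| <=
  aint 0 w + `|M * (beta + r)|%:E * zint w)%E.
Proof.
have mz : measurable_fun `[0, T] (fun q => (decay q * Z q w)%:E).
  apply: (eq_measurable_fun (fun q => (decay q * Z (clip T q) w)%:E)).
    by move=> q /set_mem; rewrite /= in_itv/= => qT; rewrite clip_id.
  apply: measurable_funTS; apply/measurable_EFinP; apply: measurable_funM => //.
  exact: (measurable_fun_pair1 w mZclip).
rewrite -ge0_integralZl//; last by move=> q _; rewrite lee_fin mulr_ge0 ?expR_ge0.
rewrite -ge0_integralD//; last 4 first.
- by move=> q; rewrite /= in_itv/= => qT; rewrite lee_fin a0.
- exact: ma_itv.
- by move=> q _; rewrite mule_ge0// lee_fin mulr_ge0 ?expR_ge0.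
- exact: measurable_funeM.
apply: ge0_le_integral => //.
- apply: measurableT_comp => //; apply/measurable_EFinP.
  apply: (eq_measurable_fun (fun q => excess (clip T q) w)).
    by move=> q /set_mem; rewrite /= in_itv/= => qT; rewrite clip_id.
  exact: measurable_funTS (measurable_fun_pair1 w mexcess).
- apply: emeasurable_funD; first exact: ma_itv.
  exact: measurable_funeM.
- move=> q; rewrite /= in_itv/= => qT; rewrite -EFinM -EFinD lee_fin /excess.
  have h1 : 0 <= a q w by exact: a0.
  have h2 : 0 <= decay q * Z q w by rewrite mulr_ge0 ?expR_ge0.
  case: ifP => _; last by rewrite normr0 addr_ge0// mulr_ge0.
  by rewrite (le_trans (ler_normB _ _))// [X in _ + X]normrM (ger0_norm h1) (ger0_norm h2).
Qed.

Let iexcess : (\int[P]_w \int[lebesgue_measure]_(q in `[0%R, T]) `|(excess q w)%:E| < +oo)%E.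
Proof.
have ma0 : measurable_fun setT (aint 0).
  by apply: (@measurable_aint_at (fun=> 0)) => // w; rewrite lexx.
apply: (@le_lt_trans _ _ (\int[P]_w (aint 0 w + `|M * (beta + r)|%:E * zint w))%E).
  apply: ge0_le_integral => //.
  - by move=> w _; exact: integral_ge0.
  - rewrite (_ : (fun w => _) = (fun w => \int[lebesgue_measure]_q
      (if (0 <= q) && (q <= T) then `|excess (clip T q) w| else 0)%:E)%E).
      apply: measurable_fun_integral; apply/measurable_EFinP.
      apply: measurable_fun_ifT => //.
        by apply: measurable_and; apply: measurable_fun_ler.
      apply: measurableT_comp => //.
      have mp : measurable_fun setT (fun x : Om * R => (x.2, x.1)).
        exact: measurable_fun_pair.
      exact: (measurableT_comp mexcess mp).
    apply/funext => w; rewrite integral_mkcond; apply: eq_integral => q _.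
    rewrite patchE mem_setE in_itv/=; case: ifP => // qT.
    by rewrite clip_id.
  - by apply: emeasurable_funD => //; exact: measurable_funeM.
rewrite ge0_integralD//; last 3 first.
- by move=> w _; exact: aint_ge0.
- by move=> w _; rewrite mule_ge0.
- exact: measurable_funeM.
rewrite ge0_integralZl// lte_add_pinfty// lte_mul_pinfty//.
Qed.

Let cumul t w := \int[lebesgue_measure]_(q in `[0, t]) excess q w.

Let cumul_wrt t : 0 <= t < T -> measurable_wrt (F t) (cumul t).
Proof.
move=> /andP[t0 tT]; have tT' : 0 <= t <= T by rewrite t0 ltW.
apply: (@measurableT_comp _ _ _ _ _ _ fine); first exact: fine_measurable.
rewrite (_ : (fun w => _) = (fun w : g_sigma_algebraType (F t) => \int[lebesgue_measure]_q
    (if (0 <= q) && (q <= t) then excess (clip t q) w else 0)%:E)%E).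
  apply: measurable_fun_integral; apply/measurable_EFinP.
  apply: measurable_fun_ifT => //.
    by apply: measurable_and; apply: measurable_fun_ler.
  have mp : measurable_fun setT (fun x : g_sigma_algebraType (F t) * R => (x.2, x.1)).
    exact: measurable_fun_pair.
  exact: (measurableT_comp (excess_progressive tT') mp).
apply/funext => w; rewrite integral_mkcond; apply: eq_integral => q _.
rewrite patchE mem_setE in_itv/=; case: ifP => // qT.
by rewrite clip_id.
Qed.

Section increment.
Variables s t : R.
Hypotheses (s0 : 0 <= s) (st : s <= t) (tT : t < T).

Let sT : 0 <= s <= T. Proof. by rewrite s0 (le_trans st (ltW tT)). Qed.
Let tT' : 0 <= t <= T. Proof. by rewrite (le_trans s0 st) ltW. Qed.

Let S w : set R := `[sg s w, sg t w[%classic.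

Let sgT q w : 0 <= q <= T -> 0 <= sg q w <= T.
Proof. by move=> qT; case: (sg_stopping qT) => + _; apply. Qed.

Let sg_le w : sg s w <= sg t w.
Proof.
rewrite /sg le_min !ge_min lexx orbT andbT ge_max !le_max lexx st.
by rewrite orbT.
Qed.

Let S_sub w : S w `<=` `[0, T].
Proof.
move=> q; rewrite /S /= !in_itv/= => /andP[h1 h2].
have /andP[h3 _] := sgT w sT; have /andP[_ h4] := sgT w tT'.
by rewrite (le_trans h3)//= (le_trans (ltW h2)).
Qed.

Let SE q w : (q \in S w) = (s <= q < t) && free q w.
Proof. by rewrite /S mem_setE in_itv/= sg_free. Qed.

Let mS w : measurable (S w : set (measurableTypeR R)).
Proof. exact: (@measurable_itv R). Qed.

Let occup (x : R -> R) w := (\int[lebesgue_measure]_(q in S w) (decay q * x q)%:E)%E.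

Let path_Z w : (zint w < +oo)%E ->
  lebesgue_measure.-integrable `[0, T] (EFin \o (fun q => decay q * Z q w)).
Proof.
move=> zw.
have mz : measurable_fun `[0, T] (fun q => (decay q * Z q w)%:E).
  apply: (eq_measurable_fun (fun q => (decay q * Z (clip T q) w)%:E)).
    by move=> q /set_mem; rewrite /= in_itv/= => qT; rewrite clip_id.
  apply: measurable_funTS; apply/measurable_EFinP; apply: measurable_funM => //.
  exact: (measurable_fun_pair1 w mZclip).
apply/integrableP; split=> //.
apply: le_lt_trans zw; apply: ge0_le_integral => //.
- exact: measurableT_comp.
- by move=> q _; rewrite lee_fin ger0_norm// mulr_ge0 ?expR_ge0.
Qed.

Let path_a w : (aint 0 w < +oo)%E ->
  lebesgue_measure.-integrable `[0, T] (EFin \o a ^~ w).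
Proof.
move=> aw; apply/integrableP; split; first exact: ma_itv.
apply: le_lt_trans aw; apply: ge0_le_integral => //.
- by apply: measurableT_comp => //; exact: ma_itv.
- exact: ma_itv.
- by move=> q; rewrite /= in_itv/= => qT; rewrite lee_fin ger0_norm ?a0.
Qed.

Let path_decay : lebesgue_measure.-integrable `[0, T] (EFin \o decay).
Proof.
apply: measurable_bounded_integrable => //.
- have : (lebesgue_measure (`[0%R, T]%classic : set R) < +oo)%E.
    by rewrite lebesgue_measure_itv/= lte_fin T0 oppr0 adde0 ltry.
  exact.
- exact: measurable_funTS.
- exists (expR (`|beta + r| * T)); split; first exact: num_real.
  move=> B hB q; rewrite /= in_itv/= => /andP[q0 qT].
  rewrite (le_trans _ (ltW hB))// ger0_norm ?expR_ge0// ler_expR.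
  rewrite (le_trans (ler_norm _))// normrN normrM ler_wpM2l//.
  by rewrite ger0_norm.
Qed.

(** Source of the factor beta + r: the part M e^{-(beta+r)t} Z_T of the gap decreases at the rate
    beta + r times itself. *)
Let decay_diff w : decay (sg s w) - decay (sg t w) =
  (beta + r) * \int[lebesgue_measure]_(q in S w) decay q.
Proof.
have iS : lebesgue_measure.-integrable (S w) (EFin \o decay).
  by apply: integrableS path_decay => //; exact: mS.
rewrite Rintegral_itv_bndo_bndc// -RintegralZl//; last first.
  apply: integrableS path_decay => //.
  move=> q; rewrite /= !in_itv/= => /andP[h1 h2].
  have /andP[h3 _] := sgT w sT; have /andP[_ h4] := sgT w tT'.
  by rewrite (le_trans h3)//= (le_trans h2).
by rewrite /decay Rintegral_expR_decay.
Qed.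

Let aint_diff w : (aint 0 w < +oo)%E ->
  fine (aint (sg s w) w) - fine (aint (sg t w) w) = \int[lebesgue_measure]_(q in S w) a q w.
Proof.
move=> aw; have ia := path_a aw.
have /andP[h3 _] := sgT w sT; have /andP[_ h4] := sgT w tT'.
have split_itv : `[sg s w, T]%classic = S w `|` `[sg t w, T]%classic.
  by rewrite -itv_bndbnd_setU// bnd_simp// sg_le.
have -> : fine (aint (sg s w) w) =
    \int[lebesgue_measure]_(q in S w `|` `[sg t w, T]) a q w.
  by rewrite /Rintegral -split_itv.
have -> : fine (aint (sg t w) w) = \int[lebesgue_measure]_(q in `[sg t w, T]) a q w by [].
rewrite Rintegral_setU//=.
- by rewrite addrK.
- apply: integrableS ia => //; first exact: (measurableU _ _ (mS w)).
  move=> q [/S_sub//|]; rewrite /= !in_itv/= => /andP[h1 ->].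
  by rewrite (le_trans h3)// (le_trans (sg_le w)).
- apply/disj_setPS => q []; rewrite /S /= !in_itv/= => /andP[_ h1] /andP[].
  by rewrite leNgt h1.
Qed.

(* The two occupation integrals have the same expectation on F_s-events, because
   Z is a martingale; the increment of [cumul] thus averages like that of [gap]. *)
Let cumul_diff w : (aint 0 w < +oo)%E -> (zint w < +oo)%E ->
  cumul t w - cumul s w = gap (sg t w) w - gap (sg s w) w +
    M * (beta + r) * (fine (occup (fun=> Z T w) w) - fine (occup (Z ^~ w) w)).
Proof.
move=> aw zw; have ia := path_a aw; have iz := path_Z zw.
have iSa : lebesgue_measure.-integrable (S w) (EFin \o a ^~ w).
  by apply: integrableS ia => //; exact: mS.
have iSz : lebesgue_measure.-integrable (S w) (EFin \o (fun q => decay q * Z q w)).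
  by apply: integrableS iz => //; exact: mS.
have iSd : lebesgue_measure.-integrable (S w) (EFin \o decay).
  by apply: integrableS path_decay => //; exact: mS.
have iSMz : lebesgue_measure.-integrable (S w)
    (EFin \o (fun q => M * (beta + r) * (decay q * Z q w))).
  rewrite (_ : _ \o _ = (fun q => (M * (beta + r))%:E * (decay q * Z q w)%:E)%E)//.
  by apply: integrableZl => //; exact: mS.
have iex : lebesgue_measure.-integrable `[0, T] (EFin \o excess ^~ w).
  apply/integrableP; split.
    apply/measurable_EFinP; apply: (eq_measurable_fun (fun q => excess (clip T q) w)).
      by move=> q /set_mem; rewrite /= in_itv/= => qT; rewrite clip_id.
    exact: measurable_funTS (measurable_fun_pair1 w mexcess).
  apply: le_lt_trans (excess_dom w) _; rewrite lte_add_pinfty// lte_mul_pinfty//.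
have cumulE : cumul t w - cumul s w =
    \int[lebesgue_measure]_(q in S w) (a q w - M * (beta + r) * (decay q * Z q w)).
  rewrite /cumul Rintegral_itvB ?bnd_simp//; last first.
    by apply: integrableS iex => //; apply: subset_itvl; rewrite bnd_simp ltW.
  have sub : `[s, t]%classic `<=` `[0, T]%classic.
    move=> q; rewrite /= !in_itv/= => /andP[h1 h2].
    by rewrite (le_trans s0)//= (le_trans h2)// ltW.
  (* End points carry no Lebesgue mass: ]s, t] is traded for [s, t[, the form in which [S] is cut
     out by [free]. *)
  rewrite Rintegral_itv_obnd_cbnd; last first.
    apply: integrableS iex => //; apply: subset_trans sub.
    by apply: subset_itvr; rewrite bnd_simp.
  rewrite -Rintegral_itv_bndo_bndc; last first.
    apply: integrableS iex => //; apply: subset_trans sub.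
    by apply: subset_itvl; rewrite bnd_simp.
  rewrite Rintegral_mkcond [RHS]Rintegral_mkcond; apply: eq_Rintegral => q _.
  rewrite !patchE SE mem_setE in_itv/= /excess.
  by case: (s <= q < t).
rewrite cumulE (RintegralB (mS w) iSa iSMz) (RintegralZl (M * (beta + r)) (mS w) iSz).
have -> : fine (occup (Z ^~ w) w) = \int[lebesgue_measure]_(q in S w) (decay q * Z q w) by [].
have -> : fine (occup (fun=> Z T w) w) = \int[lebesgue_measure]_(q in S w) (decay q * Z T w) by [].
rewrite (RintegralZr (Z T w) (mS w) iSd) -aint_diff// /gap -/(decay _) -/(decay _).
have -> : decay (sg s w) = decay (sg t w) + (beta + r) * \int[lebesgue_measure]_(q in S w) decay q.
  by rewrite -decay_diff addrC subrK.
ring.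
Qed.

Variable A : set Om.
Hypothesis FA : F s A.
Let mA : measurable A. Proof. exact: (filtration_measurable filtF sT). Qed.

(** At a fixed time q >= s, the part of [B] on which q is free is known at q, so y_q may be replaced
    by Z_T. The right side does not involve [y]; the formula serves for Z and for the process
    constantly equal to Z_T. *)
Let integral_occup (y : R -> Om -> R) (B : set Om) : F s B ->
  measurable_fun setT (fun p : R * Om => y (clip T p.1) p.2) ->
  (forall q w, 0 <= y q w) ->
  (forall q, 0 <= q <= T -> forall B, F q B ->
    (\int[P]_(w in B) (y q w)%:E = \int[P]_(w in B) (Z T w)%:E)%E) ->
  (\int[P]_(w in B) occup (y ^~ w) w = \int[lebesgue_measure]_q
     if (s <= q)%R && (q < t)%R then
       (decay q)%:E * \int[P]_(w in B `&` [set w | free q w]) (Z T w)%:E else 0)%E.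
Proof.
move=> FB my y0 marty.
have mB : measurable B by exact: (filtration_measurable filtF sT).
pose k (p : Om * R) : \bar R := (if (p.1 \in B) && ((s <= p.2 < t) && free p.2 p.1)
  then decay p.2 * y (clip T p.2) p.1 else 0)%:E.
have mk : measurable_fun setT k.
  have mswap : measurable_fun setT (fun p : Om * R => (p.2, p.1)) by exact: measurable_fun_pair.
  apply/measurable_EFinP; apply: measurable_fun_ifT => //.
    apply: measurable_and.
      have mb : measurable_fun setT (fun w => w \in B).
        by apply: (measurable_fun_bool true); rewrite setTI preimage_mem_true.
      exact: (measurableT_comp mb).
    apply: measurable_and; last exact: (measurableT_comp mfree mswap).
    by apply: measurable_and; [apply: measurable_fun_ler|apply: measurable_fun_ltr].
  apply: measurable_funM; first exact: (measurableT_comp mdecay).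
  exact: (measurableT_comp my mswap).
have k0 p : (0 <= k p)%E.
  by rewrite lee_fin; case: ifP => // _; rewrite mulr_ge0 ?expR_ge0.
transitivity (\int[P]_w \int[lebesgue_measure]_q k (w, q))%E.
  rewrite integral_mkcond; apply: eq_integral => w _; rewrite patchE /k/=.
  case: ifPn => wB /=; last by rewrite integral0.
  rewrite /occup integral_mkcond; apply: eq_integral => q _.
  rewrite patchE SE; case: ifP => // /andP[/andP[sq qt] _].
  by rewrite clip_id// (le_trans s0 sq) ltW// (lt_trans qt).
rewrite (fubini_tonelli (m1 := P) (m2 := @lebesgue_measure R) _ mk k0).
apply: eq_integral => q _; rewrite /k/=.
case: (boolP ((s <= q) && (q < t))) => [/andP[sq qt]|_] /=; last first.
  by under eq_integral do rewrite andbF; rewrite integral0.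
have qT : 0 <= q <= T by rewrite (le_trans s0 sq) ltW// (lt_trans qt).
have Fq : F q (B `&` [set w | free q w]).
  apply: (filtrationI filtF qT).
    by apply: (filtration_le filtF s0 sq) => //; case/andP: qT.
  have -> : [set w | free q w] = [set w | tau0 w <= q] `\` [set w | tau1 w <= q].
    apply/seteqP; split=> w; rewrite /= /free ltNge.
      by move=> /andP[-> /negP].
    by move=> [-> /negP].
  by apply: (filtrationD filtF qT); [case: stau0|case: stau1] => _; apply.
have mBq := filtration_measurable filtF qT Fq.
rewrite -(marty q qT _ Fq) -ge0_integralZl//; last 3 first.
- apply: measurable_funTS; apply/measurable_EFinP.
  have := measurable_fun_pair2 q my; rewrite /= clip_id//.
- by move=> w _; rewrite lee_fin.
- by rewrite lee_fin expR_ge0.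
rewrite [RHS]integral_mkcond; apply: eq_integral => w _.
rewrite patchE in_setI [in X in _ = if _ && X then _ else _]mem_setE clip_id//=.
by case: ifP.
Qed.

Let mZTclip : measurable_fun setT (fun p : R * Om => (fun _ w => Z T w) (clip T p.1) p.2).
Proof. by apply: measurableT_comp => //; exact: (adaptedT filtF aZ). Qed.

Let integral_occup_eq B : F s B ->
  (\int[P]_(w in B) occup (fun=> Z T w) w = \int[P]_(w in B) occup (Z ^~ w) w)%E.
Proof.
move=> FB; rewrite (integral_occup (y := fun _ w => Z T w) FB)//.
by rewrite (integral_occup (y := Z) FB).
Qed.

Let occup_ge0 x w : (forall q, 0 <= x q) -> (0 <= occup x w)%E.
Proof.
by move=> x0; apply: integral_ge0 => q _; rewrite lee_fin mulr_ge0 ?expR_ge0.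
Qed.

Let moccup (y : R -> Om -> R) :
  measurable_fun setT (fun p : R * Om => y (clip T p.1) p.2) ->
  measurable_fun setT (fun w => occup (y ^~ w) w).
Proof.
move=> my; rewrite (_ : (fun w => _) = (fun w => \int[lebesgue_measure]_q
    (if (s <= q < t) && free q w then decay q * y (clip T q) w else 0)%:E)%E).
  have mswap : measurable_fun setT (fun p : Om * R => (p.2, p.1)) by exact: measurable_fun_pair.
  apply: measurable_fun_integral; apply/measurable_EFinP.
  apply: measurable_fun_ifT => //.
    apply: measurable_and; last exact: (measurableT_comp mfree mswap).
    by apply: measurable_and; [apply: measurable_fun_ler|apply: measurable_fun_ltr].
  apply: measurable_funM; first exact: (measurableT_comp mdecay).
  exact: (measurableT_comp my mswap).
apply/funext => w; rewrite /occup integral_mkcond; apply: eq_integral => q _.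
rewrite patchE SE; case: ifP => // /andP[/andP[sq qt] _].
by rewrite clip_id// (le_trans s0 sq) ltW// (lt_trans qt).
Qed.

Let ioccupZ : P.-integrable setT (fun w => occup (Z ^~ w) w).
Proof.
apply/integrableP; split; first exact: moccup.
apply: le_lt_trans izint; apply: ge0_le_integral => //.
- by apply: measurableT_comp => //; exact: moccup.
- move=> w _; rewrite gee0_abs ?occup_ge0//; apply: ge0_subset_integral => //.
  + apply: (eq_measurable_fun (fun q => (decay q * Z (clip T q) w)%:E)).
      by move=> q /set_mem; rewrite /= in_itv/= => qT; rewrite clip_id.
    apply: measurable_funTS; apply/measurable_EFinP; apply: measurable_funM => //.
    exact: (measurable_fun_pair1 w mZclip).
  + by move=> q _; rewrite lee_fin mulr_ge0 ?expR_ge0.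
Qed.

Let FT : F s setT. Proof. exact: (sub_sigma_algebraT (filtration_algebra filtF sT)). Qed.

Let ioccupT : P.-integrable setT (fun w => occup (fun=> Z T w) w).
Proof.
apply/integrableP; split; first exact: (@moccup (fun _ w => Z T w)).
under eq_integral do rewrite gee0_abs ?occup_ge0//.
rewrite (integral_occup_eq FT); have /integrableP[_] := ioccupZ.
by under eq_integral do rewrite gee0_abs ?occup_ge0//.
Qed.

Let integral_fine_occup (f : Om -> \bar R) : (forall w, (0 <= f w)%E) ->
  P.-integrable setT f -> P.-integrable setT (fun w => (fine (f w))%:E) /\
  (\int[P]_(w in A) (fine (f w))%:E = \int[P]_(w in A) f w)%E.
Proof.
move=> f0 fint; have mf := measurable_int _ fint.
have mff : measurable_fun setT (fun w => (fine (f w))%:E).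
  by apply/measurable_EFinP; apply: measurableT_comp => //; exact: fine_measurable.
split.
  apply: (le_integrable measurableT mff _ fint) => w _.
  by case: (f w) => [x| |]//=; rewrite ?normr0 ?leey.
apply: ae_eq_integral => //; [exact: measurable_funTS|exact: measurable_funTS|].
have := integrable_ae measurableT fint; apply: filterS => w /(_ I) fw _.
by rewrite fineK.
Qed.

(** Off {s < tau1} both stopped times are tau1 and the gap increments cancel. On it no stop occurs
    before [s], when [A] may not yet be known, so the event belongs to the sigma-algebra at
    [sg q]. *)
Let A' := A `&` [set w | s < tau1 w].

Let stopped_A' q : s <= q -> q < T -> stopped_sigma_algebra T F (sg q) A'.
Proof.
move=> sq qT; have FA' : F s A'.
  apply: (filtrationI filtF sT) => //.
  rewrite (_ : [set w | _] = setT `\` [set w | tau1 w <= s]).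
    by apply: (filtrationD filtF sT) => //; case: stau1 => _; apply.
  by apply/seteqP; split=> w /=; rewrite ltNge; [move/negP|case=> _ /negP].
split; first by apply: (filtration_le filtF s0 _ (lexx T)) => //; case/andP: sT.
move=> x /andP[x0 xT]; have [xs|sx] := ltP x s.
  rewrite (_ : _ `&` _ = set0).
    by rewrite -(filtrationE filtF) ?x0//; exact: measurable0.
  apply/seteqP; split=> // w [[_ /= s1]].
  rewrite /sg ge_min ge_max => /orP[/andP[_ qx]|t1x].
    by have := le_lt_trans (le_trans sq qx) xs; rewrite ltxx.
  by have := lt_le_trans s1 (le_trans t1x (ltW xs)); rewrite ltxx.
have xT' : 0 <= x <= T by rewrite x0.
apply: (filtrationI filtF xT'); first exact: (filtration_le filtF s0 sx xT).
have qT' : 0 <= q <= T by rewrite (le_trans s0 sq) ltW.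
by have [_] := sg_stopping qT'; apply.
Qed.

Let mgap_sg q : 0 <= q <= T -> measurable_fun setT (fun w => gap (sg q w) w).
Proof.
move=> qT; apply: mgap_at; first by move=> w; exact: sgT.
exact: (stopping_time_measurable filtF (sg_stopping qT)).
Qed.

Let igap_sg q : 0 <= q <= T -> P.-integrable setT (fun w => (gap (sg q w) w)%:E).
Proof.
move=> qT; have mg := mgap_sg qT; apply/integrableP; split; first exact/measurable_EFinP.
have /integrableP[mgd] := gap_dom_integrable; apply: le_lt_trans.
apply: ae_ge0_le_integral => //.
- by apply: measurableT_comp => //; exact/measurable_EFinP.
- exact: measurableT_comp.
- apply: filterS ae_aint_fin => w aw _; rewrite lee_fin.
  by apply: (le_trans (gap_bound (sgT w qT) aw)); exact: ler_norm.
Qed.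

(** As tau0 < tau1 <= T almost surely, [sg q] stays below [T] for q < T; the restriction in
    [integral_gap_increase] thus removes only a null set. *)
Let gap_sg0 q : s <= q -> q < T -> (\int[P]_(w in A') (gap (sg q w) w)%:E = 0)%E.
Proof.
move=> sq qT; have qT' : 0 <= q <= T by rewrite (le_trans s0 sq) ltW.
have sA' := stopped_A' sq qT.
have mA' := stopped_sub_measurable T0' filtF sA'.
have mlt : measurable [set w | sg q w < T].
  apply: measurable_true; apply: measurable_fun_ltr => //.
  exact: (stopping_time_measurable filtF (sg_stopping qT')).
have ae_lt : {ae P, forall w, sg q w < T}.
  apply: filterS lt01 => w h; have /andP[_ h1] := tau1T w.
  by rewrite /sg gt_min gt_max qT andbT (lt_le_trans h h1).
rewrite -[RHS](integral_gap_increase (sg_stopping qT') sA').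
- rewrite integral_mkcond [RHS]integral_mkcond; apply: ae_eq_integral => //.
  + apply/(measurable_restrictT _ _).1 => //; apply: measurable_funTS.
    by apply/measurable_EFinP; exact: mgap_sg.
  + apply/(measurable_restrictT _ _).1; first exact: measurableI.
    by apply: measurable_funTS; apply/measurable_EFinP; exact: mgap_sg.
  + apply: filterS ae_lt => w h _; rewrite !patchE in_setI.
    by rewrite (mem_set (h : [set w | sg q w < T] w)) andbT.
- apply: filterS2 lt01 inc => w h incw _ x sx; apply: incw sx.
  rewrite /sg le_min ge_min (ltW h) le_max lexx/= lexx orbT.
  by [].
Qed.

Lemma cumul_mart : (\int[P]_(w in A) (cumul t w - cumul s w)%:E = 0)%E.
Proof.
have tleT : t <= T by exact: ltW.
have mcumul q : 0 <= q < T -> measurable_fun setT (cumul q).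
  move=> /andP[q0 qT]; have qT' : 0 <= q <= T by rewrite q0 ltW.
  apply: (measurable_wrtT (filtration_algebra filtF qT') (filtration_measurable filtF qT')).
  by apply: cumul_wrt; rewrite q0.
have [if1 e1] := integral_fine_occup (fun w => occup_ge0 w (fun=> Z0 T w)) ioccupT.
have [if2 e2] := integral_fine_occup (fun w => occup_ge0 w (Z0 ^~ w)) ioccupZ.
have gap0 : (\int[P]_(w in A) (gap (sg t w) w - gap (sg s w) w)%:E = 0)%E.
  have mA' : measurable A' := stopped_sub_measurable T0' filtF (stopped_A' st tT).
  transitivity (\int[P]_(w in A') (gap (sg t w) w - gap (sg s w) w)%:E)%E.
    rewrite integral_mkcond [RHS]integral_mkcond; apply: eq_integral => w _.
    rewrite !patchE /A' in_setI; case: (w \in A) => //=.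
    case: ifPn => // /negP h; have t1s : tau1 w <= s.
      by rewrite leNgt; apply/negP => h'; apply: h; exact: mem_set.
    have -> : sg t w = tau1 w by rewrite /sg min_r// le_max (le_trans t1s st) orbT.
    have -> : sg s w = tau1 w by rewrite /sg min_r// le_max t1s orbT.
    by rewrite subrr.
  rewrite integralB_EFin//.
  - rewrite !gap_sg0// ?sub0e ?oppe0//.
    exact: le_lt_trans tT.
  - by apply: (integrableS measurableT mA') => //; exact: igap_sg.
  - by apply: (integrableS measurableT mA') => //; exact: igap_sg.
have igd : P.-integrable A (fun w => (gap (sg t w) w - gap (sg s w) w)%:E).
  apply: (integrableS measurableT mA) => //.
  rewrite (_ : (fun w => _) = (fun w => (gap (sg t w) w)%:E - (gap (sg s w) w)%:E)%E)//.
  by apply: integrableB => //; exact: igap_sg.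
have iod : P.-integrable A
    (fun w => (fine (occup (fun=> Z T w) w) - fine (occup (Z ^~ w) w))%:E).
  apply: (integrableS measurableT mA) => //.
  rewrite (_ : (fun w => _) = (fun w => (fine (occup (fun=> Z T w) w))%:E - (fine (occup (Z ^~ w) w))%:E)%E)//.
  exact: integrableB.
have iMod : P.-integrable A (fun w => (M * (beta + r) *
    (fine (occup (fun=> Z T w) w) - fine (occup (Z ^~ w) w)))%:E).
  by under eq_fun do rewrite EFinM; exact: integrableZl.
transitivity (\int[P]_(w in A) ((gap (sg t w) w - gap (sg s w) w)%:E +
    (M * (beta + r) * (fine (occup (fun=> Z T w) w) - fine (occup (Z ^~ w) w)))%:E))%E.
  apply: ae_eq_integral => //.
  - apply: measurable_funTS; apply/measurable_EFinP; apply: measurable_funB; apply: mcumul.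
      by rewrite (le_trans s0 st).
    by rewrite s0 (le_lt_trans st).
  - by apply: emeasurable_funD; [exact: measurable_int igd|exact: measurable_int iMod].
  - by apply: filterS2 ae_aint_fin ae_zint_fin => w aw zw _; rewrite cumul_diff.
rewrite integralD//= gap0 add0e.
under eq_integral do rewrite EFinM.
rewrite integralZl// integralB_EFin//.
- rewrite e1 e2 integral_occup_eq// subee ?mule0//.
  by apply: integrable_fin_num => //; exact: integrableS ioccupZ.
- exact: integrableS if1.
- exact: integrableS if2.
Qed.

End increment.

Theorem excess_eq0 :
  {ae P, forall w, {ae lebesgue_measure, forall q, 0 <= q <= T -> excess q w = 0}}.
Proof.
apply: (null_martingale T0 filtF mexcess iexcess cumul_wrt).
by move=> s t A s0 st tT FA; exact: cumul_mart.
Qed.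

End free_region.

End first_order_condition.

(** * From the market model to the abstract setting *)

Lemma noise_filtrationP d (Om : measurableType d) (R : realType) (T : R)
    (P : probability Om R) (B : R -> Om -> R)
    (theta : {sigma_finite_measure set R -> \bar R})
    (v : Om -> {measure set (R * R) -> \bar R}) :
  brownian_motion T P B -> poisson_random_measure T P theta v ->
  filtration T (noise_filtration P B v).
Proof.
move=> [mB _ _ _] [mv _ _ _].
have strip_le s t : s <= t -> @strip R s `<=` strip t.
  by move=> st p; rewrite /strip /= !in_itv/= => -[/andP[-> /le_trans->]].
split.
- by move=> t _; exact: smallest_sigma_algebra.
- move=> s t s0 st tT; apply: sub_sigma_algebra2 => A.
  case=> [[u [X [/andP[u0 us] mX ->]]]|[E [X [mE Es mX ->]]]|A0].
  + by constructor 1; exists u, X; split=> //; rewrite u0 (le_trans us).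
  + by constructor 2; exists E, X; split=> //; exact: (subset_trans Es (strip_le _ _ st)).
  + by constructor 3.
- move=> t /andP[t0 tT]; apply: smallest_sub; first exact: sigma_algebra_measurable.
  move=> A [[u [X [/andP[u0 us] mX ->]]]|[E [X [mE Es mX ->]]]|[]//].
  + by rewrite -[X in measurable X]setTI; apply: mB => //; rewrite u0 (le_trans us).
  + rewrite -[X in measurable X]setTI; apply: mv => //.
    exact: (subset_trans Es (strip_le _ _ tT)).
Qed.

Section price_density.
Context {d : measure_display} {Om : measurableType d} {R : realType}.
Variables (T : R) (P : probability Om R) (F : R -> set (set Om)).
Variable Pstar : probability (g_sigma_algebraType (F T)) R.
Variables (r : R) (psi : R -> Om -> R).
Hypotheses (T0 : 0 < T) (filtF : filtration T F)
  (hpsi : state_price_density T P F Pstar r psi).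

(** The event {psi_t < 0} is known at [t]; its mass under [Pstar], which is nonnegative, is the
    integral of a negative function over it. *)
Lemma state_price_density_ge0_at t : 0 <= t <= T -> {ae P, forall w, 0 <= psi t w}.
Proof.
move=> tT; case: hpsi => apsi _ Epsi.
pose A : set Om := [set w | psi t w < 0].
have FA : F t A.
  have /measurable_wrtP-/(_ (filtration_algebra filtF tT)) := apsi t tT.
  move=> /(_ `]-oo, 0[%classic (measurable_itv _)).
  by congr (F t _); apply/seteqP; split=> w /=; rewrite in_itv.
have mA := filtration_measurable filtF tT FA.
pose k w := (- (expR (r * t) * psi t w))%:E.
have k0 w : A w -> (0 <= k w)%E.
  by move=> Aw; rewrite lee_fin oppr_ge0 mulr_ge0_le0 ?expR_ge0// ltW.
have mk : measurable_fun A k.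
  apply: measurable_funTS; apply/measurable_EFinP; apply: measurable_funN.
  by apply: measurable_funM => //; exact: (adaptedT filtF apsi).
have Ik : (\int[P]_(w in A) k w = 0)%E.
  apply/eqP; rewrite eq_le integral_ge0// andbT -oppe_ge0 -integral_ge0N//.
  under eq_integral do rewrite /k -EFinN opprK.
  by rewrite -Epsi.
have : (\int[P]_(w in A) `|k w| = 0)%E.
  by rewrite -[RHS]Ik; apply: eq_integral => w /set_mem Aw; rewrite gee0_abs ?k0.
move=> /(ae_eq_integral_abs P mA mk); apply: filterS => w h.
rewrite leNgt; apply/negP => pA; have /eqP := h pA.
by rewrite eqe oppr_eq0 mulf_eq0 gt_eqF ?expR_gt0//= lt_eqF.
Qed.

(** Countably many grid times, among them [T], share one null set, and every other time is a limit
    of such times from the right. *)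
Lemma state_price_density_ge0 :
  {ae P, forall w, forall t, 0 <= t <= T -> 0 <= psi t w}.
Proof.
have : {ae P, forall w, forall n k : nat, 0 <= psi (Num.min T (k.+1%:R / n.+1%:R)) w}.
  apply/ae_foralln => n; apply/ae_foralln => k; apply: state_price_density_ge0_at.
  by rewrite le_min ge_min lexx/= andbT divr_ge0// ltW.
apply: filterS => w h t tT; case: hpsi => _ cpsi _.
apply: (@closed_cvg _ _ \oo _ (fun n => psi (grid T n t) w) (fun x => 0 <= x)); first exact: closed_ge.
- by apply: nearW => n; exact: h.
- apply: (@cvg_grid _ T (psi ^~ w)) => // tT'.
  by apply: (cpsi w).1 => //; case/andP: tT.
Qed.

End price_density.

(** Without growth a strictly positive density would integrate to 0 over an interval of positive
    length. At t = tau1 the density is of no help and the last clause of [free_interval] takes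
    over. *)
Lemma free_interval_increasing d (Om : measurableType d) (R : realType) (T : R)
    (P : probability Om R) (C : Om -> cumulative R R) (tau0 tau1 : Om -> R) :
  free_interval T P C tau0 tau1 ->
  {ae P, forall w, forall t q, tau0 w <= t <= tau1 w -> t < q <= T -> C w t < C w q}.
Proof.
move=> [c]; apply: filterS => w [mc c0 Cc C1] t q /andP[t0 t1] /andP[tq qT].
move: t1; rewrite le_eqVlt => /predU1P[tE|t1].
  by rewrite tE; apply: C1; rewrite -tE tq.
(* Cutting at tau1 keeps ]t, b] where dC has the density c. *)
pose b := Num.min q (tau1 w).
have tb : t < b by rewrite lt_min tq.
have bq : b <= q by rewrite ge_min lexx.
apply: (lt_le_trans _ (cumulative_is_nondecreasing (C w) _ _ bq)).
rewrite ltNge; apply/negP => Cbt.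
have sub : `]t, b] `<=` `[tau0 w, tau1 w].
  move=> u; rewrite /= !in_itv/= => /andP[tu ub].
  by rewrite (le_trans t0 (ltW tu)) (le_trans ub)// ge_min lexx orbT.
have mtb : measurable (`]t, b]%classic : set R) by exact: measurable_itv.
have I0 : (\int[lebesgue_measure]_(u in `]t, b]) `|(c u w)%:E| = 0)%E.
  transitivity (dC C w `]t, b]).
    rewrite Cc//; apply: eq_integral => u /set_mem /sub.
    by rewrite /= in_itv/= => ut; rewrite ger0_norm// ltW// c0.
  apply/eqP; rewrite eq_le measure_ge0 andbT.
  by rewrite /dC (stieltjes_itvoc _ (ltW tb)) lee_fin subr_le0.
have mcE : measurable_fun `]t, b] (EFin \o c ^~ w).
  by apply/measurable_EFinP; exact: measurable_funTS.
have [N NP] := (ae_eq_integral_abs (@lebesgue_measure R) mtb mcE).1 I0.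
have [u [utb]] := ae_lebesgue_exists tb (ex_intro _ N NP).
have : `]t, b]%classic u by rewrite /= in_itv.
move=> /[dup] /sub; rewrite /= in_itv/= => uT uI /(_ uI) [cu].
by have := c0 u uT; rewrite cu ltxx.
Qed.

(** The aggregator is only Borel in time: doubling [f] at a single time leaves all integrals over
    time unchanged but doubles the marginal felicity at that time. The identity is therefore stated
    for almost every time, and for each time at which the marginal felicity is right-continuous. *)
Theorem theorem4p5 (R : realType) (T : R) (hT : 0 < T)
  (d : measure_display) (Omega : measurableType d) (P0 : probability Omega R)
  (B : R -> Omega -> R) (hB : brownian_motion T P0 B)
  (theta : {sigma_finite_measure set R -> \bar R}) (htheta : levy_measure theta)
  (v : Omega -> {measure set (R * R) -> \bar R})
  (hv : poisson_random_measure T P0 theta v)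
  (Pstar : probability
     (g_sigma_algebraType (noise_filtration P0 B v T)) R)
  (hequiv : equivalent_on T P0 (noise_filtration P0 B v) Pstar)
  (r beta eta alpha : R) (hbeta : 0 < beta) (heta : 0 <= eta)
  (halpha : 0 < alpha < 2^-1)
  (f : R -> R -> R -> R)
  (hf : measurable_fun (aggregator_domain T)
          (fun x : R * R * R => f x.1.1 x.1.2 x.2))
  (hA1 : condA1 T f) (hA2 : condA2 T f) (hA3 : condA3 T f alpha)
  (hA4 : condA4 T P0 (noise_filtration P0 B v) Pstar alpha)
  (psi : R -> Omega -> R)
  (hpsi : state_price_density T P0 (noise_filtration P0 B v) Pstar r psi)
  (wealth : R) (hwealth : 0 < wealth)
  (C : Omega -> cumulative R R) (U : R -> Omega -> R)
  (hC : optimal_plan T P0 (noise_filtration P0 B v) Pstar f eta beta r wealth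
          C U)
  (G : R -> Omega -> \bar R)
  (hG : is_utility_gradient T P0 (noise_filtration P0 B v) f eta beta C U G)
  (M : R) (hM : 0 < M) (hlagrange : lagrange_multiplier T P0 wealth psi C G M)
  (tau0 tau1 : Omega -> R)
  (htau0 : stopping_time T (noise_filtration P0 B v) tau0)
  (htau1 : stopping_time T (noise_filtration P0 B v) tau1)
  (htau : {ae P0, forall w, tau0 w < tau1 w})
  (hfree : free_interval T P0 C tau0 tau1) :
  {ae P0, forall w,
    {ae lebesgue_measure, forall t : R, tau0 w < t < tau1 w ->
       marginal_felicity f eta beta C U t w
       = M * ((r + beta) / beta) * psi t w} /\
    (forall t : R, tau0 w < t < tau1 w ->
       marginal_felicity f eta beta C U s w @[s --> t^'+]
         --> marginal_felicity f eta beta C U t w ->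
       marginal_felicity f eta beta C U t w
       = M * ((r + beta) / beta) * psi t w)}.
Proof.
have T0 : 0 <= T by exact: ltW.
have TT : 0 <= T <= T by rewrite T0 lexx.
have T00 : 0 <= (0 : R) <= T by rewrite lexx.
have filtF := noise_filtrationP hB hv.
set F := noise_filtration P0 B v in Pstar hequiv hA4 hpsi hC hG htau0 htau1 filtF *.
have psi0 := state_price_density_ge0 hT filtF hpsi.
case: hpsi => apsi cpsi Epsi.
case: hC => [[[C0 CT aC] _] [aU cU _ _] _].
case: hG => oG projG; case: hlagrange => _ leG slackG.
have beta0 := ltW hbeta.
(* psi is nonnegative only almost surely, which [`|psi|] remedies. *)
pose psip t w := `|psi t w|.
have psipE : {ae P0, forall w, forall t, 0 <= t <= T -> psip t w = psi t w}.
  by apply: filterS psi0 => w h t tT; rewrite /psip ger0_norm// h.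
have apsip : adapted T F psip.
  by move=> t tT; apply: measurableT_comp (apsi t tT); exact: normr_measurable.
have rcpsip w s : 0 <= s < T -> psip q w @[q --> s^'+] --> psip s w.
  move=> /andP[s0 sT]; apply: cvg_norm; exact: (cpsi w).1.
have psip0 s w : 0 <= psip s w by exact: normr_ge0.
pose Z t w := expR (r * t) * psip t w.
have mZ t : 0 <= t <= T -> measurable_fun setT (Z t).
  by move=> tT; apply: measurable_funM => //; exact: (adaptedT filtF apsip).
have EZ t A : 0 <= t <= T -> F t A -> (\int[P0]_(w in A) (Z t w)%:E = Pstar A)%E.
  move=> tT FA; rewrite (Epsi t tT A FA); apply: ae_eq_integral.
  - exact: (filtration_measurable filtF tT).
  - by apply: measurable_funTS; apply/measurable_EFinP; exact: mZ.
  - apply: measurable_funTS; apply/measurable_EFinP; apply: measurable_funM => //.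
    exact: (adaptedT filtF apsi).
  - by apply: filterS psipE => w h _; rewrite /Z h.
have FsetT t : 0 <= t <= T -> F t setT.
  by move=> tT; exact: (sub_sigma_algebraT (filtration_algebra filtF tT)).
have PstarT : Pstar [set: Omega] = 1%E := probability_setT Pstar.
have iZ t : 0 <= t <= T -> P0.-integrable setT (EFin \o Z t).
  move=> tT; apply/integrableP; split; first by apply/measurable_EFinP; exact: mZ.
  rewrite (_ : (\int[_]_(w in _) _)%E = Pstar setT).
    by rewrite PstarT ltry.
  rewrite -(EZ t _ tT (FsetT t tT)); apply: eq_integral => w _ /=.
  by rewrite ger0_norm// mulr_ge0 ?expR_ge0.
have martZ t : 0 <= t <= T -> forall A, F t A ->
    (\int[P0]_(w in A) (Z t w)%:E = \int[P0]_(w in A) (Z T w)%:E)%E.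
  move=> /[dup] tT /andP[t0 tT'] A FA; rewrite !EZ//.
  exact: (filtration_le filtF t0 tT' (lexx T)).
(* With this weight the kernel beta e^{-beta(s-t)} F_s is e^{beta t} a_s, so that [t] leaves the
   integrand. *)
pose a s w := beta * expR (- (beta * s)) * marginal_felicity f eta beta C U s w.
have ma : measurable_fun setT (fun p : R * Omega => a (clip T p.1) p.2).
  apply: measurable_funM.
    apply: measurable_funM => //; apply: measurableT_comp => //.
    apply: measurable_funN; apply: measurable_funM => //.
    exact: (measurableT_comp (measurable_clip T)).
  apply: (measurable_marginal_felicity T0 (lexx T)) => //.
  - by move=> s sT; exact: (adaptedT filtF aC).
  - by move=> s sT; exact: (adaptedT filtF aU).
  - by move=> w s /andP[s0 sT]; exact: (cU w).1.
have pa t : 0 <= t <= T -> measurable_fun setT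
    (fun p : R * g_sigma_algebraType (F t) => a (clip t p.1) p.2).
  move=> /[dup] tT /andP[t0 tT']; apply: measurable_funM.
    apply: measurable_funM => //; apply: measurableT_comp => //.
    apply: measurable_funN; apply: measurable_funM => //.
    exact: (measurableT_comp (measurable_clip t)).
  apply: (@measurable_marginal_felicity _ _ (g_sigma_algebraType (F t)) T) => //.
  - by move=> s /andP[s0 st]; exact: (adapted_le filtF aC).
  - by move=> s /andP[s0 st]; exact: (adapted_le filtF aU).
  - by move=> w s /andP[s0 st]; apply: (cU w).1 => //; exact: lt_le_trans tT'.
have a0 s w : 0 <= s <= T -> 0 <= a s w.
  move=> sT; apply: mulr_ge0; first by rewrite mulr_ge0 ?expR_ge0.
  exact: (marginal_felicity_ge0 (T := T)).
pose aint t w := (\int[lebesgue_measure]_(s in `[t, T]) (a s w)%:E)%E.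
have projG' tau : stopping_time T F tau -> forall A, stopped_sigma_algebra T F tau A ->
    (\int[P0]_(w in A) G (tau w) w =
     \int[P0]_(w in A) ((expR (beta * tau w))%:E * aint (tau w) w))%E.
  move=> stau A sA; rewrite (projG tau stau A sA); apply: eq_integral => w _.
  have /andP[t0 _] := stau.1 w.
  have sT s : `[tau w, T]%classic s -> 0 <= s <= T.
    by rewrite /= in_itv/= => /andP[ts ->]; rewrite (le_trans t0).
  rewrite /aint -ge0_integralZl_EFin ?expR_ge0//.
  - apply: eq_integral => s _; rewrite -EFinM; congr EFin.
    rewrite /a mulrBr opprB expRD; ring.
  - by move=> s /sT; rewrite lee_fin; exact: a0.
  - apply/measurable_EFinP; apply: (eq_measurable_fun (fun s => a (clip T s) w)).
      by move=> s /set_mem /sT sT'; rewrite clip_id.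
    by apply: measurable_funTS; exact: (measurable_fun_pair1 w ma).
have st0 : stopping_time T F (fun=> 0).
  split=> [w|t /[dup] tT /andP[t0 _]]; first by rewrite lexx.
  by rewrite (_ : [set w | _] = setT); [exact: FsetT|apply/seteqP; split].
have mG : measurable_fun setT (fun p : R * Omega => G (clip T p.1) p.2).
  apply: (measurable_optional T0 filtF oG) => //.
  - by move=> p; exact: clip_itv.
  - by apply: measurableT_comp => //; exact: measurable_clip.
have mG0 : measurable_fun setT (G 0).
  by apply: (measurable_optional (s := fun=> 0) T0 filtF oG).
have leG' : {ae P0, forall w, forall t, 0 <= t <= T -> (G t w <= (M * psip t w)%:E)%E}.
  by apply: filterS2 leG psipE => w h e t tT; rewrite e//; exact: h.
(* At the constant stopping time 0 the projection has the mean of G_0, at most M times the mean of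
   psi_0, that is M. *)
have iA : (\int[P0]_w aint 0%R w < +oo)%E.
  have := projG' _ st0 _ (stopping_timeT T0 filtF st0).
  under [RHS]eq_integral do rewrite mulr0 expR0 mul1e.
  move=> <-; apply: (@le_lt_trans _ _ (\int[P0]_w (maxe (G 0%R w) 0))%E).
    rewrite integralE funepos.unlock; apply: geeDl.
    by rewrite oppe_le0; exact: integral_ge0.
  apply: (@le_lt_trans _ _ (\int[P0]_w (M%:E * (Z 0%R w)%:E))%E).
    apply: ae_ge0_le_integral => //.
    - by move=> w _; rewrite le_max lexx orbT.
    - exact: measurable_maxe.
    - by move=> w _; rewrite -EFinM lee_fin !mulr_ge0 ?expR_ge0// ltW.
    - by apply: emeasurable_funM => //; apply/measurable_EFinP; exact: mZ.
    - apply: filterS leG' => w h _; rewrite ge_max -EFinM lee_fin /Z mulr0 expR0 mul1r.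
      by rewrite h//= mulr_ge0// ltW.
  rewrite ge0_integralZl_EFin// ?ltW//.
  - by rewrite (EZ _ _ T00 (FsetT _ T00)) PstarT mule1 ltry.
  - by move=> w _; rewrite lee_fin mulr_ge0 ?expR_ge0.
  - by apply/measurable_EFinP; exact: mZ.
have slackG' : (\int[P0]_w \int[lebesgue_stieltjes_measure (C w)]_(t in `[0%R, T])
    (G t w - (M * psip t w)%:E) = 0)%E.
  rewrite -[RHS]slackG.
  (* Trading psi for its absolute value is an almost-sure change under the outer integral, which
     requires both versions to be measurable. *)
  have mS (y : R -> Omega -> R) : adapted T F y ->
      (forall w s, 0 <= s < T -> y q w @[q --> s^'+] --> y s w) ->
      measurable_fun setT (fun w => \int[lebesgue_stieltjes_measure (C w)]_(t in `[0%R, T])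
        (G t w - (M * y t w)%:E))%E.
    move=> ay rcy.
    apply: (measurable_stieltjes (g := fun t w => (G t w - (M * y t w)%:E)%E) hT filtF C0 CT aC).
    apply: emeasurable_funB => //; apply/measurable_EFinP; apply: measurable_funM => //.
    by apply: measurable_fun_clip => // s sT; exact: (adaptedT filtF ay).
  apply: ae_eq_integral => //; first exact: mS.
    by apply: mS => // w s /andP[s0 sT]; exact: (cpsi w).1.
  apply: filterS psipE => w e _; apply: eq_integral => t /set_mem.
  by rewrite /= in_itv/= => tT; rewrite e.
have inc := free_interval_increasing hfree.
have := excess_eq0 hT filtF apsip rcpsip psip0 (iZ T TT) martZ C0 CT aC ma a0 iA oG projG'
  leG' slackG' htau0 htau1 htau inc pa.
apply: filterS2 psipE => w e Ew.
have Q : {ae lebesgue_measure, forall t : R, tau0 w < t < tau1 w ->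
    marginal_felicity f eta beta C U t w = M * ((r + beta) / beta) * psi t w}.
  case: Ew => N [mN N0 NQ]; exists N; split=> // t nQ; apply: NQ => /= h; apply: nQ => /= tt.
  have /andP[t0 t1] := tt.
  have tT : 0 <= t <= T.
    have /andP[h0 _] := htau0.1 w; have /andP[_ h1] := htau1.1 w.
    by rewrite (le_trans h0 (ltW t0)) (le_trans (ltW t1)).
  have := h tT; rewrite (ltW t0) t1/= e//.
  have decayE : expR (- ((beta + r) * t)) * expR (r * t) = expR (- (beta * t)).
    by rewrite -expRD; congr expR; ring.
  rewrite /a [_ * (_ * psi t w)]mulrA decayE => /subr0_eq aE.
  have bne : beta * expR (- (beta * t)) != 0 by rewrite mulf_neq0 ?gt_eqF ?expR_gt0.
  by apply: (mulfI bne); rewrite aE; field; rewrite gt_eqF.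
split=> // t /[dup] tt /andP[t0 t1] rcF.
have tT : 0 <= t < T.
  have /andP[h0 _] := htau0.1 w; have /andP[_ h1] := htau1.1 w.
  by rewrite (le_trans h0 (ltW t0)) (lt_le_trans t1).
(* The times avoid the null set of [Q]; the denominator n + 2, already above 1 for n = 0, keeps them
   strictly before tau1. *)
have /choice[s sP] : forall n : nat, exists s, t < s <= t + (tau1 w - t) / n.+2%:R /\
    (tau0 w < s < tau1 w ->
     marginal_felicity f eta beta C U s w = M * ((r + beta) / beta) * psi s w).
  move=> n; apply: ae_lebesgue_exists Q.
  by rewrite ltrDl divr_gt0// subr_gt0.
have st n : t < s n by case: (sP n) => /andP[].
have s1 n : s n < tau1 w.
  have [/andP[_ sn] _] := sP n; apply: (le_lt_trans sn).
  rewrite -ltrBrDl ltr_pdivrMr// ltr_pMr ?subr_gt0//.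
  by rewrite ltr1n.
have scvg : s n @[n --> \oo] --> t.
  apply: (@squeeze_cvgr _ _ _ _ (fun=> t) (fun n => t + (tau1 w - t) / n.+2%:R)).
  - by near=> n; case: (sP n) => /andP[/ltW -> ->].
  - exact: cvg_cst.
  - suff : t + (tau1 w - t) / n.+2%:R @[n --> \oo] --> t + (tau1 w - t) * 0.
      by rewrite mulr0 addr0.
    apply: cvgD; first exact: cvg_cst.
    apply: cvgM; first exact: cvg_cst.
    by rewrite (cvg_shiftS (fun n => (n.+1%:R : R)^-1)); exact: cvg_harmonic.
have Fs := (cvg_at_rightP _ _ _).1 rcF s (conj st scvg).
have psis := (cvg_at_rightP _ _ _).1 ((cpsi w).1 t (proj1 (andP tT)) (proj2 (andP tT)))
  s (conj st scvg).
have Ks : M * ((r + beta) / beta) * psi (s n) w @[n --> \oo]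
    --> M * ((r + beta) / beta) * psi t w.
  by apply: cvgM => //; exact: cvg_cst.
have Es : (fun n => marginal_felicity f eta beta C U (s n) w) =
    (fun n => M * ((r + beta) / beta) * psi (s n) w).
  by apply/funext => n; rewrite (sP n).2// s1 (lt_trans t0).
by move: Fs; rewrite Es => Fs; exact: (cvg_unique _ Fs Ks).
Unshelve. all: by end_near. Qed.
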